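(* Let $G$ be an IN group and $\omega$ a weight on $G$. Suppose that there exists a non-trivial (i.e. not identically zero) continuous group homomorphism $\Phi:G\to(\mathbb{C},+)$ such that $$\sup_{t\in G}\frac{|\Phi(t)|}{\omega(t)\omega(t^{-1})}<\infty .$$ Then $L^1(G,\omega)$ is not weakly amenable.
   Context: A locally compact group $G$ is an IN group if there is a compact neighborhood $U$ of the unit element such that $gUg^{-1}=U$ for all $g\in G$. A weight on $G$ is a continuous function $\omega:G\to(0,\infty)$ with $\omega(xy)\le\omega(x)\omega(y)$ for all $x,y\in G$ (continuity is a standing assumption). $L^1(G,\omega)=\{f: f\omega\in L^1(G)\}$ (with respect to a left Haar measure) with norm $\|f\|_\omega=\int_G|f(x)|\omega(x)\,dx$ and convolution product is a Banach algebra. A Banach algebra $A$ is weakly amenable if every continuous derivation $D:A\to A^*$ (linear, $D(ab)=a\cdot D(b)+D(a)\cdot b$) is inner, i.e. of the form $a\mapsto a\cdot f-f\cdot a$ for some $f\in A^*$; here $A^*$ has the module actions $\langle x,a\cdot f\rangle=\langle xa,f\rangle$, $\langle x,f\cdot a\rangle=\langle ax,f\rangle$. *)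

(* Defs.v *)
From HB Require Import structures.
From mathcomp Require Import all_boot all_order all_algebra.
From mathcomp Require Import all_classical all_reals all_analysis.
From mathcomp Require Import measurable_realfun complex ring_quotient.

Set Implicit Arguments.
Unset Strict Implicit.
Unset Printing Implicit Defensive.

Import Order.TTheory GRing.Theory Num.Theory.
Import numFieldNormedType.Exports.
Import ComplexField.Normc.

Local Open Scope classical_set_scope.
Local Open Scope ring_scope.
Local Open Scope complex_scope.
Local Open Scope quotient_scope.

(** The module operations and the notions below only involve the norm and the
    product of a Banach algebra, so they are stated for a normed module [A] with
    a multiplication [mul]; MathComp's own algebras are unital, which convolution
    algebras in general are not. *)
Section WeakAmenability.
Context {K : numFieldType} {A : normedModType K}.
Variable mul : A -> A -> A.

Definition in_dual (f : A -> K^o) : Prop := linear f /\ continuous f.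

Definition lact (a : A) (f : A -> K^o) : A -> K^o := fun x => f (mul x a).
Definition ract (f : A -> K^o) (a : A) : A -> K^o := fun x => f (mul a x).

(** Continuity of a map into the dual of [A] for the operator norm:
    [forall x, `|g x| <= e * `|x|] says that [g] has operator norm at most [e]. *)
Definition dual_continuous (D : A -> A -> K^o) : Prop :=
  forall a (e : K), 0 < e ->
    \forall b \near a, forall x, `|D b x - D a x| <= e * `|x|.

Definition continuous_derivation (D : A -> A -> K^o) : Prop :=
  [/\ forall a, in_dual (D a),
      forall (k : K) a b, D (k *: a + b) = k *: D a + D b,
      dual_continuous D &
      forall a b, D (mul a b) = lact a (D b) + ract (D a) b].

Definition weakly_amenable : Prop :=
  forall D, continuous_derivation D ->
    exists2 f, in_dual f & forall a, D a = lact a f - ract f a.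

End WeakAmenability.

HB.mixin Record isTopologicalGroup G & PointedTopological G & Group G := {
  mulg_continuous : continuous (fun x : G * G => (x.1 * x.2)%g);
  invg_continuous : continuous (fun x : G => x^-1%g) }.

(** The distinguished point is arbitrary; it is only there because measurable
    types are pointed. *)
#[short(type="topologicalGroupType")]
HB.structure Definition TopologicalGroup :=
  {G of PointedTopological G & Group G & isTopologicalGroup G}.

Definition IN_group (G : topologicalGroupType) : Prop :=
  exists U : set G, [/\ compact U, nbhs 1%g U &
    forall g : G, [set (g * u * g^-1)%g | u in U] = U].

Record weight (G : topologicalGroupType) (R : realType) := Weight {
  weight_fun :> G -> R;
  weight_continuous : continuous weight_fun;
  weight_gt0 : forall x, 0 < weight_fun x;
  weight_submul : forall x y,
    weight_fun (x * y)%g <= weight_fun x * weight_fun y }.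

Notation borel G := (g_sigma_algebraType (@open G)).

(** Radon in the usual sense for groups that need not be sigma-compact: outer
    regular on Borel sets, inner regular on open sets. *)
Definition left_Haar_measure (R : realType) (G : topologicalGroupType)
    (mu : {measure set (borel G) -> \bar R}) : Prop :=
  [/\ mu setT <> 0%E,
      forall (x : G) (A : set (borel G)), measurable A ->
        mu [set (x * y)%g | y in (A : set G)] = mu A,
      forall K : set G, compact K -> (mu K < +oo)%E,
      forall A : set (borel G), measurable A ->
        mu A = ereal_inf [set mu V | V in [set V : set G | open V /\ A `<=` V]] &
      forall V : set G, open V ->
        mu V = ereal_sup [set mu K | K in [set K : set G | compact K /\ K `<=` V]]].

Section ComplexIntegral.
Context {d : measure_display} {T : measurableType d} {R : realType}.
Variable mu : {measure set T -> \bar R}.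

(** Equivalent to Borel measurability for the topology of [R[i]]. *)
Definition cmeasurable (f : T -> R[i]) : Prop :=
  measurable_fun setT (fun x => complex.Re (f x)) /\
  measurable_fun setT (fun x => complex.Im (f x)).

Definition cintegrable (f : T -> R[i]) : Prop :=
  mu.-integrable setT (fun x => (complex.Re (f x))%:E) /\
  mu.-integrable setT (fun x => (complex.Im (f x))%:E).

Definition cintegral (f : T -> R[i]) : R[i] :=
  Rintegral mu setT (fun x => complex.Re (f x)) +i* Rintegral mu setT (fun x => complex.Im (f x)).

End ComplexIntegral.

Section ComplexMeasurability.
Context {d : measure_display} {T : measurableType d} {R : realType}.
Implicit Types f g : T -> R[i].

Lemma cmeasurable0 : cmeasurable (0 : T -> R[i]).
Proof. by split; exact: measurable_cst. Qed.

Lemma cmeasurableD f g :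
  cmeasurable f -> cmeasurable g -> cmeasurable (f + g).
Proof.
move=> [fr fi] [gr gi]; split.
  rewrite (_ : (fun _ => _) = (fun x => complex.Re (f x)) \+ (fun x => complex.Re (g x))).
    exact: measurable_funD.
  by apply/funext => x /=; rewrite fctE; case: (f x) (g x) => ? ? [].
rewrite (_ : (fun _ => _) = (fun x => complex.Im (f x)) \+ (fun x => complex.Im (g x))).
  exact: measurable_funD.
by apply/funext => x /=; rewrite fctE; case: (f x) (g x) => ? ? [].
Qed.

Lemma cmeasurableZ (k : R[i]) f : cmeasurable f -> cmeasurable (k *: f).
Proof.
case: k => a b [fr fi]; split.
  rewrite (_ : (fun _ => _) =
      (fun x => a * complex.Re (f x)) \- (fun x => b * complex.Im (f x))).
    by apply: measurable_funB; exact: measurable_funM.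
  by apply/funext => x /=; rewrite fctE; case: (f x).
rewrite (_ : (fun _ => _) = (fun x => a * complex.Im (f x)) \+ (fun x => b * complex.Re (f x))).
  by apply: measurable_funD; exact: measurable_funM.
by apply/funext => x /=; rewrite fctE; case: (f x).
Qed.

Lemma normc_ge0 (z : R[i]) : 0 <= normc z.
Proof. by case: z => a b; exact: sqrtr_ge0. Qed.

Lemma measurable_normc f :
  cmeasurable f -> measurable_fun setT (fun x => normc (f x)).
Proof.
move=> [fr fi].
rewrite (_ : (fun _ => _) =
  @Num.sqrt R \o (fun x => complex.Re (f x) ^+ 2 + complex.Im (f x) ^+ 2)).
  apply: measurableT_comp; first by apply: continuous_measurable_fun; exact: sqrt_continuous.
  by apply: measurable_funD; exact: measurable_funX.
by apply/funext => x /=; case: (f x).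
Qed.

End ComplexMeasurability.

Section WeightedL1.
Context {R : realType} {G : topologicalGroupType}.
Variable mu : {measure set (borel G) -> \bar R}.
Variable w : weight G R.
Implicit Types f g : borel G -> R[i].

Definition wnorm f : \bar R := (\int[mu]_x (normc (f x) * w x)%:E)%E.

(** As [w] is continuous and positive, [f] is Borel if and only if [f w] is. *)
Definition wsummable : {pred borel G -> R[i]} :=
  mem [set f | cmeasurable f /\ (wnorm f < +oo)%E].

Lemma wsummableP f : f \in wsummable <-> cmeasurable f /\ (wnorm f < +oo)%E.
Proof. by rewrite inE. Qed.

Lemma measurable_weight : measurable_fun setT (w : borel G -> R).
Proof.
move=> mT; apply: (measurability _ (RGenOInfty.measurableE R)) => //.
move=> /= _ [_ [a ->] <-].
rewrite setTI; apply: sub_sigma_algebra.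
by move/continuousP: (@weight_continuous _ _ w); apply; exact: interval_open.
Qed.

Lemma measurable_wnorm f : cmeasurable f ->
  measurable_fun setT (fun x => (normc (f x) * w x)%:E).
Proof.
move=> mf; apply/measurable_EFinP; apply: measurable_funM.
  exact: measurable_normc.
exact: measurable_weight.
Qed.

Lemma wnorm_integrand_ge0 f x : (0 <= (normc (f x) * w x)%:E)%E.
Proof. by rewrite lee_fin mulr_ge0 ?normc_ge0// ltW// weight_gt0. Qed.

Lemma wnorm_ge0 f : (0 <= wnorm f)%E.
Proof. by apply: integral_ge0 => x _; exact: wnorm_integrand_ge0. Qed.

Lemma wnormD f g : cmeasurable f -> cmeasurable g ->
  (wnorm (f + g)%R <= wnorm f + wnorm g)%E.
Proof.
move=> mf mg; rewrite /wnorm -ge0_integralD//; last 4 first.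
- by move=> x _; exact: wnorm_integrand_ge0.
- exact: measurable_wnorm.
- by move=> x _; exact: wnorm_integrand_ge0.
- exact: measurable_wnorm.
apply: ge0_le_integral => //.
- by move=> x _; exact: wnorm_integrand_ge0.
- by apply: measurable_wnorm; exact: cmeasurableD.
- by apply: emeasurable_funD; exact: measurable_wnorm.
move=> x _; rewrite -EFinD lee_fin -mulrDl ler_wpM2r ?(ltW (weight_gt0 w x))//.
exact: le_normcD.
Qed.

Lemma wnormZ (k : R[i]) f : cmeasurable f ->
  wnorm (k *: f) = ((normc k)%:E * wnorm f)%E.
Proof.
move=> mf; rewrite /wnorm -ge0_integralZl//; last 3 first.
- exact: measurable_wnorm.
- by move=> x _; exact: wnorm_integrand_ge0.
- by rewrite lee_fin normc_ge0.
by apply: eq_integral => x _; rewrite -EFinM mulrA -normcM.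
Qed.

Lemma wnorm0 : wnorm 0 = 0%E.
Proof.
by rewrite /wnorm; apply: integral0_eq => x _; rewrite normc0 mul0r.
Qed.

Lemma wsummable_submod_closed : submod_closed wsummable.
Proof.
split; first by apply/wsummableP; rewrite wnorm0; split => //; exact: cmeasurable0.
move=> k f g /wsummableP[mf lf] /wsummableP[mg lg]; apply/wsummableP.
split; first by apply: cmeasurableD => //; exact: cmeasurableZ.
have mkf := cmeasurableZ k mf.
rewrite (le_lt_trans (wnormD mkf mg))// lte_add_pinfty// wnormZ//.
by rewrite lte_mul_pinfty// lee_fin normc_ge0.
Qed.

HB.instance Definition _ :=
  GRing.isSubmodClosed.Build R[i] (borel G -> R[i]) wsummable
    wsummable_submod_closed.

Record wfun := WFun { wfun_val :> borel G -> R[i]; _ : wfun_val \in wsummable }.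

HB.instance Definition _ := [isSub for wfun_val].
HB.instance Definition _ := [Choice of wfun by <:].
HB.instance Definition _ := [SubChoice_isSubLmodule of wfun by <:].

Lemma wfun_cmeasurable (f : wfun) : cmeasurable f.
Proof. by case: f => f /= /wsummableP[]. Qed.

Lemma wfun_wnorm_fin (f : wfun) : wnorm f \is a fin_num.
Proof. by rewrite ge0_fin_numE ?wnorm_ge0//; case: f => f /= /wsummableP[]. Qed.

Definition wnull : {pred wfun} := mem [set f : wfun | {ae mu, forall x, f x = 0}].

Lemma wnullP (f : wfun) : f \in wnull <-> {ae mu, forall x, f x = 0}.
Proof. by rewrite inE. Qed.

Lemma wnullE (f : wfun) : f \in wnull <-> wnorm f = 0%E.
Proof.
have aeE := ae_eq_integral_abs mu measurableT (measurable_wnorm (wfun_cmeasurable f)).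
have absE : wnorm f = (\int[mu]_x `|(normc (f x) * w x)%:E|)%E.
  by apply: eq_integral => x _; rewrite gee0_abs// wnorm_integrand_ge0.
split=> [/wnullP f0|f0].
  rewrite absE; apply/aeE; apply: filterS f0 => x fx0 _.
  by rewrite fx0 normc0 mul0r.
apply/wnullP; move: f0; rewrite absE => /aeE; apply: filterS => x /(_ I) [].
by move=> /eqP; rewrite mulf_eq0 (gt_eqF (weight_gt0 w x)) orbF => /eqP/eq0_normc.
Qed.

Lemma wnull_zmod_closed : zmod_closed wnull.
Proof.
split; first by apply/wnullP; exact: aeW.
move=> f g /wnullP f0 /wnullP g0; apply/wnullP.
apply: filterS2 f0 g0 => x fx0 gx0.
by rewrite /= -[LHS]/(f x - g x) fx0 gx0 subr0.
Qed.

HB.instance Definition _ := GRing.isZmodClosed.Build wfun wnull wnull_zmod_closed.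

Lemma wnullZ (k : R[i]) (f : wfun) : f \in wnull -> k *: f \in wnull.
Proof.
move=> /wnullP f0; apply/wnullP; apply: filterS f0 => x fx0.
by rewrite -[LHS]/(k *: f x) fx0 scaler0.
Qed.

Definition L1 : Type := Quotient.quot wnull.

HB.instance Definition _ := Choice.on L1.
HB.instance Definition _ := EqQuotient.on L1.
HB.instance Definition _ := ZmodQuotient.on L1.

Lemma L1_eqP (f g : wfun) : \pi_L1 f = \pi_L1 g <-> f - g \in wnull.
Proof.
by rewrite (Quotient.idealrBE wnull f g); split => [->//|/eqP].
Qed.

Definition L1_scale (k : R[i]) (a : L1) : L1 := \pi_L1 (k *: repr a).

Lemma L1_scale_pi k (f : wfun) : L1_scale k (\pi_L1 f) = \pi_L1 (k *: f).
Proof.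
by apply/L1_eqP; rewrite -scalerBr; apply: wnullZ; apply/L1_eqP; rewrite reprK.
Qed.

Lemma pi_L1D (f g : wfun) : \pi_L1 (f + g) = \pi_L1 f + \pi_L1 g.
Proof. exact: (@pi_addr _ _ _ _ _ L1). Qed.

Lemma L1_scaleA (k l : R[i]) (a : L1) :
  L1_scale k (L1_scale l a) = L1_scale (k * l) a.
Proof. by rewrite L1_scale_pi scalerA. Qed.

Lemma L1_scale1 : left_id 1 L1_scale.
Proof. by move=> a; rewrite /L1_scale scale1r reprK. Qed.

Lemma L1_scaleDr : right_distributive L1_scale +%R.
Proof.
move=> k a b; rewrite -[in LHS](reprK a) -[in LHS](reprK b) -pi_L1D L1_scale_pi.
by rewrite scalerDr pi_L1D.
Qed.

Lemma L1_scaleDl (a : L1) : {morph L1_scale^~ a : k l / k + l}.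
Proof. by move=> k l; rewrite /L1_scale scalerDl pi_L1D. Qed.

HB.instance Definition _ := GRing.Zmodule_isLmodule.Build R[i] L1
  L1_scaleA L1_scale1 L1_scaleDr L1_scaleDl.

(** Norms on modules over [R[i]] take their values in [R[i]]. *)
Definition L1_norm (a : L1) : R[i] := (fine (wnorm (repr a)))%:C.

Lemma wnorm_ae_eq (f g : wfun) : f - g \in wnull -> wnorm f = wnorm g.
Proof.
move=> /wnullP fg; apply: ge0_ae_eq_integral => //.
- exact: measurable_wnorm (wfun_cmeasurable f).
- exact: measurable_wnorm (wfun_cmeasurable g).
- by move=> x _; exact: wnorm_integrand_ge0.
- by move=> x _; exact: wnorm_integrand_ge0.
apply: filterS fg => x fgx _.
by have /eqP : f x - g x = 0 by []; rewrite subr_eq0 => /eqP ->.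
Qed.

Lemma L1_norm_pi (f : wfun) : L1_norm (\pi_L1 f) = (fine (wnorm f))%:C.
Proof.
rewrite /L1_norm; congr (fine _)%:C; apply: wnorm_ae_eq.
by apply/L1_eqP; rewrite reprK.
Qed.

Lemma L1_ler_normD (a b : L1) : L1_norm (a + b) <= L1_norm a + L1_norm b.
Proof.
rewrite -[a]reprK -[b]reprK -pi_L1D !L1_norm_pi -rmorphD /= lecR.
rewrite -lee_fin EFinD !fineK ?wfun_wnorm_fin//; last first.
  exact: (wfun_wnorm_fin (repr a + repr b)).
exact: wnormD (wfun_cmeasurable _) (wfun_cmeasurable _).
Qed.

Lemma L1_normrZ (k : R[i]) (a : L1) : L1_norm (k *: a) = `|k| * L1_norm a.
Proof.
rewrite -[a]reprK [_ *: _]L1_scale_pi !L1_norm_pi.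
rewrite [wnorm _](wnormZ k (wfun_cmeasurable (repr a))) fineM ?wfun_wnorm_fin//=.
by rewrite rmorphM /=; case: k.
Qed.

Lemma L1_normr0_eq0 (a : L1) : L1_norm a = 0 -> a = 0.
Proof.
rewrite -[a]reprK L1_norm_pi => /(congr1 (@complex.Re R)) /= n0.
rewrite -[RHS](@pi_zeror _ _ _ _ _ L1); apply/L1_eqP; rewrite subr0; apply/wnullE.
by rewrite -(fineK (wfun_wnorm_fin _)) n0.
Qed.

HB.instance Definition _ := Lmodule_isNormed.Build R[i] L1
  L1_ler_normD L1_normrZ L1_normr0_eq0.

(** [h = f * g] almost everywhere, where
    [(f * g)(x) = \int f(y) g(y^-1 x) dy] *)
Definition is_convolution f g h : Prop :=
  {ae mu, forall x : G,
    let F (y : borel G) := f y * g ((y : G)^-1 * x)%g in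
    cintegrable mu F /\ h x = cintegral mu F}.

(** When [G] is locally compact and [mu] is a left Haar measure, the class of the
    convolution exists and does not depend on the representatives, so that the
    default value [0] is never taken. It is unique by definition of [L1]. *)
Definition L1_conv (a b : L1) : L1 :=
  xget 0 [set c : L1 | is_convolution (repr a) (repr b) (repr c)].

End WeightedL1.

(* Main.v *)
Require Import Defs.
From HB Require Import structures.
From mathcomp Require Import all_boot all_order all_algebra.
From mathcomp Require Import all_classical all_reals all_analysis.
From mathcomp Require Import complex measurable_realfun lra ring.

Import Order.TTheory GRing.Theory Num.Theory.
Import numFieldNormedType.Exports.
Import ComplexField.Normc.

(** A conjugation-invariant compact neighbourhood [U] of [1] gives [W = U U] with
    [1_W(xy) = 1_W(yx)]. By this symmetry,
      [D(a)(c) = \int \int a(x) Phi(x) 1_W(xy) c(y) dy dx]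
    is a derivation. It is bounded: if [xy] is in [W] then, up to constants,
    [w(x^-1) <= w(y)], hence [|Phi(x)| <= w(x) w(x^-1) <= w(x) w(y)].

    The group is unimodular, so the indicator functions of [tU] and [t^-1 U]
    commute under convolution, and an inner derivation would pair them to [0].
    But [D] pairs them to [mu(U) (Phi(t) mu(U) + \int_U Phi)], which cannot vanish
    both for [t = 1] and for some [t] with [Phi(t) <> 0].

    When [G] is not second countable, multiplication need not be measurable for
    the product of the Borel sigma-algebras, and Fubini's theorem does not apply
    directly. Finitely many elements of [L^1] are carried by a sigma-compact open
    subgroup, where the Baire sigma-algebra behaves well with respect to products,
    and regularity provides Baire versions of Borel functions. *)

Local Open Scope classical_set_scope.
Local Open Scope ring_scope.

(** * Complex-valued integrals *)

(** The derivation identity is a cyclic symmetry. In [D(ab)(c)] the kernel at [(y, x, z)] is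
    [Phi(yx) 1_W(yxz)]; additivity splits it, the term with [Phi(y)] is [D(a)(bc)], and in the term
    with [Phi(x)] the equality [1_W(yxz) = 1_W(xzy)] produces [D(b)(ca)]. The set is [U U] and not
    [U] so that [1_W(xy)] is identically [1] for [x] in [tU] and [y] in [t^-1 U], which makes the
    final pairing computable. Elements of [L^1] are classes, while a convolution evaluates a
    representative at [y^-1 x]. Inversion and right translations must therefore preserve null sets,
    and here this comes from unimodularity, long before the final computation. As the measure is
    inner regular only on open sets and on sets of finite measure, inversion invariance is
    established for Baire sets and compact sets inside a sigma-compact open subgroup, and then
    transferred to null sets by compact approximation. *)

Section ComplexNumbers.
Context {R : realType}.
Implicit Types z t : R[i].

Lemma Re_normc z : `|complex.Re z| <= normc z.
Proof.
case: z => a b /=; rewrite -sqrtr_sqr ler_sqrt ?lerDl ?sqr_ge0//.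
by rewrite addr_ge0 ?sqr_ge0.
Qed.

Lemma Im_normc z : `|complex.Im z| <= normc z.
Proof.
case: z => a b /=; rewrite -sqrtr_sqr ler_sqrt ?lerDr ?sqr_ge0//.
by rewrite addr_ge0 ?sqr_ge0.
Qed.

Lemma normc_ReIm z : normc z <= `|complex.Re z| + `|complex.Im z|.
Proof.
case: z => a b /=; rewrite -[leRHS]ger0_norm ?addr_ge0//.
rewrite -sqrtr_sqr ler_sqrt ?sqr_ge0//.
by rewrite sqrrD !real_normK ?num_real// lerD2r lerDl mulrn_wge0// mulr_ge0.
Qed.

Lemma normc_real (a : R) : normc a%:C%C = `|a|.
Proof. by rewrite /= expr0n addr0 sqrtr_sqr. Qed.

Lemma ReD z t : complex.Re (z + t) = complex.Re z + complex.Re t.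
Proof. by case: z t => ? ? []. Qed.

Lemma ImD z t : complex.Im (z + t) = complex.Im z + complex.Im t.
Proof. by case: z t => ? ? []. Qed.

Lemma ReM z t : complex.Re (z * t) =
  complex.Re z * complex.Re t - complex.Im z * complex.Im t.
Proof. by case: z t => ? ? []. Qed.

Lemma ImM z t : complex.Im (z * t) =
  complex.Re z * complex.Im t + complex.Im z * complex.Re t.
Proof. by case: z t => ? ? []. Qed.

Lemma complexP z t : complex.Re z = complex.Re t ->
  complex.Im z = complex.Im t -> z = t.
Proof. by case: z t => ? ? [? ?] /= -> ->. Qed.

End ComplexNumbers.

Section ComplexIntegration.
Context {d : measure_display} {T : measurableType d} {R : realType}.
Implicit Types f g : T -> R[i].

Lemma cmeasurableM {f g} :
  cmeasurable f -> cmeasurable g -> cmeasurable (fun x => f x * g x).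
Proof.
move=> [fr fi] [gr gi]; split.
  under eq_fun do rewrite ReM.
  by apply: measurable_funB; exact: measurable_funM.
under eq_fun do rewrite ImM.
by apply: measurable_funD; exact: measurable_funM.
Qed.

Lemma cmeasurable_real {r : T -> R} :
  measurable_fun setT r -> cmeasurable (fun x => (r x)%:C%C).
Proof. by move=> mr; split => //=; exact: measurable_cst. Qed.

Lemma cmeasurable_cst (z : R[i]) : cmeasurable (fun _ : T => z).
Proof. by split; exact: measurable_cst. Qed.

Lemma cmeasurable_indic (A : set T) :
  measurable A -> cmeasurable (fun x => (\1_A x : R)%:C%C).
Proof. by move=> mA; apply: cmeasurable_real; exact: measurable_indic. Qed.

Variable m : {measure set T -> \bar R}.

Lemma cintegrableP f : cintegrable m f <->
  cmeasurable f /\ (\int[m]_x (normc (f x))%:E < +oo)%E.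
Proof.
split=> [[fr fi]|[mf foo]].
  have mf : cmeasurable f.
    by split; apply/measurable_EFinP; exact: (measurable_int m).
  split => //.
  have := integrableD measurableT (integrable_norm fr) (integrable_norm fi).
  move=> /integrableP[_]; apply: le_lt_trans.
  apply: ge0_le_integral => //.
  - by move=> x _; rewrite lee_fin normc_ge0.
  - by apply/measurable_EFinP; exact: measurable_normc.
  - apply: measurableT_comp => //; apply/measurable_EFinP.
    by apply: measurable_funD; apply: measurableT_comp => //; case: mf.
  - move=> x _ /=; rewrite lee_fin ger0_norm ?addr_ge0//.
    exact: normc_ReIm.
have nf : m.-integrable setT (fun x => (normc (f x))%:E).
  apply/integrableP; split; first exact/measurable_EFinP/measurable_normc.
  by under eq_integral do rewrite gee0_abs ?lee_fin ?normc_ge0//.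
split; apply: le_integrable nf => //.
- by apply/measurable_EFinP; case: mf.
- by move=> x _; rewrite /= lee_fin [leRHS]ger0_norm ?normc_ge0 ?Re_normc.
- by apply/measurable_EFinP; case: mf.
- by move=> x _; rewrite /= lee_fin [leRHS]ger0_norm ?normc_ge0 ?Im_normc.
Qed.

Lemma le_cintegrable {f} (b : T -> R) : cmeasurable f ->
  (forall x, normc (f x) <= b x) -> measurable_fun setT b ->
  (\int[m]_x (b x)%:E < +oo)%E -> cintegrable m f.
Proof.
move=> mf fb mb boo; apply/cintegrableP; split => //.
apply: le_lt_trans boo; apply: ge0_le_integral => //.
- by move=> x _; rewrite lee_fin normc_ge0.
- by apply/measurable_EFinP; exact: measurable_normc.
- exact/measurable_EFinP.
- by move=> x _; rewrite lee_fin.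
Qed.

Lemma cintegrable_cmeasurable {f} : cintegrable m f -> cmeasurable f.
Proof. by move=> /cintegrableP[]. Qed.

Lemma cintegrableZ (k : R[i]) {f} : cintegrable m f ->
  cintegrable m (fun x => k * f x).
Proof.
move=> /cintegrableP[mf foo]; apply/cintegrableP; split.
  exact: cmeasurableM (cmeasurable_cst k) mf.
under eq_integral do rewrite normcM EFinM.
rewrite ge0_integralZl_EFin ?normc_ge0//.
- by rewrite lte_mul_pinfty// lee_fin normc_ge0.
- by move=> x _; rewrite lee_fin normc_ge0.
- by apply/measurable_EFinP; exact: measurable_normc.
Qed.

Lemma eq_cintegral {f g} : f =1 g -> cintegral m f = cintegral m g.
Proof. by move=> fg; congr cintegral; apply/funext. Qed.

Lemma cintegral_D {f g} : cintegrable m f -> cintegrable m g ->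
  cintegral m (fun x => f x + g x) = cintegral m f + cintegral m g.
Proof.
move=> [fr fi] [gr gi]; apply: complexP; rewrite ?(ReD, ImD) /=.
  by under eq_Rintegral do rewrite ReD; exact: RintegralD.
by under eq_Rintegral do rewrite ImD; exact: RintegralD.
Qed.

Lemma cintegral_Z (k : R[i]) {f} : cintegrable m f ->
  cintegral m (fun x => k * f x) = k * cintegral m f.
Proof.
move=> [fr fi]; apply: complexP; rewrite ?(ReM, ImM) /=.
  under eq_Rintegral do rewrite ReM.
  rewrite RintegralB// ?RintegralZl//.
    exact: (integrableZl measurableT _ fr).
  exact: (integrableZl measurableT _ fi).
under eq_Rintegral do rewrite ImM.
rewrite RintegralD// ?RintegralZl//.
  exact: (integrableZl measurableT _ fi).
exact: (integrableZl measurableT _ fr).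
Qed.

Lemma ae_eq_cintegral {f g} : cmeasurable f -> cmeasurable g ->
  {ae m, forall x, f x = g x} -> cintegral m f = cintegral m g.
Proof.
move=> [fr fi] [gr gi] fg; rewrite /cintegral /Rintegral.
congr (fine _ +i* fine _)%C; apply: ae_eq_integral => //;
  try exact/measurable_EFinP.
- by apply: filterS fg => x ->.
- by apply: filterS fg => x ->.
Qed.

Lemma ae_eq_cintegrable {f g} : cmeasurable f -> cmeasurable g ->
  {ae m, forall x, f x = g x} -> cintegrable m f -> cintegrable m g.
Proof.
move=> mf mg fg /cintegrableP[_ foo]; apply/cintegrableP; split => //.
rewrite -(@ge0_ae_eq_integral _ _ _ m setT (fun x => (normc (f x))%:E))//.
- by apply/measurable_EFinP; exact: measurable_normc.
- by apply/measurable_EFinP; exact: measurable_normc.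
- by move=> x _; rewrite lee_fin normc_ge0.
- by move=> x _; rewrite lee_fin normc_ge0.
- by apply: filterS fg => x ->.
Qed.

(* The constant 2 (instead of 1) is harmless and avoids polar coordinates. *)
Lemma normc_cintegral {f} (b : T -> R) : cmeasurable f ->
  (forall x, normc (f x) <= b x) -> measurable_fun setT b ->
  (\int[m]_x (b x)%:E < +oo)%E ->
  normc (cintegral m f) <= 2 * fine (\int[m]_x (b x)%:E).
Proof.
move=> mf fb mb boo.
have [fr fi] := le_cintegrable b mf fb mb boo.
have bi : m.-integrable setT (EFin \o b).
  apply/integrableP; split; first exact/measurable_EFinP.
  under eq_integral do rewrite gee0_abs ?lee_fin ?(le_trans (normc_ge0 _) (fb _))//.
  by [].
rewrite (le_trans (normc_ReIm _))//= mulr2n mulrDl mul1r lerD//.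
  rewrite (le_trans (le_normr_Rintegral _ _))//.
  apply: le_Rintegral => //; first exact: integrable_norm.
  by move=> x _; exact: le_trans (Re_normc _) (fb x).
rewrite (le_trans (le_normr_Rintegral _ _))//.
apply: le_Rintegral => //; first exact: integrable_norm.
by move=> x _; exact: le_trans (Im_normc _) (fb x).
Qed.

(** The pushforward of [m] by [phi] is [m], which settles nonnegative functions; the positive and
    negative parts of [f] are then treated separately, whether or not [f] is integrable. *)
Lemma integral_preserving (phi : T -> T) (f : T -> \bar R) :
  measurable_fun setT phi ->
  (forall A, measurable A -> m (phi @^-1` A) = m A) -> measurable_fun setT f ->
  (\int[m]_x f (phi x) = \int[m]_x f x)%E.
Proof.
move=> mphi phiP mf.
have ge0 (g : T -> \bar R) : measurable_fun setT g -> (forall x, 0 <= g x)%E ->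
    (\int[m]_x g (phi x) = \int[m]_x g x)%E.
  move=> mg g0; transitivity (\int[pushforward m phi]_x g x)%E.
    by rewrite ge0_integral_pushforward.
  apply: eq_measure_integral => A mA _.
  exact: phiP.
rewrite integralE [RHS]integralE; congr (_ - _)%E.
  by rewrite (funepos_comp f phi) -(ge0 f^\+%E)//; exact: measurable_funepos.
by rewrite (funeneg_comp f phi) -(ge0 f^\-%E)//; exact: measurable_funeneg.
Qed.

Lemma cintegral_preserving (phi : T -> T) f :
  measurable_fun setT phi ->
  (forall A, measurable A -> m (phi @^-1` A) = m A) -> cmeasurable f ->
  cintegral m (fun x => f (phi x)) = cintegral m f.
Proof.
move=> mphi phiP [fr fi]; rewrite /cintegral /Rintegral.
congr (fine _ +i* fine _)%C.
  by apply: (integral_preserving phi (fun x => (complex.Re (f x))%:E)) => //;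
    exact/measurable_EFinP.
by apply: (integral_preserving phi (fun x => (complex.Im (f x))%:E)) => //;
  exact/measurable_EFinP.
Qed.

Lemma cmeasurable_comp {d'} {T' : measurableType d'} (phi : T' -> T) f :
  measurable_fun setT phi -> cmeasurable f -> cmeasurable (fun x => f (phi x)).
Proof.
by move=> mphi [fr fi]; split; [exact: measurableT_comp fr mphi|
                                exact: measurableT_comp fi mphi].
Qed.

End ComplexIntegration.

Lemma ae_imp {d : measure_display} {T : measurableType d} {R : realType}
    {m : {measure set T -> \bar R}} {P Q : T -> Prop} :
  {ae m, forall x, P x} -> (forall x, P x -> Q x) -> {ae m, forall x, Q x}.
Proof. by move=> aeP PQ; apply: filterS aeP. Qed.

Lemma ae_imp2 {d : measure_display} {T : measurableType d} {R : realType}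
    {m : {measure set T -> \bar R}} {P Q S : T -> Prop} :
  {ae m, forall x, P x} -> {ae m, forall x, Q x} ->
  (forall x, P x -> Q x -> S x) -> {ae m, forall x, S x}.
Proof. by move=> aeP aeQ PQS; apply: filterS2 aeP aeQ. Qed.

(** * Restriction of a measure to a measurable set *)

Section Restriction.
Context {d : measure_display} {T : measurableType d} {R : realType}.
Variable m : {measure set T -> \bar R}.
Context {H : set T} (mH : measurable H).
Variable lam : {measure set T -> \bar R}.
Hypothesis lamE : forall A, measurable A -> lam A = m (A `&` H).

(** [m] is the sum of its restrictions to [H] and to the complement, and [f] vanishes almost
    everywhere for the second. The restriction [lam] is known only through [lamE], so that a
    sigma-finite measure can take its place. *)
Lemma integral_restr (f : T -> \bar R) : measurable_fun setT f ->
  (forall x, ~ H x -> f x = 0%E) -> (\int[lam]_x f x = \int[m]_x f x)%E.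
Proof.
move=> mf f0.
have ge0 (g : T -> \bar R) : measurable_fun setT g -> (forall x, 0 <= g x)%E ->
    (forall x, ~ H x -> g x = 0%E) -> (\int[lam]_x g x = \int[m]_x g x)%E.
  move=> mg gge0 g0.
  pose n1 : {measure set T -> \bar R} := mrestr m mH.
  pose n2 : {measure set T -> \bar R} := mrestr m (measurableC mH).
  rewrite [RHS](eq_measure_integral (measure_add n1 n2)); last first.
    move=> A mA _; transitivity (n1 A + n2 A)%E; last exact/esym/measure_addE.
    rewrite /n1 /n2 /= /mrestr [LHS](_ : _ = m ((A `&` H) `|` (A `&` ~` H))); last first.
      by rewrite -setIUr setUv setIT.
    rewrite [LHS]measureU//; [exact: measurableI|by apply: measurableI => //; exact: measurableC|].
    by rewrite setIACA setICr setI0.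
  rewrite ge0_integral_measure_add// [X in (_ + X)%E](_ : _ = 0%E) ?adde0.
    by apply: eq_measure_integral => A mA _; rewrite lamE.
  transitivity (\int[n2]_x cst 0%E x)%E; last exact: integral0.
  apply: ge0_ae_eq_integral => //.
  exists H; split => //.
    by rewrite /n2 /= /mrestr setICr measure0.
  by move=> x; apply: contra_notP => Hx /= _; exact: g0.
rewrite integralE [RHS]integralE; congr (_ - _)%E; apply: ge0 => //.
- exact: measurable_funepos.
- by move=> x Hx; rewrite funeposE f0// maxxx.
- exact: measurable_funeneg.
- by move=> x Hx; rewrite funenegE f0// oppe0 maxxx.
Qed.

Lemma cintegral_restr (f : T -> R[i]) : cmeasurable f ->
  (forall x, ~ H x -> f x = 0) -> cintegral lam f = cintegral m f.
Proof.
move=> [fr fi] f0; rewrite /cintegral /Rintegral.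
congr (fine _ +i* fine _)%C; apply: integral_restr; try exact/measurable_EFinP.
  by move=> x Hx; rewrite f0.
by move=> x Hx; rewrite f0.
Qed.

Lemma cintegrable_restr (f : T -> R[i]) :
  (forall x, ~ H x -> f x = 0) -> cintegrable lam f <-> cintegrable m f.
Proof.
move=> f0; split=> /cintegrableP[mf foo]; apply/cintegrableP; split => //.
  rewrite -integral_restr//; first by apply/measurable_EFinP; exact: measurable_normc.
  by move=> x Hx; rewrite f0// normc0.
rewrite integral_restr//; first by apply/measurable_EFinP; exact: measurable_normc.
by move=> x Hx; rewrite f0// normc0.
Qed.

Lemma ae_restr (P : T -> Prop) : {ae m, forall x, P x} -> {ae lam, forall x, P x}.
Proof.
move=> [N [mN N0 PN]]; exists N; split => //; rewrite lamE//.
by apply: subset_measure0 N0 => //; exact: measurableI.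
Qed.

Lemma restr_ae (P : T -> Prop) : {ae lam, forall x, P x} ->
  {ae m, forall x, H x -> P x}.
Proof.
move=> [N [mN N0 PN]]; exists (N `&` H); split; first exact: measurableI.
  by rewrite -lamE.
by move=> x /= /not_implyP[Hx nPx]; split => //; exact: PN.
Qed.

End Restriction.

(* [fine] sends infinite inner integrals to [0], which happens on a null set. *)
Lemma fine_fubini {d1 d2 : measure_display} {T1 : measurableType d1}
    {T2 : measurableType d2} {R : realType}
    {m1 : {sigma_finite_measure set T1 -> \bar R}}
    {m2 : {sigma_finite_measure set T2 -> \bar R}} (f : T1 * T2 -> R) :
  (m1 \x m2)%E.-integrable setT (EFin \o f) ->
  (\int[m1]_x (fine (\int[m2]_y (f (x, y))%:E))%:E =
   \int[m1]_x \int[m2]_y (f (x, y))%:E)%E.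
Proof.
move=> fi; have Fi := integrable_fubini_F fi.
apply: ae_eq_integral => //.
- apply/measurable_EFinP.
  apply: (measurableT_comp (fine_measurable measurableT)).
  exact: (measurable_fubini_F fi).
- exact: (measurable_fubini_F fi).
- by apply: filterS (integrable_ae measurableT Fi) => x + xT => /(_ xT) /fineK.
Qed.

(** * Fubini's theorem for complex-valued functions *)

Section ComplexFubini.
Context {d1 d2 : measure_display} {T1 : measurableType d1}
  {T2 : measurableType d2} {R : realType}.
Variables (m1 : {sigma_finite_measure set T1 -> \bar R})
  (m2 : {sigma_finite_measure set T2 -> \bar R}).

Lemma measurable_fubini (f : T1 * T2 -> \bar R) : measurable_fun setT f ->
  measurable_fun setT (fun x => \int[m2]_y f (x, y))%E.
Proof.
move=> mf; under eq_fun do rewrite integralE.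
have mI (g : T1 * T2 -> \bar R) : measurable_fun setT g -> (forall p, 0 <= g p)%E ->
    measurable_fun setT (fun x => \int[m2]_y g (x, y))%E.
  by move=> mg g0; exact: measurable_fun_fubini_tonelli_F.
apply: emeasurable_funB.
  rewrite (_ : (fun _ => _) = fun x => (\int[m2]_y f^\+%E (x, y))%E); last first.
    by apply/funext => x; apply: eq_integral => y _; rewrite !funeposE.
  by apply: mI => //; exact: measurable_funepos.
rewrite (_ : (fun _ => _) = fun x => (\int[m2]_y f^\-%E (x, y))%E); last first.
  by apply/funext => x; apply: eq_integral => y _; rewrite !funenegE.
by apply: mI => //; exact: measurable_funeneg.
Qed.

Variable F : T1 * T2 -> R[i].
Hypothesis mF : cmeasurable F.

Lemma cmeasurable_pair1 x : cmeasurable (fun y => F (x, y)).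
Proof. exact: (cmeasurable_comp (pair x)). Qed.

Lemma cmeasurable_pair2 y : cmeasurable (fun x => F (x, y)).
Proof. exact: (cmeasurable_comp (pair^~ y)). Qed.

Lemma cmeasurable_cfubini : cmeasurable (fun x => cintegral m2 (fun y => F (x, y))).
Proof.
have fineP (f : T1 * T2 -> R) : measurable_fun setT f ->
    measurable_fun setT (fun x => fine (\int[m2]_y (f (x, y))%:E)).
  move=> mf; apply: (measurableT_comp (fine_measurable measurableT)).
  by apply: (measurable_fubini (EFin \o f)); exact/measurable_EFinP.
by case: mF => Fr Fi; split; [exact: fineP Fr|exact: fineP Fi].
Qed.

Let mnF : measurable_fun setT (fun p => (normc (F p))%:E).
Proof. by apply/measurable_EFinP; exact: measurable_normc. Qed.

Hypothesis Foo : (\int[m1]_x \int[m2]_y (normc (F (x, y)))%:E < +oo)%E.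

Let F_int : cintegrable (m1 \x m2)%E F.
Proof.
apply/cintegrableP; split => //.
rewrite (fubini_tonelli1 (fun p => (normc (F p))%:E))// => p.
by rewrite lee_fin normc_ge0.
Qed.

Lemma ae_cintegrable_pair :
  {ae m1, forall x, cintegrable m2 (fun y => F (x, y))}.
Proof.
case: F_int => /ae_integrable1 Fr /ae_integrable1 Fi.
by apply: filterS2 Fr Fi.
Qed.

Let fine_fubini2 (f : T1 * T2 -> R) : (m1 \x m2)%E.-integrable setT (EFin \o f) ->
  (\int[m2]_y (fine (\int[m1]_x (f (x, y))%:E))%:E =
   \int[m2]_y \int[m1]_x (f (x, y))%:E)%E.
Proof.
move=> fi; apply: (fine_fubini (fun p => f (p.2, p.1))); apply/integrable12ltyP.
  apply/measurable_EFinP; apply: (measurableT_comp (f := f)).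
    by apply/measurable_EFinP; exact: measurable_int fi.
  by apply/measurable_fun_pairP; split; [exact: measurable_snd|exact: measurable_fst].
exact: (integrable21ltyP m1 m2 (measurable_int _ fi)).1 fi.
Qed.

Lemma cFubini :
  cintegral m1 (fun x => cintegral m2 (fun y => F (x, y))) =
  cintegral m2 (fun y => cintegral m1 (fun x => F (x, y))).
Proof.
case: F_int => Fr Fi; rewrite /cintegral /Rintegral /=.
congr (fine _ +i* fine _)%C.
  exact: (etrans (fine_fubini (fun p => complex.Re (F p)) Fr)
    (etrans (Fubini Fr) (esym (fine_fubini2 _ Fr)))).
exact: (etrans (fine_fubini (fun p => complex.Im (F p)) Fi)
  (etrans (Fubini Fi) (esym (fine_fubini2 _ Fi)))).
Qed.

Let cintegrable_fine (f : T1 * T2 -> R) : (m1 \x m2)%E.-integrable setT (EFin \o f) ->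
  m1.-integrable setT (fun x => (fine (\int[m2]_y (f (x, y))%:E))%:E).
Proof.
move=> fi; have Fi := integrable_fubini_F fi.
apply: le_integrable Fi => //.
  apply/measurable_EFinP; apply: (measurableT_comp (fine_measurable measurableT)).
  exact: (measurable_fubini_F fi).
(* [fine] replaces infinite values by [0], so it does not increase the absolute value. *)
by move=> x _; rewrite /fubini_F /=; case: (integral _ _ _) => //= *; rewrite normr0 leey.
Qed.

Lemma cintegrable_cfubini :
  cintegrable m1 (fun x => cintegral m2 (fun y => F (x, y))).
Proof.
by case: F_int => Fr Fi; split; [exact: cintegrable_fine Fr|exact: cintegrable_fine Fi].
Qed.

End ComplexFubini.

(** * Sigma-compact open subgroups *)

(** The finite subcover argument: [F] is generated by the upper cones of the members of [M] inside
    [O], which are directed by unions, and compactness in its near-covering form yields one member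
    for all points of [K]. It serves for Baire sets, for product-measurable sets and for negligible
    sets. *)
Lemma compact_sub_basic {X : topologicalType} (M : set (set X)) (K O : set X) :
  M set0 -> (forall V W, M V -> M W -> M (V `|` W)) ->
  (forall x, O x -> exists V, [/\ M V, open V, V x & V `<=` O]) ->
  compact K -> K `<=` O -> exists V, [/\ M V, K `<=` V & V `<=` O].
Proof.
move=> M0 MU Mbase /compact_near_coveringP cK KO.
pose D := [set V | M V /\ V `<=` O].
pose F := filter_from D (fun V => [set W | D W /\ V `<=` W]).
have FF : Filter F.
  apply: filter_from_filter; first by exists set0; split => //; exact: sub0set.
  move=> V W [MV VO] [MW WO]; exists (V `|` W).
    by split; [exact: MU|rewrite subUset].
  move=> Z [DZ]; rewrite subUset => -[VZ WZ]; by split.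
have [x Kx|V [MV VO] KV] := cK _ F (fun V => V) FF.
  have [V [MV oV Vx VO]] := Mbase _ (KO _ Kx).
  exists (V, [set W | D W /\ V `<=` W]) => /=.
    by split; [exact: open_nbhs_nbhs|exists V].
  by move=> [y W] /= [Vy [_ VW]]; exact: VW.
by exists V; split => //; apply: KV; split.
Qed.

Lemma compact_image {X Y : topologicalType} (f : X -> Y) (A : set X) :
  continuous f -> compact A -> compact [set f x | x in A].
Proof. by move=> cf; apply: continuous_compact; apply: continuous_subspaceT. Qed.

Lemma continuous_compact_le {R : realType} {X : topologicalType} (K : set X) (f : X -> R) :
  compact K -> continuous f -> exists2 M, 0 <= M & forall x, K x -> f x <= M.
Proof.
move=> cK cf; have [M [_ fM]] := compact_bounded (compact_image _ _ cf cK).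
exists `|M + 1| => // x Kx; apply: le_trans (ler_norm _) _.
apply: le_trans (ler_norm _); apply: (fM (M + 1)); first by rewrite ltrDl.
by exists x.
Qed.

Section TopologicalGroup.
Context {G : topologicalGroupType}.
Implicit Types (A B K : set G) (x y : G).

Lemma continuous_mulg {X : topologicalType} (f g : X -> G) :
  continuous f -> continuous g -> continuous (fun t => (f t * g t)%g).
Proof.
move=> cf cg t; apply: (@continuous_comp _ _ _ (fun t => (f t, g t)) (fun p => p.1 * p.2)%g).
  by apply: cvg_pair; [exact: cf|exact: cg].
exact: mulg_continuous.
Qed.

Lemma continuous_invg {X : topologicalType} (f : X -> G) :
  continuous f -> continuous (fun t => (f t)^-1%g).
Proof.
move=> cf t; apply: (@continuous_comp _ _ _ f (fun x => x^-1%g)); first exact: cf.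
exact: invg_continuous.
Qed.

Lemma continuous_lmulg x : continuous (fun y => (x * y)%g).
Proof. by apply: continuous_mulg => y; [exact: cvg_cst|exact: cvg_id]. Qed.

Lemma continuous_rmulg x : continuous (fun y => (y * x)%g).
Proof. by apply: continuous_mulg => y; [exact: cvg_id|exact: cvg_cst]. Qed.

Lemma compact_mulg A B : compact A -> compact B ->
  compact [set (p.1 * p.2)%g | p in A `*` B].
Proof.
move=> cA cB; apply: (compact_image (fun p : G * G => (p.1 * p.2)%g)).
  exact: mulg_continuous.
exact: compact_setX.
Qed.

Lemma compact_invg A : compact A -> compact [set x^-1%g | x in A].
Proof. by apply: compact_image; exact: invg_continuous. Qed.

Definition sigma_compact A :=
  exists2 P : nat -> set G, (forall n, compact (P n)) & A = \bigcup_n P n.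

Lemma sigma_compactU A B :
  sigma_compact A -> sigma_compact B -> sigma_compact (A `|` B).
Proof.
move=> [P cP ->] [Q cQ ->]; exists (fun n => P n `|` Q n) => [n|].
  exact: compactU.
by rewrite bigcupU.
Qed.

Lemma compact_sigma_compact K : compact K -> sigma_compact K.
Proof. by move=> cK; exists (fun=> K) => //; rewrite bigcup_const//; exists 0%N. Qed.

Record open_sigma_subgroup (H : set G) : Prop := OpenSigmaSubgroup {
  oss_open : open H;
  oss_sigma : sigma_compact H;
  oss1 : H 1%g;
  ossM : forall x y, H x -> H y -> H (x * y)%g;
  ossV : forall x, H x -> H x^-1%g }.

(** This is the subgroup generated by [A] and a compact neighbourhood of [1]: open because it
    contains that neighbourhood, sigma-compact because there are only countably many finite words in
    the compact pieces and their inverses. *)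
Lemma sub_open_sigma_subgroup A : locally_compact [set: G] -> sigma_compact A ->
  exists2 H, open_sigma_subgroup H & A `<=` H.
Proof.
move=> lcG sA.
have [U U1 [cU _]] : exists2 U, nbhs (1%g : G) U & compact U /\ closed U.
  have [U U1 [cU clU]] := lcG 1%g I.
  exists U => //; move: U1; rewrite /within /= => /filterS; apply => x; exact.
have [P cP PE] := sigma_compactU _ _ sA (compact_sigma_compact _ cU).
pose S n := P n `|` [set x^-1%g | x in P n].
(* A list of indices [n1, ..., nk] encodes the set of products [s1 ... sk] with [si] in [S ni]. *)
pose W := foldr (fun n B => [set (p.1 * p.2)%g | p in S n `*` B]) [set 1%g : G].
have cW l : compact (W l).
  elim: l => [|n l IH]; first exact: compact_set1.
  by apply: compact_mulg => //; apply: compactU => //; exact: compact_invg.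
have Wcat l1 l2 x y : W l1 x -> W l2 y -> W (l1 ++ l2) (x * y)%g.
  elim: l1 x => [|n l IH] x; first by move=> -> ; rewrite mul1g.
  move=> [[a b] /= [Sa Wb] <-] Wy; exists (a, (b * y)%g) => /=; last by rewrite mulgA.
  by split => //; exact: IH.
have SV n x : S n x -> S n x^-1%g.
  by move=> [Px|[y Py <-]]; [right; exists x|left; rewrite invgK].
have Wrev l x : W l x -> W (rev l) x^-1%g.
  elim: l x => [|n l IH] x; first by move=> ->; rewrite invg1.
  move=> [[a b] /= [Sa Wb] <-]; rewrite rev_cons -cats1 invgM.
  apply: Wcat; first exact: IH.
  by exists (a^-1, 1)%g; rewrite ?mulg1//; split => //; exact: SV.
pose H := \bigcup_l W l.
have PH : \bigcup_n P n `<=` H.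
  move=> x [n _ Px]; exists [:: n] => //=.
  by exists (x, 1%g); rewrite /= ?mulg1//; split => //; left.
have HM x y : H x -> H y -> H (x * y)%g.
  by move=> [l1 _ W1] [l2 _ W2]; exists (l1 ++ l2) => //; exact: Wcat.
exists H; last by apply: subset_trans PH; rewrite -PE; exact: subsetUl.
split => //.
- rewrite openE => x Hx.
  have := @continuous_lmulg x^-1%g x U; rewrite mulVg => /(_ U1) xU.
  rewrite /interior /=; apply: (filterS _ (xU : nbhs x [set y | U (x^-1 * y)%g])) => y /= Uy.
  rewrite -(mulVKg x y) -{1}(invgK x); apply: HM; first by rewrite invgK.
  by apply: PH; rewrite -PE; right.
(* Enumeration of all words; an integer that encodes no word contributes the empty set. *)
- exists (fun n => if choice.unpickle n is Some l then W l else set0) => [n|].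
    by case: choice.unpickle => // ; exact: compact0.
  apply/seteqP; split => x.
    by move=> [l _ Wl]; exists (choice.pickle l) => //; rewrite choice.pickleK.
  by move=> [n _]; case: choice.unpickle => // l Wl; exists l.
- by exists [::].
- by move=> x [l _ Wl]; exists (rev l) => //; exact: Wrev.
Qed.

Section Subgroup.
Context {H : set G} (HH : open_sigma_subgroup H).

Lemma ossMr x y : H x -> H (x * y)%g -> H y.
Proof. by move=> Hx Hxy; rewrite -(mulKg x y); apply: ossM => //; exact: ossV. Qed.

Lemma ossMl x y : H y -> H (x * y)%g -> H x.
Proof. by move=> Hy Hxy; rewrite -(mulgK y x); apply: ossM => //; exact: ossV. Qed.

(** The complement of an open subgroup is a union of open cosets. *)
Lemma oss_closed : closed H.
Proof.
rewrite -openC openE => x nHx.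
have H1 : nbhs (1%g : G) H.
  by apply: open_nbhs_nbhs; split; [exact: oss_open|exact: oss1].
have := @continuous_lmulg x^-1%g x H; rewrite mulVg => /(_ H1) xH; rewrite /interior /=.
apply: (filterS _ (xH : nbhs x [set y | H (x^-1 * y)%g])) => y /= Hxy Hy.
apply: nHx; rewrite -(invgK x); apply: ossV => //.
exact: ossMl Hxy.
Qed.

(** A total substitute for restricting to [H], continuous since [H] is open and closed. After
    precomposition with it, group operations become measurable from products of sigma-algebras to
    the Baire sigma-algebra. *)
Definition retr x := if x \in H then x else 1%g.

Lemma retr_id x : H x -> retr x = x.
Proof. by move=> Hx; rewrite /retr mem_set. Qed.

Lemma retr_in x : H (retr x).
Proof. by rewrite /retr; case: ifPn => [/set_mem//|_]; exact: oss1. Qed.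

Lemma retr_continuous : continuous retr.
Proof.
move=> x V; rewrite nbhs_simpl /= => nV; have [Hx|nHx] := pselect (H x).
  move: nV; rewrite retr_id// => nV.
  near=> y; rewrite /= retr_id//; first exact: (near nV y).
  near: y; by apply: open_nbhs_nbhs; split => //; exact: oss_open.
move: nV; rewrite {1}/retr memNset// => /nbhs_singleton V1.
near=> y; rewrite /= /retr memNset//; near: y.
apply: open_nbhs_nbhs; split => //; apply: closed_openC; exact: oss_closed.
Unshelve. all: by end_near. Qed.

End Subgroup.

End TopologicalGroup.
Arguments retr {G} H x.

(** * Baire sets *)

(** The sigma-algebra generated by these sets is the smallest one that makes all continuous real
    functions measurable. *)
Definition cozero (R : realType) (G : topologicalGroupType) : set (set G) :=
  [set A | exists2 phi : G -> R, continuous phi & A = [set x | 0 < phi x]].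

Notation baire R G := (g_sigma_algebraType (@cozero R G)).

Lemma open_gt0 {R : realType} {X : topologicalType} (phi : X -> R) :
  continuous phi -> open [set x | 0 < phi x].
Proof. by move=> /continuousP /(_ [set y : R | 0 < y]); apply; exact: open_gt. Qed.

Lemma open_setX {X Y : topologicalType} (A : set X) (B : set Y) :
  open A -> open B -> open (A `*` B).
Proof.
move=> oA oB; rewrite openE => -[x y] [/= Ax By]; exists (A, B) => //=.
by split; apply: open_nbhs_nbhs.
Qed.

Section Baire.
Context {R : realType} {G : topologicalGroupType}.
Implicit Types (K O : set G).

Lemma measurable_to_baire {d : measure_display} {T : measurableType d}
    (f : T -> baire R G) :
  (forall phi : G -> R, continuous phi -> measurable [set t | 0 < phi (f t)]) ->
  measurable_fun setT f.
Proof.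
move=> mf; apply: (@measurability _ _ T (baire R G) setT f (@cozero R G) erefl).
by move=> _ [_ [phi cphi ->] <-]; rewrite setTI; exact: mf.
Qed.

Lemma continuous_baire (s : G -> G) : continuous s ->
  measurable_fun setT (s : baire R G -> baire R G).
Proof.
move=> cs; apply: measurable_to_baire => phi cphi; apply: sub_sigma_algebra.
exists (phi \o s) => // x; apply: continuous_comp; [exact: cs|exact: cphi].
Qed.

Lemma baire_sub_borel (A : set G) :
  measurable (A : set (baire R G)) -> measurable (A : set (borel G)).
Proof.
apply: smallest_sub; first exact: sigma_algebra_measurable.
by move=> _ [phi cphi ->]; apply: sub_sigma_algebra; exact: open_gt0.
Qed.

Lemma measurable_id_baire : measurable_fun setT (id : borel G -> baire R G).
Proof. by move=> _ A mA; rewrite setTI; exact: baire_sub_borel. Qed.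

Lemma continuous_measurable_baire (phi : G -> R) : continuous phi ->
  measurable_fun setT (phi : baire R G -> R).
Proof.
move=> cphi; move=> mT; apply: (measurability _ (RGenOInfty.measurableE R)) => //.
move=> _ [_ [a ->] <-]; rewrite setTI; apply: sub_sigma_algebra.
exists (fun x => phi x - a).
  by move=> x; apply: cvgB; [exact: cphi|exact: cvg_cst].
by apply/seteqP; split => x /=; rewrite in_itv /= andbT subr_gt0.
Qed.

Hypothesis hG : hausdorff_space G.
Hypothesis lcG : locally_compact [set: G].

(** Complete regularity of locally compact Hausdorff spaces: a function [f] that separates [x] from
    the complement of [O] gives the cozero set of [1 - f]. *)
Lemma cozero_base O x : open O -> O x ->
  exists V, [/\ @cozero R G V, open V, V x & V `<=` O].
Proof.
move=> oO Ox.
have : @uniform_separator G [set x] (~` O).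
  by apply: (@locally_compact_completely_regular _ R) => //; exact: open_closedC.
move=> /(@uniform_separatorP _ R)[f [cf _ fx fO]].
have cg : continuous (fun y => 1 - f y).
  by move=> y; apply: cvgB; [exact: cvg_cst|exact: cf].
exists [set y | 0 < 1 - f y]; split.
- by exists (fun y => 1 - f y).
- exact: open_gt0.
- by rewrite /= (fx (f x)) ?subr0//; exists x.
- move=> y /= fy; apply: contrapT => nOy; move: fy.
  by rewrite (fO (f y)) ?subrr ?ltxx//; exists y.
Qed.

Lemma compact_sub_baire K O : compact K -> open O -> K `<=` O ->
  exists V, [/\ measurable (V : set (baire R G)), K `<=` V & V `<=` O].
Proof.
move=> cK oO; apply: (compact_sub_basic (@measurable _ (baire R G))) => //.
  by move=> V W; exact: measurableU.
move=> x /(cozero_base _ _ oO)[V [cV oV Vx VO]]; exists V; split => //.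
exact: sub_sigma_algebra.
Qed.

Context {H : set G} (HH : open_sigma_subgroup H).

(** The indicator function of an open and closed set is continuous. *)
Lemma measurable_oss : measurable (H : set (baire R G)).
Proof.
apply: sub_sigma_algebra.
have Hloc (x : G) : \forall y \near x, (y \in H) = (x \in H).
  have [Hx|nHx] := pselect (H x).
    have : nbhs x H by apply: open_nbhs_nbhs; split => //; exact: oss_open.
    by apply: filterS => y Hy; rewrite !mem_set.
  have : nbhs x (~` H).
    by apply: open_nbhs_nbhs; split => //; exact/closed_openC/(oss_closed HH).
  by apply: filterS => y nHy; rewrite !memNset.
exists (fun x => if x \in H then 1 else 0 : R).
  move=> x V; rewrite nbhs_simpl /= => /nbhs_singleton Vx.
  by apply: filterS (Hloc x) => y /= ->.
apply/seteqP; split => x /=; first by move=> Hx; rewrite mem_set.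
by case: ifPn => [/set_mem//|]; rewrite ltxx.
Qed.

(* Only on sigma-compact sets do continuous maps respect the product of the
   Baire sigma-algebras: there a cozero set of [G * G] is a countable union of
   compact sets, each of which finitely many rectangles cover. *)
Lemma measurable_cozero_prod (psi : G * G -> R) : continuous psi ->
  measurable ((H `*` H) `&` [set p | 0 < psi p] : set (baire R G * baire R G)).
Proof.
move=> cpsi; have [P cP HE] := oss_sigma _ HH.
pose O : set (G * G) := (H `*` H) `&` [set p | 0 < psi p].
pose K (l : nat * nat * nat) := (P l.1.1 `*` P l.1.2) `&` [set p | l.2.+1%:R^-1 <= psi p].
have cK l : compact (K l).
  apply: compact_closedI; first exact: compact_setX.
  apply: (@closed_comp _ _ psi [set t | l.2.+1%:R^-1 <= t]); last exact: closed_ge.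
  by move=> p _; exact: cpsi.
have KO l : K l `<=` O.
  move=> [x y] [[/= Px Py] pp]; split; last by apply: lt_le_trans pp; rewrite invr_gt0.
  by split; rewrite HE; [exists l.1.1|exists l.1.2].
have base p : O p -> exists V, [/\ measurable (V : set (baire R G * baire R G)),
    open (V : set (G * G)), V p & V `<=` O].
  move=> [[Hp1 Hp2] pp].
  have : nbhs p O.
    apply: open_nbhs_nbhs; split; last by split.
    apply: openI; last exact: open_gt0.
    apply: open_setX; exact: oss_open.
  move=> [[A B] [/= nA nB] AB].
  have [A' [cA' oA' A'p A'A]] := cozero_base _ _ (open_interior A) nA.
  have [B' [cB' oB' B'p B'B]] := cozero_base _ _ (open_interior B) nB.
  exists (A' `*` B'); split => //.
  - by apply: measurableX; exact: sub_sigma_algebra.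
  - exact: open_setX.
  - apply: subset_trans AB => -[x y] [/= /A'A Ax /B'B By].
    by split; exact: interior_subset.
have cover l : exists V, [/\ measurable (V : set (baire R G * baire R G)), K l `<=` V & V `<=` O].
  apply: (@compact_sub_basic (G * G)%type
    (@measurable _ (baire R G * baire R G)%type) (K l) O) => //.
  by move=> V W; exact: measurableU.
have [V VP] := choice cover.
rewrite (_ : _ `&` _ = \bigcup_l V l).
  by apply: countable_bigcupT_measurable => // l; case: (VP l).
apply/seteqP; split => [[x y] [[/= Hx Hy] pxy]|p [l _]]; last first.
  by case: (VP l) => _ _; exact.
move: Hx Hy; rewrite HE => -[i _ Px] [j _ Py].
have [k kpsi] : exists k, k.+1%:R^-1 < psi (x, y).
  by have [k _ hk] := near_infty_natSinv_lt (PosNum pxy); exists k; exact: (hk k (leqnn k)).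
exists (i, j, k) => //; case: (VP (i, j, k)) => _ + _; apply.
by split => //=; exact: ltW.
Qed.

(** The preimage of a cozero set is the preimage, under the measurable map [rr], of the part inside
    [H * H] of a cozero set of [G * G], and that part is product measurable. *)
Lemma measurable_baire_prod (s : G * G -> G) : continuous s ->
  measurable_fun setT (fun p : baire R G * baire R G =>
    s (retr H p.1, retr H p.2) : baire R G).
Proof.
move=> cs; apply: measurable_to_baire => phi cphi.
pose rr (p : baire R G * baire R G) : baire R G * baire R G := (retr H p.1, retr H p.2).
have mrr : measurable_fun setT rr.
  have mr := continuous_baire _ (retr_continuous HH).
  apply/measurable_fun_pairP; split.
    exact: (measurableT_comp mr measurable_fst).
  exact: (measurableT_comp mr measurable_snd).
have cpsi : continuous (phi \o s).
  by move=> p; apply: continuous_comp; [exact: cs|exact: cphi].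
have := mrr measurableT _ (measurable_cozero_prod _ cpsi).
rewrite setTI; congr measurable; apply/seteqP; split => p /=; first by case.
by move=> ?; split => //; split; exact: retr_in.
Qed.

End Baire.

(** * Regularity of Haar measure *)

Lemma sigma_finite_restriction {d : measure_display} {T : measurableType d}
    {R : realType} (m : {measure set T -> \bar R}) (H : set T) :
  measurable H ->
  (exists F : nat -> set T, [/\ forall n, measurable (F n),
     forall n, (m (F n `&` H) < +oo)%E & H `<=` \bigcup_n F n]) ->
  exists lam : {sigma_finite_measure set T -> \bar R},
    forall A, measurable A -> lam A = m (A `&` H).
Proof.
move=> mH [F [mF Foo HF]].
pose lam : {measure set T -> \bar R} := mrestr m mH.
have sf : sigma_finite setT lam.
  (* The complement of [H] has measure zero for the restriction, so adding it turns a cover of [H]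
     into a cover of the whole space by sets of finite measure. *)
  exists (fun n => F n `|` ~` H).
    apply/seteqP; split => x _ //; have [Hx|nHx] := pselect (H x); last by exists 0%N => //; right.
    by have [n _ Fx] := HF _ Hx; exists n => //; left.
  move=> n; split; first by apply: measurableU => //; exact: measurableC.
  by rewrite /lam /= /mrestr setIUl setICl setU0.
pose lam' : {sigma_finite_measure set T -> \bar R} := HB.pack (mrestr m mH)
  (Measure_isSigmaFinite.Build _ _ _ (mrestr m mH) sf).
by exists lam'.
Qed.

Section Haar.
Context {R : realType} {G : topologicalGroupType}.
Context {mu : {measure set (borel G) -> \bar R}}.
Hypothesis hG : hausdorff_space G.
Hypothesis lcG : locally_compact [set: G].
Hypothesis Hmu : left_Haar_measure mu.
Implicit Types (A E K O : set G).

Lemma open_borel O : open O -> measurable (O : set (borel G)).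
Proof. exact: sub_sigma_algebra. Qed.

Lemma closed_borel K : closed K -> measurable (K : set (borel G)).
Proof.
by move=> cK; rewrite -(setCK K); apply: measurableC; apply: open_borel; exact: closed_openC.
Qed.

Lemma compact_borel K : compact K -> measurable (K : set (borel G)).
Proof. by move=> /(compact_closed hG); exact: closed_borel. Qed.

Lemma continuous_borel (s : G -> G) : continuous s ->
  measurable_fun setT (s : borel G -> borel G).
Proof.
move=> cs; apply: (@measurability _ _ (borel G) (borel G) setT s (@open G) erefl).
move=> _ [V oV <-]; rewrite setTI; apply: open_borel.
by move: cs => /continuousP; apply.
Qed.

Lemma continuous_measurable_borel (phi : G -> R) : continuous phi ->
  measurable_fun setT (phi : borel G -> R).
Proof.
move=> cphi; apply: (measurableT_comp (f := phi : baire R G -> R)).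
  exact: continuous_measurable_baire.
exact: measurable_id_baire.
Qed.

Lemma haar_compact K : compact K -> (mu K < +oo)%E.
Proof. by case: Hmu => _ _ + _ _; exact. Qed.

Lemma haar_left (x : G) (A : set (borel G)) : measurable A ->
  mu ((fun y : borel G => (x * (y : G))%g : borel G) @^-1` A) = mu A.
Proof.
move=> mA; case: Hmu => _ inv _ _ _; rewrite -[RHS](inv x^-1%g A mA); congr (mu _).
apply/seteqP; split => [y /= Axy|_ [y Ay <-]] /=; last by rewrite mulVKg.
by exists (x * (y : G))%g; rewrite ?mulKg.
Qed.

Lemma haar_outer (A : set (borel G)) (e : R) : measurable A -> (mu A < +oo)%E -> 0 < e ->
  exists O, [/\ open O, A `<=` O & (mu O < mu A + e%:E)%E].
Proof.
move=> mA Aoo e0; case: Hmu => _ _ _ /(_ A mA) out _.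
have : (mu A < mu A + e%:E)%E by rewrite lteDl ?lte_fin// ge0_fin_numE.
rewrite {1}out => /ereal_inf_lt[y [V [oV AV] Vy] yA].
by exists V; rewrite Vy.
Qed.

Lemma haar_inner_open O (e : R) : open O -> (mu O < +oo)%E -> 0 < e ->
  exists K, [/\ compact K, K `<=` O & (mu O < mu K + e%:E)%E].
Proof.
move=> oO Ooo e0; case: Hmu => _ _ _ _ /(_ O oO) inn.
have fO : mu O \is a fin_num by rewrite ge0_fin_numE.
have : (mu O - e%:E < mu O)%E by rewrite lteBlDr// lteDl ?lte_fin.
rewrite {2}inn => /ereal_sup_gt[y [K [cK KO] Ky]].
by rewrite -Ky lteBlDr// => KV; exists K.
Qed.

Lemma haar_diff (A B : set (borel G)) (e : R) : measurable A -> measurable B ->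
  B `<=` A -> (mu A < +oo)%E -> (mu A < mu B + e%:E)%E -> (mu (A `\` B) < e%:E)%E.
Proof.
move=> mA mB BA Aoo AB.
have Boo : mu B \is a fin_num.
  by rewrite ge0_fin_numE// (le_lt_trans _ Aoo)// le_measure ?inE.
by rewrite measureD// setIidr// lteBlDl.
Qed.

(** Inner regularity passes from open sets to Borel sets of finite measure: take [O] open around
    [E], [K0] compact in [O], and remove from [K0] an open set [V] of small measure that contains
    [O \ E]. What remains is compact and inside [E]. *)
Lemma haar_inner (E : set (borel G)) (e : R) : measurable E -> (mu E < +oo)%E -> 0 < e ->
  exists K, [/\ compact K, K `<=` E & (mu (E `\` K) < e%:E)%E].
Proof.
(* The set lost lies in the union of [O \ K0], of measure below [e4], and [V], of measure below
   [e4 + e4]. *)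
move=> mE Eoo e0; pose e4 := e / 4.
have e40 : 0 < e4 by rewrite divr_gt0.
have [ O [oO EO OE]] := haar_outer _ _ mE Eoo e40.
have mO := open_borel _ oO.
have Ooo : (mu O < +oo)%E by rewrite (lt_trans OE)// lte_add_pinfty// ltry.
have [K0 [cK0 K0O OK0]] := haar_inner_open _ _ oO Ooo e40.
have mK0 := compact_borel _ cK0.
have DE : (mu (O `\` E) < e4%:E)%E by exact: haar_diff.
have DK : (mu (O `\` K0) < e4%:E)%E by exact: haar_diff.
have mD : measurable (O `\` E : set (borel G)) by exact: measurableD.
have [|V [oV DV VD]] := haar_outer _ _ mD _ e40; first by rewrite (lt_trans DE)// ltry.
have mV := open_borel _ oV.
exists (K0 `\` V); split.
- apply: compact_closedI => //; exact: open_closedC.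
- move=> x [K0x nVx]; apply: contrapT => nEx; apply: nVx; apply: DV.
  by split => //; exact: K0O.
- have sub : E `\` (K0 `\` V) `<=` (O `\` K0) `|` V.
    move=> x [Ex nKx]; have [Vx|nVx] := pselect (V x); first by right.
    by left; split; [exact: EO|move=> K0x; apply: nKx].
  have le1 : (mu (E `\` (K0 `\` V)) <= mu ((O `\` K0) `|` V))%E.
    apply: le_measure; rewrite ?inE//; first by do 2 apply: measurableD => //.
    by apply: measurableU => //; exact: measurableD.
  apply: (le_lt_trans le1); apply: (le_lt_trans (measureU2 _ _ _)) => //.
    exact: measurableD.
  have VD' : (mu V < e4%:E + e4%:E)%E by rewrite (lt_trans VD)// lteD2rE.
  apply: (lt_trans (lteD DK VD')); rewrite -!EFinD lte_fin /e4; lra.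
Qed.

(** Baire sets squeezed between [K] and open sets of measure close to [mu K] are intersected. The
    compact set itself is in general not Baire. *)
Lemma compact_baire_hull K : compact K ->
  exists Z, [/\ measurable (Z : set (baire R G)), K `<=` Z & mu (Z `\` K) = 0%E].
Proof.
move=> cK; have mK := compact_borel _ cK; have Koo := haar_compact _ cK.
have step (n : nat) : exists Z, [/\ measurable (Z : set (baire R G)), K `<=` Z &
    (mu (Z `\` K) <= (n.+1%:R^-1)%:E)%E].
  have n0 : 0 < n.+1%:R^-1 :> R by rewrite invr_gt0.
  have [ O [oO KO OK]] := haar_outer _ _ mK Koo n0.
  have [Z [mZ KZ ZO]] := compact_sub_baire (R := R) hG lcG _ _ cK oO KO.
  exists Z; split => //.
  have Ooo : (mu O < +oo)%E by rewrite (lt_trans OK)// lte_add_pinfty// ltry.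
  have mZb := baire_sub_borel _ mZ.
  have mO := open_borel _ oO.
  apply/ltW/(le_lt_trans _ (haar_diff _ _ _ mO mK KO Ooo OK)).
  apply: le_measure; rewrite ?inE//; [exact: measurableD|exact: measurableD|].
  exact: setSD.
have [Z ZP] := choice step.
exists (\bigcap_n Z n); split.
- by apply: bigcapT_measurable => n; case: (ZP n).
- by move=> x Kx n _; case: (ZP n) => _ + _; exact.
- apply/eqP; rewrite eq_le measure_ge0 andbT; apply/lee_addgt0Pr => e e0.
  rewrite add0e; have [n _ /(_ _ (leqnn n)) ne] := near_infty_natSinv_lt (PosNum e0).
  case: (ZP n) => mZ _ Zn; apply: (@le_trans _ _ (n.+1%:R^-1)%:E%E); last first.
    by rewrite lee_fin; exact: ltW ne.
  apply: le_trans Zn; apply: le_measure; rewrite ?inE//.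
  + apply: measurableD => //; apply: bigcapT_measurable => k.
    by case: (ZP k) => mZk _ _; exact: (baire_sub_borel _ mZk).
  + by apply: measurableD => //; exact: (baire_sub_borel _ mZ).
  + by apply: setSD => x; exact.
Qed.

Lemma finite_sigma_compact (E : set (borel G)) : measurable E -> (mu E < +oo)%E ->
  exists P : nat -> set G, [/\ forall n, compact (P n), \bigcup_n P n `<=` E &
    mu (E `\` \bigcup_n P n) = 0%E].
Proof.
move=> mE Eoo.
have step (n : nat) : exists K, [/\ compact K, K `<=` E & (mu (E `\` K) < (n.+1%:R^-1)%:E)%E].
  by apply: haar_inner => //; rewrite invr_gt0.
have [P PP] := choice step; exists P; split.
- by move=> n; case: (PP n).
- by move=> x [n _ Px]; case: (PP n) => _ + _; exact.
- have mP n : measurable (P n : set (borel G)) by apply: compact_borel; case: (PP n).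
  apply/eqP; rewrite eq_le measure_ge0 andbT; apply/lee_addgt0Pr => e e0.
  rewrite add0e; have [n _ /(_ _ (leqnn n)) ne] := near_infty_natSinv_lt (PosNum e0).
  case: (PP n) => _ _ /ltW Pn; apply: (@le_trans _ _ (n.+1%:R^-1)%:E%E); last first.
    by rewrite lee_fin; exact: ltW ne.
  apply: le_trans Pn; apply: le_measure; rewrite ?inE//.
  + by apply: measurableD => //; exact: bigcupT_measurable.
  + exact: measurableD.
  + by apply: setDS => x Px; exists n.
Qed.

(** Inner regularity makes [E] a countable union of compact sets up to a null set, and each compact
    set has a Baire hull with null excess. *)
Lemma borel_ae_baire (E : set (borel G)) : measurable E -> (mu E < +oo)%E ->
  exists2 Z, measurable (Z : set (baire R G)) & {ae mu, forall x, E x <-> Z x}.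
Proof.
move=> mE Eoo; have [P [cP PE P0]] := finite_sigma_compact _ mE Eoo.
have [Z ZP] := choice (fun n => compact_baire_hull _ (cP n)).
have mP n : measurable (P n : set (borel G)) by exact: compact_borel.
have mZ n : measurable (Z n : set (borel G)).
  by case: (ZP n) => mZn _ _; exact: (baire_sub_borel _ mZn).
exists (\bigcup_n Z n); first by apply: bigcupT_measurable => n; case: (ZP n).
have mPU : measurable (\bigcup_n P n : set (borel G)) by exact: bigcupT_measurable.
apply: (@negligibleS _ _ _ _ ((E `\` \bigcup_n P n) `|` \bigcup_n (Z n `\` P n))); last first.
  apply: negligibleU; first by apply/negligibleP => //; exact: measurableD.
  apply: negligible_bigcup => n; apply/negligibleP; first exact: measurableD.
  by case: (ZP n).
move=> x /= nEZ; have [Px|nPx] := pselect ((\bigcup_n P n) x).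
  exfalso; apply: nEZ; split => [_|_]; last exact: PE.
  by case: Px => n _ Px; exists n => //; case: (ZP n) => _ + _; exact.
have [Ex|nEx] := pselect (E x); first by left.
right; apply: contrapT => nZ; apply: nEZ; split => // -[n _ Zx].
by exfalso; apply: nZ; exists n => //; split => // Px; apply: nPx; exists n.
Qed.

Context {H : set G} (HH : open_sigma_subgroup H).

Lemma oss_borel : measurable (H : set (borel G)).
Proof. by apply: open_borel; exact: oss_open. Qed.

Lemma haar_restriction : exists lam : {sigma_finite_measure set (borel G) -> \bar R},
  forall A : set (borel G), measurable A -> lam A = mu (A `&` H).
Proof.
apply: sigma_finite_restriction; first exact: oss_borel.
have [P cP HE] := oss_sigma _ HH; exists P; split.
- by move=> n; exact: compact_borel.
- move=> n; apply: le_lt_trans (haar_compact _ (cP n)).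
  apply: le_measure; rewrite ?inE//; last exact: compact_borel.
  by apply: measurableI; [exact: compact_borel|exact: oss_borel].
- by rewrite HE.
Qed.

End Haar.

Lemma measurable_superlevel {d : measure_display} {T : measurableType d}
    {R : realType} (g : T -> R) (q : R) :
  measurable_fun setT g -> measurable [set x | q < g x].
Proof.
move=> mg; have := mg measurableT _ (measurable_itv `]q, +oo[).
by rewrite setTI; congr measurable; apply/seteqP; split => x /=; rewrite in_itv /= andbT.
Qed.

(** * Baire versions of Borel functions *)

Section BaireVersions.
Context {R : realType} {G : topologicalGroupType}.
Context {mu : {measure set (borel G) -> \bar R}}.
Hypothesis hG : hausdorff_space G.
Hypothesis lcG : locally_compact [set: G].
Hypothesis Hmu : left_Haar_measure mu.

(** A nonnegative [g] is the supremum of the functions [q 1_{g > q}] over the positive rationals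
    [q]. There are countably many level sets, and each is replaced by a Baire set that agrees with
    it almost everywhere. *)
Lemma borel_fun_ae_baire (g : borel G -> R) : measurable_fun setT g ->
  (forall x, 0 <= g x) -> (forall q, 0 < q -> (mu [set x | (q < g x)%R] < +oo)%E) ->
  exists2 h : baire R G -> R, measurable_fun setT h & {ae mu, forall x, g x = h x}.
Proof.
move=> mg g0 gfin.
(* An enumeration of the positive rationals; the default value [1] is again a positive rational, so
   the supremum is not affected. *)
pose q n : R := if choice.unpickle n is Some r then
  (if 0 < ratr r :> R then ratr r else 1) else 1.
have q0 n : 0 < q n.
  by rewrite /q; case: choice.unpickle => // r; case: ifPn.
have mE n := measurable_superlevel g (q n) mg.
have zE n : exists Z, measurable (Z : set (baire R G)) /\
    {ae mu, forall x, [set x | q n < g x] x <-> Z x}.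
  by have [Z mZ Zae] := borel_ae_baire hG lcG Hmu _ (mE n) (gfin _ (q0 n)); exists Z.
have [Z ZP] := choice zE.
pose u (x : G) : (\bar R)^nat := fun n => (q n * \1_(Z n) x)%:E.
exists (fun x => fine (esups (u x) 0%N)).
  apply: (measurableT_comp (fine_measurable measurableT)).
  apply: (@measurable_fun_esups _ (baire R G) R setT (fun n x => u x n)) => n.
  apply/measurable_EFinP; apply: measurable_funM => //.
  by apply: measurable_indic; case: (ZP n).
have : {ae mu, forall x, forall n, [set x | q n < g x] x <-> Z n x}.
  by apply: ae_foralln => n; case: (ZP n).
apply: filterS => x /= EZ.
suff -> : esups (u x) 0%N = (g x)%:E by [].
apply/eqP; rewrite eq_le; apply/andP; split.
  apply: ge_ereal_sup => _ [n _ <-]; rewrite /u lee_fin.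
  have [Zx|nZx] := pselect (Z n x).
    by rewrite indicE mem_set// mulr1; apply/ltW/EZ.
  by rewrite indicE memNset// mulr0.
apply/lee_addgt0Pr => e e0; rewrite -leeBlDr// -EFinB.
have [ge|ge] := leP (g x) e.
  apply: (@le_trans _ _ 0%E); first by rewrite lee_fin subr_le0.
  apply: (@le_trans _ _ (u x 0%N)).
    by rewrite lee_fin mulr_ge0// ltW.
  by apply: ereal_sup_ubound; exists 0%N.
have lt : g x - e < g x by rewrite ltrBlDr ltrDl.
have [r] := rat_in_itvoo lt.
rewrite in_itv /= => /andP[er rg].
have r0 : 0 < ratr r :> R by rewrite (lt_trans _ er)// subr_gt0.
have qr : q (choice.pickle r) = ratr r by rewrite /q choice.pickleK r0.
apply: (@le_trans _ _ (u x (choice.pickle r))).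
  rewrite lee_fin indicE mem_set ?mulr1 ?qr ?ltW//.
  by apply/EZ; rewrite qr.
by apply: ereal_sup_ubound; exists (choice.pickle r).
Qed.

(** Markov's inequality. *)
Lemma level_set_fin (g : borel G -> R) (q : R) : measurable_fun setT g ->
  (\int[mu]_x `|(g x)%:E| < +oo)%E -> 0 < q -> (mu [set x | (q < `|g x|)%R] < +oo)%E.
Proof.
move=> mg goo q0.
have mn : measurable_fun setT (fun x => `|g x|) by exact: measurableT_comp.
have := le_lt_trans (le_integral_abse mu measurableT (proj2 (measurable_EFinP _ _) mg) q0) goo.
rewrite setTI => le1.
have : (mu [set x | q%:E <= `|(g x)%:E|]%E < +oo)%E.
  rewrite -(@lte_pmul2l _ q%:E)// (lt_le_trans le1)// gt0_muley//.
apply: le_lt_trans; apply: le_measure; rewrite ?inE//.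
    exact: measurable_superlevel.
  have := mn measurableT _ (measurable_itv `[q, +oo[).
  by rewrite setTI; congr measurable; apply/seteqP; split => x /=; rewrite in_itv /= andbT lee_fin.
by move=> x /=; rewrite lee_fin => /ltW.
Qed.

Lemma integrable_ae_baire (g : borel G -> R) : mu.-integrable setT (EFin \o g) ->
  exists2 h : baire R G -> R, measurable_fun setT h & {ae mu, forall x, g x = h x}.
Proof.
move=> gi; have mg : measurable_fun setT g by apply/measurable_EFinP; exact: measurable_int gi.
have /integrableP[_ goo] := gi.
have [h1 mh1 gh1] : exists2 h : baire R G -> R, measurable_fun setT h &
    {ae mu, forall x, Num.max (g x) 0 = h x}.
  apply: borel_fun_ae_baire; first exact: measurable_maxr.
    by move=> x; rewrite le_max lexx orbT.
  move=> q q0; apply: le_lt_trans (level_set_fin _ _ mg goo q0).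
  apply: le_measure; rewrite ?inE//.
  - by apply: measurable_superlevel; exact: measurable_maxr.
  - by apply: measurable_superlevel; exact: measurableT_comp.
  - move=> x /=; rewrite lt_max (ltNge q 0) (ltW q0) orbF => /lt_le_trans; apply.
    by rewrite ?ler_norm// -normrN ler_norm.
have [h2 mh2 gh2] : exists2 h : baire R G -> R, measurable_fun setT h &
    {ae mu, forall x, Num.max (- g x) 0 = h x}.
  apply: borel_fun_ae_baire.
    by apply: measurable_maxr => //; exact: measurableT_comp.
    by move=> x; rewrite le_max lexx orbT.
  move=> q q0; apply: le_lt_trans (level_set_fin _ _ mg goo q0).
  apply: le_measure; rewrite ?inE//.
  - by apply: measurable_superlevel; apply: measurable_maxr => //; exact: measurableT_comp.
  - by apply: measurable_superlevel; exact: measurableT_comp.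
  - move=> x /=; rewrite lt_max (ltNge q 0) (ltW q0) orbF => /lt_le_trans; apply.
    by rewrite ?ler_norm// -normrN ler_norm.
exists (fun x => h1 x - h2 x); first exact: measurable_funB.
apply: filterS2 gh1 gh2 => x <- <-.
have [gx|gx] := leP 0 (g x).
  by rewrite max_r ?subr0// oppr_le0.
by rewrite max_l ?sub0r ?opprK// oppr_ge0 ltW.
Qed.

End BaireVersions.

(** * Unimodularity *)

Section WeightedFunctions.
Context {R : realType} {G : topologicalGroupType}.
Context {mu : {measure set (borel G) -> \bar R}} {w : weight G R}.
Hypothesis hG : hausdorff_space G.
Hypothesis lcG : locally_compact [set: G].
Hypothesis Hmu : left_Haar_measure mu.
Context {f : borel G -> R[i]}.
Hypothesis mf : cmeasurable f.
Hypothesis foo : (wnorm mu w f < +oo)%E.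

Let mfw : measurable_fun setT (fun x : borel G => normc (f x) * w x).
Proof. by apply/measurable_EFinP; exact: measurable_wnorm. Qed.

Let fw_ge0 x : 0 <= normc (f x) * w x.
Proof. by rewrite mulr_ge0 ?normc_ge0// ltW// weight_gt0. Qed.

(** Where [f] does not vanish, [f w] exceeds some [1/(n+1)] in norm; these level sets have finite
    measure, hence are sigma-compact up to null sets. *)
Lemma wsummable_carrier :
  exists2 A : set G, sigma_compact A & {ae mu, forall x, ~ A x -> f x = 0}.
Proof.
pose E n : set (borel G) := [set x | n.+1%:R^-1 < normc (f x) * w x].
have n0 n : 0 < n.+1%:R^-1 :> R by rewrite invr_gt0.
have Efin n : (mu (E n) < +oo)%E.
  have goo : (\int[mu]_x `|(normc (f x) * w x)%:E| < +oo)%E.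
    by under eq_integral do rewrite gee0_abs ?lee_fin//.
  by have := level_set_fin _ _ mfw goo (n0 n);
     under eq_set do rewrite ger0_norm//.
have [P PP] := choice (fun n => finite_sigma_compact hG Hmu _
  (measurable_superlevel _ _ mfw) (Efin n)).
exists (\bigcup_n \bigcup_k P n k).
  exists (fun l => if choice.unpickle l is Some (n, k) then P n k else set0).
    move=> l; case: choice.unpickle => [[n k]|]; last exact: compact0.
    by case: (PP n).
  apply/seteqP; split => x.
    by move=> [n _ [k _ Px]]; exists (choice.pickle (n, k)) => //; rewrite choice.pickleK.
  by move=> [l _]; case: choice.unpickle => // -[n k] Px; exists n => //; exists k.
have : {ae mu, forall x, forall n, ~ (E n `\` \bigcup_k P n k) x}.
  apply: ae_foralln => n; case: (PP n) => cP _ P0.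
  exists (E n `\` \bigcup_k P n k); split => //.
    apply: measurableD; first exact: measurable_superlevel.
    by apply: bigcupT_measurable => k; exact: compact_borel.
  by move=> x /= /contrapT.
apply: filterS => x /= nE nA.
suff : normc (f x) * w x = 0.
  by move/eqP; rewrite mulf_eq0 (gt_eqF (weight_gt0 w x)) orbF => /eqP/eq0_normc.
apply/eqP; rewrite eq_le fw_ge0 andbT; apply/ler_addgt0Pr => e e0; rewrite add0r.
have [n _ /(_ _ (leqnn n)) ne] := near_infty_natSinv_lt (PosNum e0).
rewrite leNgt; apply/negP => ex; apply: (nE n); split.
  by rewrite /E /=; apply: lt_trans ex.
by move=> [k _ Px]; apply: nA; exists n => //; exists k.
Qed.

(** The integrable function is [f w] and not [f]: a Baire version of [f w] is divided by the
    continuous function [w], separately for real and imaginary parts. *)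
Lemma wsummable_baire :
  exists2 h : baire R G -> R[i], cmeasurable h & {ae mu, forall x, f x = h x}.
Proof.
have mw := measurable_weight w.
have rep (g : borel G -> R) : measurable_fun setT g -> (forall x, `|g x| <= normc (f x)) ->
    exists2 h : baire R G -> R, measurable_fun setT h & {ae mu, forall x, g x = h x}.
  move=> mg gf.
  have [|h mh gh] := integrable_ae_baire hG lcG Hmu (fun x => g x * w x).
    apply/integrableP; split; first exact/measurable_EFinP/measurable_funM.
    apply: le_lt_trans foo; apply: ge0_le_integral => //.
    - by do 2 apply: measurableT_comp => //; exact: measurable_funM.
    - exact/measurable_EFinP.
    - move=> x _; rewrite lee_fin normrM (gtr0_norm (weight_gt0 w x)).
      by rewrite ler_wpM2r// ltW// weight_gt0.
  exists (fun x => h x * (w x)^-1).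
    apply: measurable_funM => //; apply: continuous_measurable_baire => x.
    by apply: cvgV; [rewrite gt_eqF ?weight_gt0|exact: weight_continuous].
  by apply: filterS gh => x <-; rewrite mulfK// gt_eqF ?weight_gt0.
have [h1 mh1 fh1] := rep _ mf.1 (fun x => Re_normc (f x)).
have [h2 mh2 fh2] := rep _ mf.2 (fun x => Im_normc (f x)).
exists (fun x => (h1 x +i* h2 x)%C); first by split.
by apply: filterS2 fh1 fh2 => x h1x h2x; exact: complexP.
Qed.

End WeightedFunctions.

(** * Inversion invariance and null sets inside a sigma-compact open subgroup *)

Section Inversion.
Context {R : realType} {G : topologicalGroupType}.
Context {mu : {measure set (borel G) -> \bar R}}.
Hypothesis hG : hausdorff_space G.
Hypothesis lcG : locally_compact [set: G].
Hypothesis Hmu : left_Haar_measure mu.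
Context {H : set G} (HH : open_sigma_subgroup H).
Context {lam : {sigma_finite_measure set (borel G) -> \bar R}}.
Hypothesis lamE : forall A : set (borel G), measurable A -> lam A = mu (A `&` H).

Let mH : measurable (H : set (borel G)). Proof. exact: oss_borel. Qed.

(** This is what Baire versions are for: on [H * H] a group operation is measurable for the Baire
    sigma-algebra on the target, so a Baire [b] can be composed with it, whereas a Borel one in
    general cannot. *)
Lemma cmeasurable_baire_prod (s : G * G -> G) (b : baire R G -> R[i]) :
  continuous s -> cmeasurable b ->
  cmeasurable (fun p : borel G * borel G => b (s (retr H p.1, retr H p.2))).
Proof.
move=> cs mb; apply: (cmeasurable_comp (fun p : borel G * borel G =>
  s (retr H p.1, retr H p.2) : baire R G) b) => //.
have mid : measurable_fun setT (fun p : borel G * borel G =>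
    (p.1, p.2) : baire R G * baire R G).
  apply/measurable_fun_pairP; split.
    exact: (measurableT_comp measurable_id_baire measurable_fst).
  exact: (measurableT_comp measurable_id_baire measurable_snd).
exact: (measurableT_comp (measurable_baire_prod hG lcG HH _ cs) mid).
Qed.

Lemma measurable_indic_baire_prod (s : G * G -> G) (Z : set G) :
  continuous s -> measurable (Z : set (baire R G)) ->
  measurable_fun setT (fun p : borel G * borel G =>
    \1_Z (s (retr H p.1, retr H p.2)) : R).
Proof. by move=> cs /(@cmeasurable_indic _ _ R) /(cmeasurable_baire_prod _ _ cs)[]. Qed.

Lemma haar_lmul_lam (x : G) (A : set (borel G)) : measurable A -> H x ->
  lam ((fun y : borel G => (x * (y : G))%g : borel G) @^-1` A) = lam A.
Proof.
move=> mA Hx.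
have ml : measurable_fun setT (fun y : borel G => (x * (y : G))%g : borel G).
  by apply: continuous_borel; exact: continuous_lmulg.
have mB : measurable ((fun y : borel G => (x * (y : G))%g : borel G) @^-1` A).
  by have := ml measurableT _ mA; rewrite setTI.
rewrite !lamE//; rewrite -[RHS](haar_left Hmu x); last exact: measurableI.
congr (mu _); apply/seteqP; split => y [/= Axy Hy]; split => //=.
  exact: (ossM _ HH).
exact: (ossMr HH _ _ Hx).
Qed.

Context {U : set G}.
Hypothesis cU : compact U.
Hypothesis UC : forall x y, U (x * y)%g -> U (y * x)%g.
Hypothesis U0 : mu U <> 0%E.
Hypothesis UH : U `<=` H.

Definition inv_pre (A : set G) : set G := (fun x => x^-1%g) @^-1` A.

Lemma baire_inv (Z : set G) : measurable (Z : set (baire R G)) ->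
  measurable (inv_pre Z : set (baire R G)).
Proof.
move=> mZ; have cinv : continuous (fun x : G => x^-1%g) by exact: invg_continuous.
by have := continuous_baire _ cinv measurableT _ mZ; rewrite setTI.
Qed.

Lemma borel_inv (Z : set G) : measurable (Z : set (borel G)) ->
  measurable (inv_pre Z : set (borel G)).
Proof.
move=> mZ; have cinv : continuous (fun x : G => x^-1%g) by exact: invg_continuous.
by have := continuous_borel _ cinv measurableT _ mZ; rewrite setTI.
Qed.

(* Compare [1_Z(y^-1 x) 1_U(y)] integrated in both orders: after [y -> x y] the
   conjugation invariance of [U] replaces [1_U(xy)] by [1_U(yx)], whose integral
   in [x] only involves left translates. *)
Lemma haar_inv_le (Z : set G) : measurable (Z : set (baire R G)) -> Z `<=` H ->
  (mu Z <= mu (inv_pre Z))%E.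
Proof.
move=> mZ ZH.
have mZb : measurable (Z : set (borel G)) := baire_sub_borel _ mZ.
have mUb : measurable (U : set (borel G)) by exact: compact_borel.
(* The hull [V] has the measure of [U] and replaces [U] under the product sign, where a Baire set is
   required. Since [V] only contains [U], the comparison gives an inequality; the converse will come
   from applying it to [Z^-1]. *)
have [V0 [mV0 UV0 V0U]] := @compact_baire_hull R _ _ hG lcG Hmu _ cU.
pose V := V0 `&` H.
have mV : measurable (V : set (baire R G)) by apply: measurableI => //; exact: measurable_oss.
have mVb : measurable (V : set (borel G)) := baire_sub_borel _ mV.
have UV : U `<=` V by move=> x Ux; split; [exact: UV0|exact: UH].
have muV : mu V = mu U.
  apply/eqP; rewrite eq_le; apply/andP; split; last by apply: le_measure; rewrite ?inE.
  have mV0b : measurable (V0 : set (borel G)) := baire_sub_borel _ mV0.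
  have VU : V `<=` U `|` (V0 `\` U).
    by move=> x [Vx _]; have [Ux|nUx] := pselect (U x); [left|right].
  apply: (@le_trans _ _ (mu (U `|` (V0 `\` U)))).
    by apply: le_measure; rewrite ?inE//; apply: measurableU => //; exact: measurableD.
  rewrite -[leRHS]adde0 -V0U; apply: measureU2 => //; exact: measurableD.
have mIZ : measurable (inv_pre Z : set (borel G)) by exact: borel_inv.
pose F (p : borel G * borel G) : R :=
  \1_Z ((retr H p.2)^-1 * retr H p.1)%g * \1_U p.2 * \1_H p.1.
pose F' (p : borel G * borel G) : R :=
  \1_(inv_pre Z) p.2 * \1_V (retr H p.2 * retr H p.1)%g * \1_H p.1.
have m1 (A : set (borel G)) : measurable A ->
    measurable_fun setT (fun p : borel G * borel G => \1_A p.1 : R).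
  by move=> mA; exact: (measurableT_comp (measurable_indic mA) measurable_fst).
have m2 (A : set (borel G)) : measurable A ->
    measurable_fun setT (fun p : borel G * borel G => \1_A p.2 : R).
  by move=> mA; exact: (measurableT_comp (measurable_indic mA) measurable_snd).
have cf : continuous (fun p : G * G => p.1) by move=> p; exact: cvg_fst.
have cg : continuous (fun p : G * G => p.2) by move=> p; exact: cvg_snd.
have mF : measurable_fun setT F.
  apply: measurable_funM; last exact: m1.
  apply: measurable_funM; last exact: m2.
  apply: (measurable_indic_baire_prod (fun p => p.2^-1 * p.1)%g) => //.
  by apply: continuous_mulg => //; exact: continuous_invg.
have mF' : measurable_fun setT F'.
  apply: measurable_funM; last exact: m1.
  apply: measurable_funM; first exact: m2.
  apply: (measurable_indic_baire_prod (fun p => p.2 * p.1)%g) => //.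
  exact: continuous_mulg.
have F0 p : (0 <= (F p)%:E)%E by rewrite lee_fin !mulr_ge0.
have F'0 p : (0 <= (F' p)%:E)%E by rewrite lee_fin !mulr_ge0.
have lamZ (A : set (borel G)) : measurable A -> A `<=` H -> lam A = mu A.
  by move=> mA AH; rewrite lamE// setIidl.
have slice (B : set G) (y : G) : measurable (B : set (borel G)) -> B `<=` H -> H y ->
    (\int[lam]_x (\1_B (y * retr H x)%g * \1_H x : R)%:E = mu B)%E.
  move=> mB BH Hy; rewrite -lamZ// -(haar_lmul_lam y)//.
  rewrite -[X in _ = lam X]setIT -(integral_indic lam measurableT); last first.
    have cy : continuous (fun x : G => (y * x)%g) by exact: continuous_lmulg.
    by have := continuous_borel _ cy measurableT _ mB; rewrite setTI.
  apply: eq_integral => x _; congr (_%:E).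
  have [Hx|nHx] := pselect (H x).
    by rewrite retr_id// [X in _ * X]indicE mem_set// mulr1.
  rewrite [X in _ * X]indicE memNset// mulr0 indicE memNset// => /BH.
  by move=> /(ossMr HH _ _ Hy).
have E1 : (\int[lam]_y \int[lam]_x (F (x, y))%:E = mu Z * mu U)%E.
  transitivity (\int[lam]_y (mu Z * (\1_U y)%:E))%E.
    apply: eq_integral => y _; rewrite /F /=.
    have [Uy|nUy] := pselect (U y); last first.
      by rewrite indicE (memNset nUy) mule0 integral0_eq// => x _; rewrite mulr0 mul0r.
    have Hy := UH _ Uy.
    rewrite indicE mem_set// mule1 -(slice Z y^-1%g)//; last exact: (ossV _ HH).
    by apply: eq_integral => x _; rewrite mulr1 retr_id.
  rewrite ge0_integralZl//; last by apply/measurable_EFinP; exact: measurable_indic.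
  by rewrite integral_indic// setIT; congr (_ * _)%E; exact: lamZ.
have E3 : (\int[lam]_y \int[lam]_x (F' (x, y))%:E = mu V * mu (inv_pre Z))%E.
  transitivity (\int[lam]_y (mu V * (\1_(inv_pre Z) y)%:E))%E.
    apply: eq_integral => y _; rewrite /F' /=.
    have [Zy|nZy] := pselect (inv_pre Z y); last first.
      by rewrite indicE (memNset nZy) mule0 integral0_eq// => x _; rewrite !mul0r.
    have Hy : H y by rewrite -(invgK y); apply: (ossV _ HH); exact: ZH.
    rewrite indicE mem_set// mule1 -(slice V y)//; last by move=> x [].
    by apply: eq_integral => x _; rewrite mul1r retr_id.
  rewrite ge0_integralZl//; last by apply/measurable_EFinP; exact: measurable_indic.
  rewrite integral_indic// setIT; congr (_ * _)%E; apply: lamZ => // y Zy.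
  by rewrite -(invgK y); apply: (ossV _ HH); exact: ZH.
have E2 : (\int[lam]_x \int[lam]_y (F (x, y))%:E <=
           \int[lam]_x \int[lam]_y (F' (x, y))%:E)%E.
  have mFE := proj2 (measurable_EFinP _ _) mF.
  have mF'E := proj2 (measurable_EFinP _ _) mF'.
  apply: ge0_le_integral => //.
  - by move=> x _; apply: integral_ge0 => y _; exact: F0.
  - exact: (measurable_fun_fubini_tonelli_F (EFin \o F)).
  - exact: (measurable_fun_fubini_tonelli_F (EFin \o F')).
  move=> x _; have [Hx|nHx] := pselect (H x); last first.
    rewrite integral0_eq; last by move=> y _; rewrite /F /= [X in _ * X]indicE memNset// mulr0.
    by apply: integral_ge0 => y _; exact: F'0.
  have mFx : measurable_fun setT (fun y => (F (x, y))%:E).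
    exact: (measurableT_comp mFE (measurable_pair1 x)).
  have ml : measurable_fun setT (fun y : borel G => (x * (y : G))%g : borel G).
    by apply: continuous_borel; exact: continuous_lmulg.
  rewrite -(integral_preserving lam (fun y : borel G => (x * (y : G))%g : borel G)
    (fun y => (F (x, y))%:E))//; last first.
    by move=> A mA; exact: haar_lmul_lam.
  apply: ge0_le_integral => //.
  - exact: (measurableT_comp mFx ml).
  - exact: (measurableT_comp mF'E (measurable_pair1 x)).
  move=> y _; rewrite lee_fin /F /F' /= ler_wpM2r// (retr_id _ Hx).
  have [Uxy|nUxy] := pselect (U (x * y)%g); last first.
    by rewrite [X in _ * X]indicE memNset// mulr0 mulr_ge0.
  have Hxy := UH _ Uxy; have Hy := ossMr HH _ _ Hx Hxy.
  rewrite (retr_id _ Hxy) (retr_id _ Hy) invgM mulgVK ler_wpM2l//.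
  by rewrite [leRHS]indicE mem_set ?indicE ?mem_set//; apply: UV; exact: UC.
(* [mu U] is positive and finite, hence can be cancelled from both sides. *)
have U0' : (0 < mu U)%E by rewrite lt0e; apply/andP; split => //; apply/eqP.
have Ufin : mu U \is a fin_num by rewrite ge0_fin_numE// (haar_compact Hmu _ cU).
rewrite -(lee_pmul2l Ufin U0').
rewrite [X in (X <= _)%E]muleC -E1 -[X in (_ <= X * _)%E]muV -E3.
have FE : (\int[lam]_y \int[lam]_x (F (x, y))%:E = \int[lam]_x \int[lam]_y (F (x, y))%:E)%E.
  by apply/esym/(fubini_tonelli (EFin \o F)) => //; exact/measurable_EFinP.
have F'E : (\int[lam]_y \int[lam]_x (F' (x, y))%:E = \int[lam]_x \int[lam]_y (F' (x, y))%:E)%E.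
  by apply/esym/(fubini_tonelli (EFin \o F')) => //; exact/measurable_EFinP.
by rewrite FE F'E.
Qed.

Lemma inv_preK (A : set G) : inv_pre (inv_pre A) = A.
Proof. by apply/seteqP; split => x; rewrite /inv_pre /= invgK. Qed.

Lemma inv_pre_sub (A : set G) : A `<=` H -> inv_pre A `<=` H.
Proof. by move=> AH x /AH /(ossV _ HH); rewrite invgK. Qed.

Lemma haar_inv_baire (Z : set G) : measurable (Z : set (baire R G)) -> Z `<=` H ->
  mu (inv_pre Z) = mu Z.
Proof.
move=> mZ ZH; apply/eqP; rewrite eq_le haar_inv_le// andbT.
rewrite -{2}(inv_preK Z); apply: haar_inv_le; first exact: baire_inv.
exact: inv_pre_sub.
Qed.

Lemma compact_inv_pre K : compact K -> compact (inv_pre K).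
Proof.
move=> cK; rewrite (_ : inv_pre K = [set x^-1%g | x in K]); first exact: compact_invg.
apply/seteqP; split => [x Kx|_ [x Kx <-]]; first by exists x^-1%g; rewrite ?invgK.
by rewrite /inv_pre /= invgK.
Qed.

Lemma haar_inv_compact_le K : compact K -> K `<=` H -> (mu (inv_pre K) <= mu K)%E.
Proof.
move=> cK KH; have mKb := compact_borel hG _ cK.
have [Z0 [mZ0 KZ0 Z0K]] := @compact_baire_hull R _ _ hG lcG Hmu _ cK.
pose Z := Z0 `&` H.
have mZ : measurable (Z : set (baire R G)) by apply: measurableI => //; exact: measurable_oss.
have mZb : measurable (Z : set (borel G)) := baire_sub_borel _ mZ.
have mZ0b : measurable (Z0 : set (borel G)) := baire_sub_borel _ mZ0.
apply: (@le_trans _ _ (mu (inv_pre Z))).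
  apply: le_measure; rewrite ?inE//; [exact: borel_inv|exact: borel_inv|].
  by move=> x Kx; split; [exact: KZ0|exact: KH].
rewrite haar_inv_baire//; last by move=> x [].
apply: (@le_trans _ _ (mu (K `|` (Z0 `\` K)))).
  apply: le_measure; rewrite ?inE//; first by apply: measurableU => //; exact: measurableD.
  by move=> x [Zx _]; have [Kx|nKx] := pselect (K x); [left|right].
rewrite -[leRHS]adde0 -Z0K; apply: measureU2 => //; exact: measurableD.
Qed.

Lemma haar_inv_compact K : compact K -> K `<=` H -> mu (inv_pre K) = mu K.
Proof.
move=> cK KH; apply/eqP; rewrite eq_le haar_inv_compact_le//=.
rewrite -{1}(inv_preK K); apply: haar_inv_compact_le; first exact: compact_inv_pre.
exact: inv_pre_sub.
Qed.

(** Conjugation is a left translation followed by a right one, and a right translation is a left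
    translation between two inversions. *)
Lemma haar_conj_compact K t : compact K -> K `<=` H -> H t ->
  mu [set y | K (t * y * t^-1)%g] = mu K.
Proof.
move=> cK KH Ht; rewrite -(haar_inv_compact _ cK KH).
have cI := compact_inv_pre _ cK.
have preM (A : set G) s : measurable (A : set (borel G)) ->
    measurable ([set y | A (s * y)%g] : set (borel G)).
  move=> mA; have cs : continuous (fun x : G => (s * x)%g) by exact: continuous_lmulg.
  by have := continuous_borel _ cs measurableT _ mA; rewrite setTI.
have preR (A : set G) s : measurable (A : set (borel G)) ->
    measurable ([set y | A (y * s)%g] : set (borel G)).
  move=> mA; have cs : continuous (fun x : G => (x * s)%g) by exact: continuous_rmulg.
  by have := continuous_borel _ cs measurableT _ mA; rewrite setTI.
rewrite [LHS](haar_left Hmu t [set y | K (y * t^-1)%g]); last first.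
  by apply: preR; exact: compact_borel.
rewrite -[RHS](haar_left Hmu t); last exact: compact_borel.
have -> : [set y | K (y * t^-1)%g] = inv_pre [set u | inv_pre K (t * u)%g].
  by apply/seteqP; split => y; rewrite /inv_pre /= invgM invgK.
apply: haar_inv_compact; last first.
  move=> u /(inv_pre_sub _ KH); exact: (ossMr HH _ _ Ht).
rewrite (_ : [set u | _] = [set (t^-1 * y)%g | y in inv_pre K]).
  by apply: (compact_image (fun y => t^-1 * y)%g) => //; exact: continuous_lmulg.
apply/seteqP; split => [u Ku|_ [y Ky <-]] /=; last by rewrite mulVKg.
by exists (t * u)%g; rewrite ?mulKg.
Qed.

(** Each [N^-1] cut by a compact piece of [H] has finite measure, so it is exhausted from inside by
    compact sets. The inverses of these lie in [N], hence are null, and inversion invariance on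
    compact sets concludes. *)
Lemma haar_inv_null (N : set G) : measurable (N : set (borel G)) -> mu N = 0%E ->
  mu (inv_pre N `&` H) = 0%E.
Proof.
move=> mN N0; have mI := borel_inv _ mN; have [P cP HE] := oss_sigma _ HH.
have mP n : measurable (P n : set (borel G)) by exact: compact_borel.
have -> : inv_pre N `&` H = \bigcup_n (inv_pre N `&` P n).
  by rewrite HE setI_bigcupr.
have mIP n : measurable (inv_pre N `&` P n : set (borel G)) by exact: measurableI.
apply/(negligibleP mu); first exact: bigcupT_measurable.
apply: negligible_bigcup => n.
have IPfin : (mu (inv_pre N `&` P n) < +oo)%E.
  by apply: le_lt_trans (haar_compact Hmu _ (cP n)); apply: le_measure; rewrite ?inE.
have [K [cK KI K0]] := finite_sigma_compact hG Hmu _ (mIP n) IPfin.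
apply: (@negligibleS _ (borel G) R mu (((inv_pre N `&` P n) `\` \bigcup_k K k) `|` \bigcup_k K k)).
  by move=> x Ix; have [Kx|nKx] := pselect ((\bigcup_k K k) x); [right|left].
have mK k : measurable (K k : set (borel G)) by exact: compact_borel.
apply: negligibleU.
  by apply/negligibleP => //; apply: measurableD => //; exact: bigcupT_measurable.
apply: negligible_bigcup => k; apply/negligibleP => //.
have KH : K k `<=` H.
  by move=> x Kx; have [|_ Px] := KI x; [exists k|rewrite HE; exists n].
transitivity (mu (inv_pre (K k))); first by apply/esym/haar_inv_compact.
apply: (subset_measure0 _ mN _ N0); first exact: borel_inv.
move=> x Kx; have [|] := KI x^-1%g; first by exists k.
by rewrite /inv_pre /= invgK.
Qed.

(** The exceptional set is the left translate by [x] of [N^-1] cut by [H]. This allows the factor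
    [g (y^-1 x)] of a convolution to be changed on a null set. *)
Lemma ae_invl (P : G -> Prop) (x : G) : H x -> {ae mu, forall y, P y} ->
  {ae mu, forall y, H y -> P (y^-1 * x)%g}.
Proof.
move=> Hx [N [mN N0 PN]].
have mIH : measurable (inv_pre N `&` H : set (borel G)).
  by apply: measurableI; [exact: borel_inv|exact: oss_borel].
exists [set y | (inv_pre N `&` H) (x^-1 * y)%g]; split.
- have cs : continuous (fun y : G => (x^-1 * y)%g) by exact: continuous_lmulg.
  by have := continuous_borel _ cs measurableT _ mIH; rewrite setTI.
- rewrite [LHS](haar_left Hmu x^-1%g)//; exact: haar_inv_null.
- move=> y /= /not_implyP[Hy nP]; split; last by apply: (ossM _ HH) => //; exact: (ossV _ HH).
  by rewrite /inv_pre /= invgM invgK; exact: PN.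
Qed.

Lemma ae_lmul (P : G -> Prop) (x : G) : {ae mu, forall y, P y} ->
  {ae mu, forall y, P (x * y)%g}.
Proof.
move=> [N [mN N0 PN]]; exists [set y | N (x * y)%g]; split.
- have cs : continuous (fun y : G => (x * y)%g) by exact: continuous_lmulg.
  by have := continuous_borel _ cs measurableT _ mN; rewrite setTI.
- by rewrite [LHS](haar_left Hmu x).
- by move=> y /= nP; exact: PN.
Qed.

Lemma ae_rmul (P : G -> Prop) (x : G) : H x -> {ae mu, forall y, P y} ->
  {ae mu, forall y, H y -> P (y * x)%g}.
Proof.
(* Two inversions make a right translation: [y x = (y^-1 1)^-1 x]. *)
move=> Hx /(ae_invl _ _ Hx) /(ae_invl _ _ (oss1 _ HH)) h.
apply: (ae_imp h) => y + Hy; rewrite mulg1 invgK => /(_ Hy); apply.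
exact: (ossV _ HH).
Qed.

End Inversion.

(** * Convolution *)

Section Unimodular.
Context {R : realType} {G : topologicalGroupType}.
Context {mu : {measure set (borel G) -> \bar R}}.
Hypothesis hG : hausdorff_space G.
Hypothesis lcG : locally_compact [set: G].
Hypothesis Hmu : left_Haar_measure mu.

(** If [U] were null, finitely many translates of its interior would cover any compact set by null
    sets, and inner regularity would make the whole group null. *)
Lemma haar_nbhs_neq0 (U : set G) : compact U -> nbhs 1%g U -> mu U <> 0%E.
Proof.
move=> cU U1 U0; case: Hmu => + _ _ _ inn; apply.
rewrite inn; last exact: openT.
suff K0 (K : set G) : compact K -> mu K = 0%E.
  apply/eqP; rewrite eq_le; apply/andP; split.
    by apply: ge_ereal_sup => _ [K [cK _] <-]; rewrite K0.
  by apply: ereal_sup_ubound; exists set0 => //; split => //; exact: compact0.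
move=> cK; have [] := @compact_sub_basic G (fun V => mu.-negligible (V : set (borel G))) K setT.
- exact: negligible_set0.
- by move=> V W; exact: negligibleU.
- move=> x _; exists [set y | U° (x^-1 * y)%g]; split => //.
  + exists [set y | U (x^-1 * y)%g]; split.
    * have cs : continuous (fun y : G => (x^-1 * y)%g) by exact: continuous_lmulg.
      have := continuous_borel _ cs measurableT _ (compact_borel hG _ cU).
      by rewrite setTI.
    * by rewrite [LHS](haar_left Hmu x^-1%g)//; exact: compact_borel.
    * by move=> y; exact: interior_subset.
  + move: (@continuous_lmulg _ x^-1%g) => /continuousP /(_ U°); apply; exact: open_interior.
  + by rewrite /= mulVg.
- exact: cK.
- by [].
- move=> V [nV KV _]; apply/(negligibleP mu); first exact: compact_borel.
  exact: negligibleS nV.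
Qed.

Context {U : set G}.
Hypothesis cU : compact U.
Hypothesis U1 : nbhs 1%g U.
Hypothesis UC : forall x y, U (x * y)%g -> U (y * x)%g.

Let U0 := haar_nbhs_neq0 U cU U1.

Lemma exists_oss (A : set G) : sigma_compact A ->
  exists H, [/\ open_sigma_subgroup H, U `<=` H & A `<=` H].
Proof.
move=> sA; have := sub_open_sigma_subgroup _ lcG
  (sigma_compactU _ _ (compact_sigma_compact _ cU) sA).
move=> [H HH]; rewrite subUset => -[UH AH]; by exists H.
Qed.

Lemma sigma_compact1 (x : G) : sigma_compact [set x].
Proof. by apply: compact_sigma_compact; exact: compact_set1. Qed.

Lemma ae_invl_sigma (A : set G) (P : G -> Prop) (x : G) : sigma_compact A ->
  {ae mu, forall y, P y} -> {ae mu, forall y, A y -> P (y^-1 * x)%g}.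
Proof.
move=> sA aeP; have [H [HH UH]] := exists_oss _ (sigma_compactU _ _ sA (sigma_compact1 x)).
rewrite subUset => -[AH xH].
have [lam lamE] := haar_restriction hG Hmu HH.
have h := ae_invl hG lcG Hmu HH lamE cU UC U0 UH P x (xH _ erefl) aeP.
apply: (ae_imp h) => y hP /AH; exact: hP.
Qed.

Lemma ae_rmul_sigma (A : set G) (P : G -> Prop) (x : G) : sigma_compact A ->
  {ae mu, forall y, P y} -> {ae mu, forall y, A y -> P (y * x)%g}.
Proof.
move=> sA aeP; have [H [HH UH]] := exists_oss _ (sigma_compactU _ _ sA (sigma_compact1 x)).
rewrite subUset => -[AH xH].
have [lam lamE] := haar_restriction hG Hmu HH.
have h := ae_rmul hG lcG Hmu HH lamE cU UC U0 UH P x (xH _ erefl) aeP.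
apply: (ae_imp h) => y hP /AH; exact: hP.
Qed.

Lemma haar_conj (K : set G) (t : G) : compact K ->
  mu [set y | K (t * y * t^-1)%g] = mu K.
Proof.
move=> cK; have [H [HH UH]] := exists_oss _
  (sigma_compactU _ _ (compact_sigma_compact _ cK) (sigma_compact1 t)).
rewrite subUset => -[KH tH].
have [lam lamE] := haar_restriction hG Hmu HH.
exact: (haar_conj_compact hG lcG Hmu HH lamE cU UC U0 UH K t cK KH (tH _ erefl)).
Qed.

Context {w : weight G R}.

Definition wsum (f : borel G -> R[i]) := cmeasurable f /\ (wnorm mu w f < +oo)%E.

Lemma cmeasurable_borel (h : baire R G -> R[i]) :
  cmeasurable h -> cmeasurable (h : borel G -> R[i]).
Proof. exact: (cmeasurable_comp _ h measurable_id_baire). Qed.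

Definition carried (H : set G) (f : borel G -> R[i]) :=
  {ae mu, forall x, ~ H x -> f x = 0}.

(** Multiplication of a Baire version by [1_H], itself Baire, turns vanishing almost everywhere off
    [H] into vanishing everywhere off [H]. *)
Lemma wsum_version (H : set G) (f : borel G -> R[i]) :
  open_sigma_subgroup H -> wsum f -> carried H f ->
  exists h : G -> R[i], [/\ cmeasurable (h : baire R G -> R[i]),
    forall x, ~ H x -> h x = 0, {ae mu, forall x, f x = h x} & wsum h].
Proof.
move=> HH [mf foo] fH; have [h mh fh] := wsummable_baire hG lcG Hmu mf foo.
have mi := cmeasurableM mh (cmeasurable_indic _ (measurable_oss (R := R) HH)).
pose k x := h x * ((\1_H x : R)%:C)%C.
have fk : {ae mu, forall x, f x = k x}.
  apply: filterS2 fh fH => x fx fHx; rewrite /k.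
  have [Hx|nHx] := pselect (H x); first by rewrite indicE mem_set// mulr1 fx.
  by rewrite indicE memNset// mulr0 fHx.
exists k; split => //.
  by move=> x nHx; rewrite /k indicE memNset// mulr0.
have mk : cmeasurable (k : borel G -> R[i]) by exact: cmeasurable_borel.
split => //; rewrite (_ : wnorm mu w k = wnorm mu w f)//.
apply: ge0_ae_eq_integral => //.
- exact: measurable_wnorm.
- exact: measurable_wnorm.
- by move=> x _; exact: wnorm_integrand_ge0.
- by move=> x _; exact: wnorm_integrand_ge0.
- by apply: filterS fk => x ->.
Qed.

Lemma carriedS (H H' : set G) f : H `<=` H' -> carried H f -> carried H' f.
Proof.
move=> HH' cf; apply: (ae_imp cf) => x fx nH.
by apply: fx => /HH'.
Qed.

Lemma exists_carrier (A : set G) (f g h : borel G -> R[i]) : sigma_compact A ->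
  wsum f -> wsum g -> wsum h ->
  exists H, [/\ open_sigma_subgroup H, U `<=` H, A `<=` H &
    [/\ carried H f, carried H g & carried H h]].
Proof.
move=> sA [mf foo] [mg goo] [mh hoo].
have [F sF fF] := wsummable_carrier hG Hmu mf foo.
have [K sK gK] := wsummable_carrier hG Hmu mg goo.
have [L sL hL] := wsummable_carrier hG Hmu mh hoo.
have [H [HH UH]] := exists_oss _ (sigma_compactU _ _ sA
  (sigma_compactU _ _ sF (sigma_compactU _ _ sK sL))).
rewrite !subUset => -[AH [FH [KH LH]]].
exists H; split => //.
by split; [exact: carriedS FH fF|exact: carriedS KH gK|exact: carriedS LH hL].
Qed.

Section Convolution.
Context {H : set G} (HH : open_sigma_subgroup H) (UH : U `<=` H).
Context {lam : {sigma_finite_measure set (borel G) -> \bar R}}.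
Hypothesis lamE : forall A : set (borel G), measurable A -> lam A = mu (A `&` H).
Context {al be : G -> R[i]}.
Hypothesis mal : cmeasurable (al : baire R G -> R[i]).
Hypothesis mbe : cmeasurable (be : baire R G -> R[i]).
Hypothesis al0 : forall x, ~ H x -> al x = 0.
Hypothesis be0 : forall x, ~ H x -> be x = 0.
Hypothesis wal : wsum al.
Hypothesis wbe : wsum be.
Context {K : borel G -> R[i]} {C : R}.
Hypothesis mK : cmeasurable K.
Hypothesis KC : forall x, normc (K x) <= C * w x.
Hypothesis K0 : forall x, ~ H x -> K x = 0.

Let mH : measurable (H : set (borel G)). Proof. exact: oss_borel. Qed.

Let lamHC : lam (~` H) = 0%E.
Proof. by rewrite lamE ?setICl ?measure0//; exact: measurableC. Qed.

Lemma lmul_borel (x : G) : measurable_fun setT (fun y : borel G => (x * (y : G))%g : borel G).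
Proof. by apply: continuous_borel; exact: continuous_lmulg. Qed.

Lemma invl_borel (x : G) : measurable_fun setT (fun y : borel G => ((y : G)^-1 * x)%g : borel G).
Proof.
apply: continuous_borel; apply: continuous_mulg; last by move=> ?; exact: cvg_cst.
by apply: continuous_invg => ?; exact: cvg_id.
Qed.

(** At [(x, y)] in [H * H] this is [be (y^-1 x) K(x)]. The retractions make it product measurable;
    for [x] outside [H] it is zero because [K] is, and values at [y] outside [H] will be multiplied
    by [al y = 0] or discarded. *)
Definition pair_ker (p : borel G * borel G) : R[i] :=
  be ((retr H p.2)^-1 * retr H p.1)%g * K p.1.

Lemma cmeasurable_pair_ker : cmeasurable pair_ker.
Proof.
apply: cmeasurableM; last exact: (cmeasurable_comp fst K measurable_fst mK).
apply: (cmeasurable_baire_prod hG lcG HH (fun p => p.2^-1 * p.1)%g) => //.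
by apply: continuous_mulg; [apply: continuous_invg => p; exact: cvg_snd|move=> p; exact: cvg_fst].
Qed.

Lemma pair_ker_shift (x y : G) : H y -> H x -> pair_ker (y * x, y)%g = be x * K (y * x)%g.
Proof.
move=> Hy Hx; have Hyx := ossM _ HH _ _ Hy Hx.
by rewrite /pair_ker /= (retr_id _ Hyx) (retr_id _ Hy) mulKg.
Qed.

(** The functional with density [K], evaluated at the left translate of [be] by [y]. *)
Definition pairing (y : borel G) : R[i] :=
  cintegral mu (fun x : borel G => be x * K ((y : G) * (x : G))%g).

Lemma cmeasurable_pairing_in (y : G) : cmeasurable (fun x : borel G => be x * K (y * (x : G))%g).
Proof.
apply: cmeasurableM; first exact: cmeasurable_borel.
exact: cmeasurable_comp (lmul_borel y) mK.
Qed.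

Lemma lam_shift (y : G) (f : borel G -> \bar R) : H y -> measurable_fun setT f ->
  (\int[lam]_x f (y * (x : G))%g = \int[lam]_x f x)%E.
Proof.
move=> Hy mf; apply: (integral_preserving lam (fun x : borel G => (y * (x : G))%g : borel G)) => //.
  exact: lmul_borel.
by move=> A mA; exact: (haar_lmul_lam Hmu HH lamE).
Qed.

Lemma lam_cshift (y : G) (f : borel G -> R[i]) : H y -> cmeasurable f ->
  cintegral lam (fun x => f (y * (x : G))%g) = cintegral lam f.
Proof.
move=> Hy mf.
apply: (cintegral_preserving lam (fun x : borel G => (y * (x : G))%g : borel G)) => //.
  exact: lmul_borel.
by move=> A mA; exact: (haar_lmul_lam Hmu HH lamE).
Qed.

Lemma cintegral_pair_ker (y : G) : H y -> cintegral lam (fun x => pair_ker (x, y)) = pairing y.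
Proof.
move=> Hy; rewrite -(lam_cshift y)//; last exact: cmeasurable_pair2 cmeasurable_pair_ker _.
rewrite /pairing -(cintegral_restr mu mH lam lamE); last 2 first.
- exact: cmeasurable_pairing_in.
- by move=> x nHx; rewrite be0// mul0r.
apply: ae_eq_cintegral.
- apply: (cmeasurable_comp (fun x : borel G => (y * (x : G))%g : borel G)
    (fun x => pair_ker (x, y))); first exact: lmul_borel.
  exact: cmeasurable_pair2 cmeasurable_pair_ker _.
- exact: cmeasurable_pairing_in.
exists (~` H); split; first exact: measurableC.
  exact: lamHC.
by move=> x /= + Hx; apply; exact: pair_ker_shift.
Qed.

Lemma pairing0 (y : G) : ~ H y -> pairing y = 0.
Proof.
move=> nHy; rewrite /pairing (_ : (fun _ => _) = fun=> 0).
  by rewrite /cintegral /Rintegral /= integral0.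
apply/funext => x; have [Hx|nHx] := pselect (H x); last by rewrite be0// mul0r.
by rewrite K0 ?mulr0// => /(ossMl HH _ _ Hx).
Qed.

(** The integrand of [pairing] need not be product measurable. On [H] the shift [x -> y x] turns its
    integral into that of [pair_ker], to which Fubini applies, and [1_H] accounts for the other
    points. *)
Lemma cmeasurable_pairing : cmeasurable pairing.
Proof.
rewrite (_ : pairing = fun y : borel G =>
    (\1_H y : R)%:C%C * cintegral lam (fun x => pair_ker (x, y))).
  apply: cmeasurableM; first exact: cmeasurable_indic.
  have mk : cmeasurable (fun p : borel G * borel G => pair_ker (p.2, p.1)).
    apply: (cmeasurable_comp (fun p => (p.2, p.1)) pair_ker); last exact: cmeasurable_pair_ker.
    by apply/measurable_fun_pairP; split; [exact: measurable_snd|exact: measurable_fst].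
  exact: (cmeasurable_cfubini lam _ mk).
apply/funext => y; have [Hy|nHy] := pselect (H y).
  by rewrite indicE mem_set// mul1r cintegral_pair_ker.
by rewrite indicE memNset// mul0r pairing0.
Qed.

Let C0 : 0 <= C.
Proof.
have := le_trans (normc_ge0 _) (KC 1%g).
by rewrite pmulr_lge0// weight_gt0.
Qed.

Let wnE (f : borel G -> R[i]) : wsum f -> measurable_fun setT (fun x => (normc (f x) * w x)%:E).
Proof. by move=> [mf _]; exact: measurable_wnorm. Qed.

Let lamZ (f : borel G -> R[i]) (c : \bar R) : wsum f -> (forall x, ~ H x -> f x = 0) ->
  (0 <= c)%E -> (\int[lam]_x (c * (normc (f x) * w x)%:E) = c * wnorm mu w f)%E.
Proof.
move=> wf f0 c0; rewrite ge0_integralZl//; last 2 first.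
- exact: wnE.
- by move=> x _; exact: wnorm_integrand_ge0.
congr (_ * _)%E; apply: (integral_restr mu mH lam lamE); first exact: wnE.
by move=> x nHx; rewrite f0// normc0 mul0r.
Qed.

Lemma pairing_bound (y : G) x : normc (be x * K (y * x)%g) <= C * w y * (normc (be x) * w x).
Proof.
rewrite normcM mulrCA ler_wpM2l ?normc_ge0//.
apply: (le_trans (KC _)); rewrite -mulrA ler_wpM2l//.
exact: weight_submul.
Qed.

Lemma cintegrable_pairing_in (y : G) : cintegrable mu (fun x : borel G => be x * K (y * (x : G))%g).
Proof.
apply: (le_cintegrable mu (fun x => C * w y * (normc (be x) * w x))).
- exact: cmeasurable_pairing_in.
- exact: pairing_bound.
- apply: measurable_funM => //; apply/measurable_EFinP; exact: wnE.
- under eq_integral do rewrite EFinM.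
  rewrite ge0_integralZl_EFin//.
  + by case: wbe => _; apply: lte_mul_pinfty; rewrite ?lee_fin ?mulr_ge0 ?(ltW (weight_gt0 _ _)).
  + by move=> x _; exact: wnorm_integrand_ge0.
  + exact: wnE.
  + by rewrite mulr_ge0// ltW// weight_gt0.
Qed.

Definition fubini_ker (p : borel G * borel G) : R[i] := al p.2 * pair_ker p.

Lemma cmeasurable_fubini_ker : cmeasurable fubini_ker.
Proof.
apply: cmeasurableM; last exact: cmeasurable_pair_ker.
exact: (cmeasurable_comp snd (al : borel G -> R[i]) measurable_snd (cmeasurable_borel _ mal)).
Qed.

(** The bound is [C] times the product of the norms of [al] and [be]: integrate over [x] first,
    shift [x] to [y x], and use [w (y x) <= w y w x]. *)
Lemma fubini_ker_fin : (\int[lam]_x \int[lam]_y (normc (fubini_ker (x, y)))%:E < +oo)%E.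
Proof.
rewrite (fubini_tonelli (fun p => (normc (fubini_ker p))%:E)); last 2 first.
- by apply/measurable_EFinP; apply: measurable_normc; exact: cmeasurable_fubini_ker.
- by move=> p; rewrite lee_fin normc_ge0.
pose B : \bar R := (C%:E * wnorm mu w be)%E.
have B0 : (0 <= B)%E by rewrite mule_ge0 ?lee_fin ?wnorm_ge0.
have Boo : (B < +oo)%E by case: wbe => _; apply: lte_mul_pinfty.
have mkb : measurable_fun setT (fun p : borel G * borel G => (normc (fubini_ker (p.2, p.1)))%:E).
  apply/measurable_EFinP; apply: measurable_normc.
  apply: (cmeasurable_comp (fun p : borel G * borel G => (p.2, p.1)) fubini_ker).
    by apply/measurable_fun_pairP; split; [exact: measurable_snd|exact: measurable_fst].
  exact: cmeasurable_fubini_ker.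
apply: (@le_lt_trans _ _ (\int[lam]_y (B * (normc (al y) * w y)%:E))%E); last first.
  rewrite lamZ//; apply: lte_mul_pinfty => //; first by rewrite ge0_fin_numE.
  by case: wal.
apply: ge0_le_integral => //.
- by move=> y _; apply: integral_ge0 => x _; rewrite lee_fin normc_ge0.
- apply: (measurable_fun_fubini_tonelli_F (fun p : borel G * borel G =>
    (normc (fubini_ker (p.2, p.1)))%:E)) => //.
  by move=> p; rewrite lee_fin normc_ge0.
- by apply: emeasurable_funM => //; exact: wnE.
move=> y _; have [Hy|nHy] := pselect (H y); last first.
  rewrite integral0_eq; last by move=> x _; rewrite /fubini_ker /= al0// mul0r normc0.
  by rewrite al0// normc0 mul0r mule0.
have mky : measurable_fun setT (fun x => (normc (fubini_ker (x, y)))%:E).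
  apply/measurable_EFinP; apply: measurable_normc.
  exact: cmeasurable_pair2 cmeasurable_fubini_ker _.
rewrite -(lam_shift y (fun x => (normc (fubini_ker (x, y)))%:E))//.
apply: (@le_trans _ _ (\int[lam]_x ((normc (al y) * (C * w y))%:E * (normc (be x) * w x)%:E))%E).
  apply: ae_ge0_le_integral => //.
  - by move=> x _; rewrite lee_fin normc_ge0.
  - exact: (measurableT_comp mky (lmul_borel y)).
  - move=> x _; rewrite mule_ge0 ?wnorm_integrand_ge0// lee_fin.
    by rewrite !mulr_ge0 ?normc_ge0// ltW// weight_gt0.
  - by apply: emeasurable_funM => //; exact: wnE.
  exists (~` H); split; first exact: measurableC.
    exact: lamHC.
  move=> x /= /not_implyP[_ +] Hx; apply.
  rewrite /fubini_ker /= (pair_ker_shift _ _ Hy Hx) normcM -EFinM lee_fin -mulrA.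
  rewrite ler_wpM2l ?normc_ge0//.
  exact: pairing_bound.
rewrite lamZ//; last by rewrite lee_fin !mulr_ge0 ?normc_ge0// ltW// weight_gt0.
rewrite /B mulrCA EFinM [leRHS]muleC muleA [X in (_ <= X * _)%E]muleC.
by rewrite -muleA [X in (_ * X)%E]muleC.
Qed.

Lemma fubini_ker_slice (y : G) : cintegral lam (fun x => fubini_ker (x, y)) = al y * pairing y.
Proof.
have [Hy|nHy] := pselect (H y); last first.
  rewrite al0// mul0r (_ : (fun _ => _) = fun=> 0).
    by rewrite /cintegral /Rintegral /= integral0.
  by apply/funext => x; rewrite /fubini_ker /= al0// mul0r.
have mky : cmeasurable (fun x => fubini_ker (x, y)).
  exact: cmeasurable_pair2 cmeasurable_fubini_ker _.
have mjy := cmeasurableM (cmeasurable_cst (al y)) (cmeasurable_pairing_in y).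
rewrite -(lam_cshift y)// -cintegral_Z; last exact: cintegrable_pairing_in.
rewrite -(cintegral_restr mu mH lam lamE)//; last first.
  by move=> x nHx; rewrite be0// mul0r mulr0.
apply: ae_eq_cintegral => //; first exact: cmeasurable_comp (lmul_borel y) mky.
exists (~` H); split; [exact: measurableC|exact: lamHC|].
by move=> x /= + Hx; apply; rewrite /fubini_ker /= (pair_ker_shift _ _ Hy Hx).
Qed.

Definition conv_ig (x : G) (y : borel G) : R[i] := al y * be ((y : G)^-1 * x)%g.

Lemma cmeasurable_conv_ig x : cmeasurable (conv_ig x).
Proof.
apply: cmeasurableM; first exact: cmeasurable_borel.
exact: cmeasurable_comp (invl_borel x) (cmeasurable_borel _ mbe).
Qed.

Lemma conv_ig0 x y : ~ H y -> conv_ig x y = 0.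
Proof. by move=> nHy; rewrite /conv_ig al0// mul0r. Qed.

Lemma fubini_kerE (x y : G) : H x -> fubini_ker (x, y) = K x * conv_ig x y.
Proof.
move=> Hx; have [Hy|nHy] := pselect (H y); last first.
  by rewrite conv_ig0// mulr0 /fubini_ker /= al0// mul0r.
by rewrite /fubini_ker /pair_ker /conv_ig /= !retr_id// mulrA mulrC.
Qed.

Lemma fubini_ker0 (x : G) : ~ H x -> cintegral lam (fun y => fubini_ker (x, y)) = 0.
Proof.
move=> nHx; rewrite (_ : (fun _ => _) = fun=> 0).
  by rewrite /cintegral /Rintegral /= integral0.
by apply/funext => y; rewrite /fubini_ker /pair_ker /= K0// !mulr0.
Qed.

Lemma conv_ig_integrableP (x : G) : cintegrable lam (conv_ig x) <-> cintegrable mu (conv_ig x).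
Proof. by apply: (cintegrable_restr mu mH lam lamE) => y; exact: conv_ig0. Qed.

Lemma fubini_ker_cintegral (x : G) : H x -> cintegrable mu (conv_ig x) ->
  cintegral lam (fun y => fubini_ker (x, y)) = K x * cintegral mu (conv_ig x).
Proof.
move=> Hx icv.
rewrite -(cintegral_restr mu mH lam lamE); [|exact: cmeasurable_conv_ig|exact: conv_ig0].
rewrite -cintegral_Z; last exact/conv_ig_integrableP.
by apply: eq_cintegral => y; exact: fubini_kerE.
Qed.

Context {f g : borel G -> R[i]}.
Hypothesis mf : cmeasurable f.
Hypothesis mg : cmeasurable g.
Hypothesis fal : {ae mu, forall x, f x = al x}.
Hypothesis gbe : {ae mu, forall x, g x = be x}.

Lemma cmeasurable_conv_in (x : G) : cmeasurable (fun y : borel G => f y * g ((y : G)^-1 * x)%g).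
Proof. by apply: cmeasurableM => //; exact: cmeasurable_comp (invl_borel x) mg. Qed.

Lemma conv_ig_ae (x : G) :
  {ae mu, forall y : borel G, f y * g ((y : G)^-1 * x)%g = conv_ig x y}.
Proof.
have gx := ae_invl_sigma H (fun z => g z = be z) x (oss_sigma _ HH) gbe.
apply: filterS2 fal gx => y fy gy; rewrite /conv_ig fy.
by have [Hy|nHy] := pselect (H y); [rewrite gy|rewrite al0// !mul0r].
Qed.

Lemma pairingE (y : G) : pairing y = cintegral mu (fun x : borel G => g x * K (y * (x : G))%g).
Proof.
apply: ae_eq_cintegral; first exact: cmeasurable_pairing_in.
  by apply: cmeasurableM => //; exact: cmeasurable_comp (lmul_borel y) mK.
by apply: filterS gbe => x ->.
Qed.

(** Integrating a convolution against a kernel bounded by the weight: every product in the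
    derivation identity is expanded in this way. Fubini applies to the Baire versions and to [lam],
    and [f], [g], [mu] are restored afterwards. *)
Lemma cintegral_conv (h : borel G -> R[i]) : cmeasurable h ->
  is_convolution mu f g h ->
  cintegral mu (fun x => h x * K x) =
  cintegral mu (fun y : borel G =>
    f y * cintegral mu (fun x : borel G => g x * K ((y : G) * (x : G))%g)).
Proof.
move=> mh fgh; have mF := cmeasurable_cfubini lam _ cmeasurable_fubini_ker.
transitivity (cintegral mu (fun x => cintegral lam (fun y => fubini_ker (x, y)))).
  apply: ae_eq_cintegral => //; first exact: cmeasurableM.
  apply: (ae_imp fgh) => x [iF ->].
  have [Hx|nHx] := pselect (H x); last by rewrite fubini_ker0// K0// mulr0.
  have icv := ae_eq_cintegrable mu (cmeasurable_conv_in x) (cmeasurable_conv_ig x)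
    (conv_ig_ae x) iF.
  rewrite fubini_ker_cintegral// mulrC; congr (_ * _).
  exact: ae_eq_cintegral (cmeasurable_conv_in x) (cmeasurable_conv_ig x) (conv_ig_ae x).
rewrite -(cintegral_restr mu mH lam lamE)//; last exact: fubini_ker0.
rewrite (cFubini lam lam fubini_ker)//; [|exact: cmeasurable_fubini_ker|exact: fubini_ker_fin].
transitivity (cintegral lam (fun y => al y * pairing y)).
  by apply: eq_cintegral => y; exact: fubini_ker_slice.
have maj : cmeasurable (fun y : borel G => al y * pairing y).
  by apply: cmeasurableM; [exact: cmeasurable_borel|exact: cmeasurable_pairing].
transitivity (cintegral mu (fun y => al y * pairing y)).
  by apply: (cintegral_restr mu mH lam lamE _ maj) => y nHy; rewrite al0// mul0r.
transitivity (cintegral mu (fun y => f y * pairing y)).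
  apply: ae_eq_cintegral => //; first by apply: cmeasurableM => //; exact: cmeasurable_pairing.
  by apply: filterS fal => y ->.
by apply: eq_cintegral => y; rewrite pairingE.
Qed.

End Convolution.

(** With the kernel [w 1_H], integrability of the inner integral of [F] is exactly finiteness of the
    weighted norm of the convolution, and [h] is that inner integral divided by [w]. *)
Lemma conv_exists (f g : borel G -> R[i]) : wsum f -> wsum g ->
  exists2 h, wsum h & is_convolution mu f g h.
Proof.
move=> wf wg; have [mf _] := wf; have [mg _] := wg.
have [H [HH UH _ [Hf Hg _]]] := exists_carrier _ _ _ _ (sigma_compact1 1%g) wf wg wg.
have [lam lamE] := haar_restriction hG Hmu HH.
have mH : measurable (H : set (borel G)) by exact: oss_borel.
have [al [mal al0 fal wal]] := wsum_version _ _ HH wf Hf.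
have [be [mbe be0 gbe wbe]] := wsum_version _ _ HH wg Hg.
pose K (x : borel G) : R[i] := (w x * \1_H x)%:C%C.
have mK : cmeasurable K.
  apply: cmeasurable_real; apply: measurable_funM; first exact: measurable_weight.
  exact: measurable_indic.
have K1 (x : G) : H x -> K x = (w x)%:C%C by move=> Hx; rewrite /K indicE mem_set// mulr1.
have K0 (x : G) : ~ H x -> K x = 0 by move=> Hx; rewrite /K indicE memNset// mulr0.
have KC x : normc (K x) <= 1 * w x.
  rewrite mul1r /K normc_real ger0_norm ?mulr_ge0 ?(ltW (weight_gt0 _ _))//.
  by rewrite ler_piMr ?(ltW (weight_gt0 _ _))// indicE; case: (_ \in _).
have w0 (x : G) : (w x)%:C%C != 0 :> R[i].
  by rewrite eq_complex /= gt_eqF// weight_gt0.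
pose F := fubini_ker (H := H) (al := al) (be := be) (K := K).
have mF : cmeasurable F by exact: cmeasurable_fubini_ker.
have Ffin : (\int[lam]_x \int[lam]_y (normc (F (x, y)))%:E < +oo)%E.
  exact: (fubini_ker_fin HH lamE mal mbe al0 be0 wal wbe mK KC).
pose h (x : borel G) : R[i] := (w x)^-1%:C%C * cintegral lam (fun y => F (x, y)).
have h0 x : ~ H x -> h x = 0.
  by move=> nHx; rewrite /h fubini_ker0// mulr0.
have mwV : measurable_fun setT (fun x : borel G => (w x)^-1).
  apply: continuous_measurable_borel => x.
  by apply: cvgV; [rewrite gt_eqF ?weight_gt0|exact: weight_continuous].
have mh : cmeasurable h.
  by apply: cmeasurableM; [exact: cmeasurable_real|exact: cmeasurable_cfubini].
exists h.
  split => //; rewrite /wnorm -(integral_restr mu mH lam lamE); last 2 first.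
  - exact: measurable_wnorm.
  - by move=> x nHx; rewrite h0// normc0 mul0r.
  have /cintegrableP[_] := cintegrable_cfubini lam lam F mF Ffin.
  congr (_ < _)%E; apply: eq_integral => x _; congr _%:E.
  rewrite /h normcM normc_real ger0_norm ?invr_ge0 ?(ltW (weight_gt0 _ _))//.
  by rewrite mulrC mulrA divff ?mul1r// gt_eqF ?weight_gt0.
have Fae := restr_ae mu mH lam lamE _ (ae_cintegrable_pair lam lam F mF Ffin).
apply: filterS Fae => x Fx /=.
have mfg := cmeasurable_conv_in mf mg x.
have mc := cmeasurable_conv_ig mal mbe x.
have fgcv := conv_ig_ae HH al0 fal gbe x.
have cvfg : {ae mu, forall y, conv_ig (al := al) (be := be) x y = f y * g ((y : G)^-1 * x)%g}.
  by apply: filterS fgcv.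
have [Hx|nHx] := pselect (H x); last first.
  (* For [y] in [H] and [x] outside, [y^-1 x] is outside [H], so one of the two factors always
     vanishes. *)
  have cvE0 : conv_ig (al := al) (be := be) x = fun=> 0.
    apply/funext => y; rewrite /conv_ig.
    have [Hy|nHy] := pselect (H y); last by rewrite al0// mul0r.
    rewrite be0 ?mulr0// => Hyx; apply: nHx; rewrite -(mulVKg y x).
    exact: (ossM _ HH).
  rewrite h0//; rewrite cvE0 in cvfg; split.
    apply: (ae_eq_cintegrable mu (cmeasurable_cst 0) mfg cvfg).
    by apply/cintegrableP; split; [exact: cmeasurable_cst|rewrite normc0 integral0].
  rewrite -(ae_eq_cintegral mu (cmeasurable_cst 0) mfg cvfg).
  by rewrite /cintegral /Rintegral /= integral0.
have icv : cintegrable mu (conv_ig (al := al) (be := be) x).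
  apply/(conv_ig_integrableP HH lamE al0).
  rewrite (_ : conv_ig x = fun y => (w x)^-1%:C%C * F (x, y)); first exact/cintegrableZ/Fx.
  apply/funext => y; rewrite /F (fubini_kerE al0)// K1// mulrA -rmorphM /= mulVf ?mul1r//.
  by rewrite gt_eqF ?weight_gt0.
split; first exact: (ae_eq_cintegrable mu mc mfg cvfg icv).
rewrite -(ae_eq_cintegral mu mc mfg cvfg) /h.
rewrite (fubini_ker_cintegral HH lamE mal mbe al0)// K1// mulrA -rmorphM /= mulVf ?mul1r//.
by rewrite gt_eqF ?weight_gt0.
Qed.

End Unimodular.

(** * The derivation *)

Section Swap.
Context {R : realType} {G : topologicalGroupType}.
Context {mu : {measure set (borel G) -> \bar R}}.
Hypothesis hG : hausdorff_space G.
Hypothesis Hmu : left_Haar_measure mu.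
Context {H : set G} (HH : open_sigma_subgroup H).

Let mH : measurable (H : set (borel G)). Proof. exact: oss_borel. Qed.

Lemma cintegral_slice (lam : {measure set (borel G) -> \bar R}) (k : R[i])
    (q q' : borel G -> R[i]) :
  (forall A : set (borel G), measurable A -> lam A = mu (A `&` H)) ->
  cmeasurable q' -> cintegrable mu q -> (forall y, ~ H y -> q' y = 0) ->
  {ae mu, forall y, q y = q' y} ->
  cintegral lam (fun y => k * q' y) = k * cintegral mu q.
Proof.
move=> lamE mq' iq q'0 qq'; have mq := cintegrable_cmeasurable mu iq.
have mk (p : borel G -> R[i]) : cmeasurable p -> cmeasurable (fun y => k * p y).
  by move=> mp; exact: cmeasurableM (cmeasurable_cst k) mp.
rewrite (cintegral_restr mu mH lam lamE)//; last 2 first.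
- exact: mk.
- by move=> y nHy; rewrite q'0// mulr0.
rewrite -cintegral_Z//; apply: ae_eq_cintegral; [exact: mk|exact: mk|].
by apply: filterS qq' => y ->.
Qed.

(* [Q] itself need not be measurable for the product of the Borel sigma-algebras;
   a product-measurable [Q'] that agrees with it on almost all points of each
   slice is enough. *)
Lemma cintegral_swap (f g : borel G -> R[i]) (u v : borel G -> R)
    (Q : G -> G -> R[i]) (Q' : borel G * borel G -> R[i]) :
  cmeasurable f -> cmeasurable g -> @carried R G mu H f -> @carried R G mu H g ->
  cmeasurable Q' ->
  (forall x, H x -> {ae mu, forall y : borel G, H y -> Q x y = Q' (x, y)}) ->
  (forall y, H y -> {ae mu, forall x : borel G, H x -> Q x y = Q' (x, y)}) ->
  (forall x, cintegrable mu (fun y : borel G => g y * Q x y)) ->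
  (forall y, cintegrable mu (fun x : borel G => f x * Q x y)) ->
  (forall x y, normc (f x * (g y * Q x y)) <= u x * v y) ->
  measurable_fun setT u -> measurable_fun setT v ->
  (forall x, 0 <= u x) -> (forall y, 0 <= v y) ->
  (\int[mu]_x (u x)%:E < +oo)%E -> (\int[mu]_y (v y)%:E < +oo)%E ->
  cmeasurable (fun x : borel G => cintegral mu (fun y : borel G => g y * Q x y)) ->
  cmeasurable (fun y : borel G => cintegral mu (fun x : borel G => f x * Q x y)) ->
  cintegral mu (fun x => f x * cintegral mu (fun y : borel G => g y * Q x y)) =
  cintegral mu (fun y => g y * cintegral mu (fun x : borel G => f x * Q x y)) /\
  cintegrable mu (fun y => g y * cintegral mu (fun x : borel G => f x * Q x y)).
Proof.
move=> mf mg fH gH mQ' QQ1 QQ2 iP iP' Quv mu' mv u0 v0 uoo voo mP mP'.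
have [lam lamE] := haar_restriction hG Hmu HH.
pose ind (x : borel G) : R[i] := (\1_H x : R)%:C%C.
have ind1 (x : borel G) : H x -> ind x = 1 by move=> Hx; rewrite /ind indicE mem_set.
have ind0 (x : borel G) : ~ H x -> ind x = 0 by move=> Hx; rewrite /ind indicE memNset.
have mind : cmeasurable ind by exact: cmeasurable_indic.
(* [f] and [g] vanish off [H] only almost everywhere, while [Q'] is tied to [Q] only on [H]; the
   truncations make [F] vanish everywhere off [H * H]. *)
pose f0 x := ind x * f x; pose g0 x := ind x * g x.
have mf0 : cmeasurable f0 by exact: cmeasurableM.
have mg0 : cmeasurable g0 by exact: cmeasurableM.
have ff0 : {ae mu, forall x, f x = f0 x}.
  apply: (ae_imp fH) => x fx; rewrite /f0.
  have [Hx|nHx] := pselect (H x); first by rewrite ind1// mul1r.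
  by rewrite ind0// mul0r fx.
have gg0 : {ae mu, forall x, g x = g0 x}.
  apply: (ae_imp gH) => x gx; rewrite /g0.
  have [Hx|nHx] := pselect (H x); first by rewrite ind1// mul1r.
  by rewrite ind0// mul0r gx.
pose F (p : borel G * borel G) := f0 p.1 * (g0 p.2 * Q' p).
have mF : cmeasurable F.
  apply: cmeasurableM; first exact: cmeasurable_comp measurable_fst mf0.
  by apply: cmeasurableM => //; exact: cmeasurable_comp measurable_snd mg0.
have lamHC : lam (~` H) = 0%E by rewrite lamE ?setICl ?measure0//; exact: measurableC.
have lam_fin (r : borel G -> R) : measurable_fun setT r -> (forall x, 0 <= r x) ->
    (\int[mu]_x (r x)%:E < +oo)%E -> (\int[lam]_x (r x)%:E < +oo)%E.
  move=> mr r0; apply: le_lt_trans.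
  have mr1 : measurable_fun setT (fun x : borel G => (\1_H x * r x)%:E).
    by apply/measurable_EFinP; apply: measurable_funM => //; exact: measurable_indic.
  apply: (@le_trans _ _ (\int[lam]_x (\1_H x * r x)%:E)%E).
    apply: ae_ge0_le_integral => //.
    - by move=> x _; rewrite lee_fin.
    - exact/measurable_EFinP.
    - by move=> x _; rewrite lee_fin mulr_ge0.
    exists (~` H); split; [exact: measurableC|exact: lamHC|].
    move=> x /= /not_implyP[_ +] Hx; apply.
    by rewrite indicE mem_set// mul1r.
  rewrite (integral_restr mu mH lam lamE)//; last first.
    by move=> x nHx; rewrite indicE memNset// mul0r.
  apply: ge0_le_integral => //.
  - by move=> x _; rewrite lee_fin mulr_ge0.
  - exact/measurable_EFinP.
  - by move=> x _; rewrite lee_fin ler_piMl// indicE; case: (_ \in _).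
have Voo := lam_fin v mv v0 voo; have Uoo := lam_fin u mu' u0 uoo.
have Ffin : (\int[lam]_x \int[lam]_y (normc (F (x, y)))%:E < +oo)%E.
  pose V := (\int[lam]_y (v y)%:E)%E.
  have V0 : (0 <= V)%E by apply: integral_ge0 => y _; rewrite lee_fin.
  have mnF : measurable_fun setT (fun p => (normc (F p))%:E).
    by apply/measurable_EFinP; exact: measurable_normc.
  apply: (@le_lt_trans _ _ (\int[lam]_x (V * (u x)%:E))%E); last first.
    rewrite ge0_integralZl//; last 2 first.
    - exact/measurable_EFinP.
    - by move=> x _; rewrite lee_fin.
    by apply: lte_mul_pinfty => //; rewrite ge0_fin_numE.
  apply: ge0_le_integral => //.
  - by move=> x _; apply: integral_ge0 => y _; rewrite lee_fin normc_ge0.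
  - apply: (measurable_fun_fubini_tonelli_F (fun p => (normc (F p))%:E)) => //.
    by move=> p; rewrite lee_fin normc_ge0.
  - by apply: emeasurable_funM => //; exact/measurable_EFinP.
  move=> x _; have [Hx|nHx] := pselect (H x); last first.
    rewrite integral0_eq; first by rewrite mule_ge0// lee_fin.
    by move=> y _; rewrite /F /= /f0 ind0// !mul0r normc0.
  rewrite muleC /V -ge0_integralZl//; last 3 first.
  - exact/measurable_EFinP.
  - by move=> y _; rewrite lee_fin.
  - by rewrite lee_fin.
  apply: ae_ge0_le_integral => //.
  - by move=> y _; rewrite lee_fin normc_ge0.
  - by apply/measurable_EFinP; apply: measurable_normc; exact: cmeasurable_pair1 mF x.
  - by move=> y _; rewrite mule_ge0// lee_fin.
  - by apply: emeasurable_funM => //; exact/measurable_EFinP.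
  have QQ := ae_restr mu mH lam lamE _ (QQ1 x Hx).
  apply: filterS QQ => y QQy _; rewrite /F /= /f0 /g0 ind1// mul1r.
  have [Hy|nHy] := pselect (H y); last first.
    by rewrite ind0// !mul0r mulr0 normc0 mule_ge0// lee_fin.
  by rewrite ind1// mul1r -QQy// -EFinM lee_fin.
have E1 (x : borel G) : H x ->
    cintegral lam (fun y => F (x, y)) = f0 x * cintegral mu (fun y : borel G => g y * Q x y).
  move=> Hx; apply: (cintegral_slice lam (f0 x) _ (fun y => g0 y * Q' (x, y)) lamE) => //.
  - by apply: cmeasurableM => //; exact: cmeasurable_pair1 mQ' x.
  - by move=> y nHy; rewrite /g0 ind0// !mul0r.
  - apply: filterS2 (QQ1 x Hx) gg0 => y QQy ->.
    have [Hy|nHy] := pselect (H y); first by rewrite QQy.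
    by rewrite /g0 ind0// !mul0r.
have E2 (y : borel G) : H y ->
    cintegral lam (fun x => F (x, y)) = g0 y * cintegral mu (fun x : borel G => f x * Q x y).
  move=> Hy; rewrite -(cintegral_slice lam (g0 y) _ (fun x => f0 x * Q' (x, y)) lamE)//.
  - by apply: eq_cintegral => x; rewrite /F /= mulrCA.
  - by apply: cmeasurableM => //; exact: cmeasurable_pair2 mQ' y.
  - by move=> x nHx; rewrite /f0 ind0// !mul0r.
  - apply: filterS2 (QQ2 y Hy) ff0 => x QQx ->.
    have [Hx|nHx] := pselect (H x); first by rewrite QQx.
    by rewrite /f0 ind0// !mul0r.
have E1' (x : borel G) : cintegral lam (fun y => F (x, y)) =
    f0 x * cintegral mu (fun y : borel G => g y * Q x y).
  have [Hx|nHx] := pselect (H x); first exact: E1.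
  rewrite /f0 ind0// !mul0r (_ : (fun _ => _) = fun=> 0).
    by rewrite /cintegral /Rintegral /= integral0.
  by apply/funext => y; rewrite /F /= /f0 ind0// !mul0r.
have E2' (y : borel G) : cintegral lam (fun x => F (x, y)) =
    g0 y * cintegral mu (fun x : borel G => f x * Q x y).
  have [Hy|nHy] := pselect (H y); first exact: E2.
  rewrite /g0 ind0// !mul0r (_ : (fun _ => _) = fun=> 0).
    by rewrite /cintegral /Rintegral /= integral0.
  by apply/funext => x; rewrite /F /= /g0 ind0// !mul0r mulr0.
have mf0P := cmeasurableM mf0 mP; have mfP := cmeasurableM mf mP.
have mg0P := cmeasurableM mg0 mP'; have mgP := cmeasurableM mg mP'.
have g0gP : {ae mu, forall y, g0 y * cintegral mu (fun x : borel G => f x * Q x y) =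
    g y * cintegral mu (fun x : borel G => f x * Q x y)}.
  by apply: filterS gg0 => y ->.
have g0off y : ~ H y -> g0 y * cintegral mu (fun x : borel G => f x * Q x y) = 0.
  by move=> nHy; rewrite /g0 ind0// !mul0r.
split.
  transitivity (cintegral mu (fun x => f0 x * cintegral mu (fun y : borel G => g y * Q x y))).
    by apply: ae_eq_cintegral => //; apply: filterS ff0 => x ->.
  rewrite -(cintegral_restr mu mH lam lamE _ mf0P); last first.
    by move=> x nHx; rewrite /f0 ind0// !mul0r.
  transitivity (cintegral lam (fun x => cintegral lam (fun y => F (x, y)))).
    by apply: eq_cintegral => x; rewrite E1'.
  transitivity (cintegral lam (fun y => cintegral lam (fun x => F (x, y)))).
    exact: cFubini.
  transitivity (cintegral lam (fun y => g0 y * cintegral mu (fun x : borel G => f x * Q x y))).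
    by apply: eq_cintegral => y; rewrite E2'.
  rewrite (cintegral_restr mu mH lam lamE _ mg0P)//.
  exact: ae_eq_cintegral.
apply: (ae_eq_cintegrable mu mg0P mgP g0gP).
apply/(cintegrable_restr mu mH lam lamE _ g0off).
rewrite (_ : (fun _ => _) = fun y => cintegral lam (fun x => F (x, y))); last first.
  by apply/funext => y; rewrite E2'.
apply: (cintegrable_cfubini lam lam (fun p => F (p.2, p.1))).
  apply: (cmeasurable_comp (fun p : borel G * borel G => (p.2, p.1)) F); last exact: mF.
  by apply/measurable_fun_pairP; split; [exact: measurable_snd|exact: measurable_fst].
move: Ffin; rewrite (fubini_tonelli (fun p => (normc (F p))%:E))//.
  by apply/measurable_EFinP; exact: measurable_normc.
by move=> p; rewrite lee_fin normc_ge0.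
Qed.

End Swap.

(** * The bilinear form and its bounds *)

Section Derivation.
Context {R : realType} {G : topologicalGroupType}.
Context {mu : {measure set (borel G) -> \bar R}} {w : weight G R}.
Hypothesis hG : hausdorff_space G.
Hypothesis lcG : locally_compact [set: G].
Hypothesis Hmu : left_Haar_measure mu.
Context {U : set G}.
Hypothesis cU : compact U.
Hypothesis U1 : nbhs 1%g U.
Hypothesis UC : forall x y, U (x * y)%g -> U (y * x)%g.
Context {W : set G}.
Hypothesis cW : compact W.
Hypothesis WC : forall x y, W (x * y)%g -> W (y * x)%g.
Context {Phi : G -> R[i]} {M1 M2 : R}.
Hypothesis mPhi : cmeasurable (Phi : baire R G -> R[i]).
Hypothesis PhiM : forall x y, Phi (x * y)%g = Phi x + Phi y.
Hypothesis WM1 : forall x y, W (x * y)%g -> 1 <= M1 * (w x * w y).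
Hypothesis WM2 : forall x y, W (x * y)%g -> normc (Phi x) <= M2 * (w x * w y).
Hypothesis M10 : 0 <= M1.
Hypothesis M20 : 0 <= M2.

Let wsum := @wsum R G mu w.
Let fnorm (f : borel G -> R[i]) : R := fine (wnorm mu w f).
Let w0 (x : G) : 0 <= w x. Proof. exact/ltW/weight_gt0. Qed.

(** The common pattern of the estimates below; the factor [2] is the one of [normc_cintegral]. *)
Lemma wsum_bound (F f : borel G -> R[i]) (k : R) : wsum f -> cmeasurable F -> 0 <= k ->
  (forall y, normc (F y) <= k * (normc (f y) * w y)) ->
  cintegrable mu F /\ normc (cintegral mu F) <= 2 * (k * fnorm f).
Proof.
move=> [mf foo] mF k0 Fk.
have mb : measurable_fun setT (fun y : borel G => k * (normc (f y) * w y)).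
  by apply: measurable_funM => //; apply/measurable_EFinP; exact: measurable_wnorm.
have bE : (\int[mu]_y (k * (normc (f y) * w y))%:E = k%:E * wnorm mu w f)%E.
  rewrite /wnorm -ge0_integralZl_EFin//.
  - by move=> y _; exact: wnorm_integrand_ge0.
  - exact: measurable_wnorm.
have boo : (\int[mu]_y (k * (normc (f y) * w y))%:E < +oo)%E.
  by rewrite bE; apply: lte_mul_pinfty.
split; first exact: (le_cintegrable mu (fun y => k * (normc (f y) * w y))).
apply: (le_trans (normc_cintegral mu (fun y => k * (normc (f y) * w y)) mF Fk mb boo)).
rewrite bE fineM//.
by rewrite ge0_fin_numE ?wnorm_ge0.
Qed.

Let chi (x : G) : R[i] := (\1_W x : R)%:C%C.

(** The integral of [c] over [x^-1 W], that is, the inner integral of the bilinear form with [Phi x]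
    left out. *)
Definition chint (c : borel G -> R[i]) (x : G) : R[i] :=
  cintegral mu (fun y : borel G => c y * chi (x * (y : G))%g).

Definition dform (a c : borel G -> R[i]) : R[i] :=
  cintegral mu (fun x : borel G => a x * (Phi x * chint c x)).

Lemma normc_chi x : normc (chi x) = \1_W x.
Proof. by rewrite /chi normc_real ger0_norm. Qed.

Lemma chi_le1 x y : normc (chi (x * y)%g) <= M1 * (w x * w y).
Proof.
rewrite normc_chi indicE; case: (boolP (_ \in _)) => [/set_mem/WM1//|_].
by rewrite mulr_ge0// mulr_ge0.
Qed.

Lemma chi_le2 x y : normc (Phi x * chi (x * y)%g) <= M2 * (w x * w y).
Proof.
rewrite normcM normc_chi indicE; case: (boolP (_ \in _)) => [/set_mem/WM2|_].
  by rewrite mulr1.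
by rewrite mulr0 mulr_ge0// mulr_ge0.
Qed.

Let bW : measurable (W : set (borel G)). Proof. exact: compact_borel. Qed.

Lemma chiC x y : chi (x * y)%g = chi (y * x)%g.
Proof.
rewrite /chi !indicE; congr (_%:R%:C)%C; congr nat_of_bool.
by apply/idP/idP => /set_mem/WC/mem_set.
Qed.

Lemma cmeasurable_chi : cmeasurable (chi : borel G -> R[i]).
Proof. exact: cmeasurable_indic. Qed.

Lemma cmeasurable_chint_in c x : cmeasurable c ->
  cmeasurable (fun y : borel G => c y * chi (x * (y : G))%g).
Proof.
by move=> mc; apply: cmeasurableM => //; exact: cmeasurable_comp (lmul_borel x) cmeasurable_chi.
Qed.

Lemma chint_ae c c' x : cmeasurable c -> cmeasurable c' ->
  {ae mu, forall y, c y = c' y} -> chint c x = chint c' x.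
Proof.
move=> mc mc' cc'.
apply: ae_eq_cintegral; [exact: cmeasurable_chint_in|exact: cmeasurable_chint_in|].
by apply: filterS cc' => y ->.
Qed.

Lemma chint_bound1 c x : wsum c ->
  cintegrable mu (fun y : borel G => c y * chi (x * (y : G))%g) /\
  normc (chint c x) <= (2 * M1 * fnorm c) * w x.
Proof.
move=> wc; have [mc _] := wc.
have [] := wsum_bound _ c (M1 * w x) wc (cmeasurable_chint_in c x mc).
- by rewrite mulr_ge0.
- move=> y; rewrite normcM mulrCA ler_wpM2l ?normc_ge0// -mulrA.
  exact: chi_le1.
by rewrite -!mulrA [w x * _]mulrC.
Qed.

(** [WM2] bounds [Phi x] only where [x y] lies in [W], so [Phi x] is moved under the integral, next
    to [chi]. *)
Lemma chint_bound2 c x : wsum c ->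
  normc (Phi x * chint c x) <= (2 * M2 * fnorm c) * w x.
Proof.
move=> wc; have [mc _] := wc.
rewrite -cintegral_Z; last by case: (chint_bound1 c x wc).
have [] := wsum_bound (fun y => Phi x * (c y * chi (x * y)%g)) c (M2 * w x) wc.
- by apply: cmeasurableM; [exact: cmeasurable_cst|exact: cmeasurable_chint_in].
- by rewrite mulr_ge0.
- move=> y; rewrite mulrCA normcM mulrCA ler_wpM2l ?normc_ge0// -mulrA.
  exact: chi_le2.
by move=> _; rewrite -!mulrA [w x * _]mulrC.
Qed.

Section Carried.
Context {H : set G} (HH : open_sigma_subgroup H) (WH : W `<=` H).
Context {c : borel G -> R[i]}.
Hypothesis wc : wsum c.
Hypothesis cH : @carried R G mu H c.

Lemma chi0 (x y : G) : ~ H x -> H y -> chi (x * y)%g = 0.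
Proof.
move=> nHx Hy; rewrite /chi indicE memNset// => /WH /(ossMl HH _ _ Hy).
by [].
Qed.

Lemma chint0 (x : G) : ~ H x -> chint c x = 0.
Proof.
move=> nHx; have [mc _] := wc.
rewrite /chint (ae_eq_cintegral mu (cmeasurable_chint_in c x mc) (cmeasurable_cst 0)).
  by rewrite /cintegral /Rintegral /= integral0.
apply: (ae_imp cH) => y cy.
have [Hy|nHy] := pselect (H y); first by rewrite chi0// mulr0.
by rewrite cy// mul0r.
Qed.

(** [W] is replaced by an almost equal Baire set, which left translations allow for each [x], and
    [c] by a Baire version. Baire and not only Borel measurability is sought because [chint c] will
    be composed with the multiplication. *)
Lemma chint_baire : cmeasurable (chint c : baire R G -> R[i]).
Proof.
have [mc _] := wc.
have [lam lamE] := haar_restriction hG Hmu HH.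
have mH : measurable (H : set (borel G)) by exact: oss_borel.
have [ga [mga ga0 cga wga]] := wsum_version hG lcG Hmu _ _ HH wc cH.
have [mga' _] := wga.
have [Z mZ WZ] := borel_ae_baire hG lcG Hmu _ bW (haar_compact Hmu _ cW).
pose E (p : baire R G * borel G) : R[i] :=
  ga p.2 * (\1_Z (retr H p.1 * retr H p.2)%g : R)%:C%C.
have mE : cmeasurable E.
  apply: cmeasurableM.
    exact: (cmeasurable_comp snd (ga : borel G -> R[i]) measurable_snd mga').
  apply: (cmeasurable_comp (fun p : baire R G * borel G =>
    (retr H p.1 * retr H p.2)%g : baire R G) (fun z => (\1_Z z : R)%:C%C)); last first.
    exact: cmeasurable_indic.
  have mid : measurable_fun setT (fun p : baire R G * borel G =>
      (p.1, p.2) : baire R G * baire R G).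
    apply/measurable_fun_pairP; split; first exact: measurable_fst.
    exact: (measurableT_comp measurable_id_baire measurable_snd).
  apply: (measurableT_comp (measurable_baire_prod hG lcG HH (fun p => p.1 * p.2)%g _) mid).
  exact: mulg_continuous.
rewrite (_ : chint c = fun x => (\1_H x : R)%:C%C * cintegral lam (fun y => E (x, y))).
  apply: cmeasurableM; first by apply: cmeasurable_indic; exact: measurable_oss.
  exact: cmeasurable_cfubini.
apply/funext => x; have [Hx|nHx] := pselect (H x); last first.
  by rewrite chint0// indicE memNset// mul0r.
rewrite indicE mem_set// mul1r (cintegral_restr mu mH lam lamE); last 2 first.
- exact: cmeasurable_pair1 mE x.
- by move=> y nHy; rewrite /E /= ga0// mul0r.
apply: ae_eq_cintegral; [exact: cmeasurable_chint_in|exact: cmeasurable_pair1 mE x|].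
have WZx := ae_lmul Hmu _ x WZ.
apply: filterS2 cga WZx => y cy WZy; rewrite /E /= cy.
have [Hy|nHy] := pselect (H y); last by rewrite ga0// !mul0r.
rewrite !retr_id// /chi !indicE; congr (_ * _%:R%:C)%C; congr nat_of_bool.
by apply/idP/idP => /set_mem/WZy/mem_set.
Qed.

Lemma cmeasurable_chint_carried : cmeasurable (chint c : borel G -> R[i]).
Proof. by apply: cmeasurable_borel; exact: chint_baire. Qed.

End Carried.

Lemma cmeasurable_chint c : wsum c -> cmeasurable (chint c : borel G -> R[i]).
Proof.
move=> wc; have [H [HH UH WH [cH _ _]]] := exists_carrier hG lcG Hmu cU _ _ _ _
  (compact_sigma_compact _ cW) wc wc wc.
exact: (cmeasurable_chint_carried HH WH wc cH).
Qed.

Lemma cmeasurable_Phi_chint c : wsum c -> cmeasurable (fun x : borel G => Phi x * chint c x).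
Proof.
by move=> wc; apply: cmeasurableM; [exact: cmeasurable_borel|exact: cmeasurable_chint].
Qed.

Lemma cmeasurable_dform_in a c : wsum a -> wsum c ->
  cmeasurable (fun x : borel G => a x * (Phi x * chint c x)).
Proof. by move=> [ma _] wc; apply: cmeasurableM => //; exact: cmeasurable_Phi_chint. Qed.

Lemma fnorm_ge0 f : 0 <= fnorm f.
Proof. by rewrite fine_ge0// wnorm_ge0. Qed.

(** The constant [4] collects a factor [2] from each of the two integrations. *)
Lemma dform_bound a c : wsum a -> wsum c ->
  cintegrable mu (fun x : borel G => a x * (Phi x * chint c x)) /\
  normc (dform a c) <= (4 * M2) * fnorm a * fnorm c.
Proof.
move=> wa wc.
have [||] := wsum_bound _ a (2 * M2 * fnorm c) wa (cmeasurable_dform_in a c wa wc).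
- by rewrite !mulr_ge0// fnorm_ge0.
- move=> x; rewrite normcM mulrCA ler_wpM2l ?normc_ge0//.
  exact: chint_bound2.
move=> ia /le_trans le; split => //; apply: le; lra.
Qed.

Lemma dform_ae a a' c c' : wsum a -> wsum a' -> wsum c -> wsum c' ->
  {ae mu, forall x, a x = a' x} -> {ae mu, forall x, c x = c' x} ->
  dform a c = dform a' c'.
Proof.
move=> wa wa' wc wc' aa' cc'.
apply: ae_eq_cintegral; [exact: cmeasurable_dform_in|exact: cmeasurable_dform_in|].
have [mc _] := wc; have [mc' _] := wc'.
by apply: filterS aa' => x ->; rewrite (chint_ae c c').
Qed.

Lemma wsumD f g (k : R[i]) : wsum f -> wsum g -> wsum (fun x => k * f x + g x).
Proof.
move=> wf wg; apply/(wsummableP mu w).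
by apply: (wsummable_submod_closed mu w).2; exact/wsummableP.
Qed.

Lemma chintD (k : R[i]) c c' x : wsum c -> wsum c' ->
  chint (fun y => k * c y + c' y) x = k * chint c x + chint c' x.
Proof.
move=> wc wc'; have [ic _] := chint_bound1 c x wc; have [ic' _] := chint_bound1 c' x wc'.
rewrite /chint -cintegral_Z// -cintegral_D//; last exact: cintegrableZ.
by apply: eq_cintegral => y; rewrite mulrDl mulrA.
Qed.

Lemma dformDr (k : R[i]) a c c' : wsum a -> wsum c -> wsum c' ->
  dform a (fun y => k * c y + c' y) = k * dform a c + dform a c'.
Proof.
move=> wa wc wc'; have [ic _] := dform_bound a c wa wc; have [ic' _] := dform_bound a c' wa wc'.
rewrite /dform -cintegral_Z// -cintegral_D//; last exact: cintegrableZ.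
by apply: eq_cintegral => x; rewrite chintD//; ring.
Qed.

Lemma dformDl (k : R[i]) a a' c : wsum a -> wsum a' -> wsum c ->
  dform (fun y => k * a y + a' y) c = k * dform a c + dform a' c.
Proof.
move=> wa wa' wc; have [ic _] := dform_bound a c wa wc; have [ic' _] := dform_bound a' c wa' wc.
rewrite /dform -cintegral_Z// -cintegral_D//; last exact: cintegrableZ.
by apply: eq_cintegral => x; ring.
Qed.

(** Here the argument of [Phi] stands second in the product. The symmetry of [chi] replaces [y x z]
    by [x z y], and [WM2] applies with [x] in front. *)
Lemma chint_bound3 c x y : wsum c ->
  normc (Phi x * chint c (y * x)%g) <= (2 * M2 * fnorm c * w y) * w x.
Proof.
move=> wc; have [mc _] := wc.
rewrite -cintegral_Z; last by case: (chint_bound1 c (y * x)%g wc).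
have [] := wsum_bound (fun z => Phi x * (c z * chi (y * x * z)%g)) c (M2 * (w x * w y)) wc.
- by apply: cmeasurableM; [exact: cmeasurable_cst|exact: cmeasurable_chint_in].
- by rewrite !mulr_ge0.
- move=> z; rewrite mulrCA normcM mulrCA ler_wpM2l ?normc_ge0//.
  rewrite -mulgA chiC -mulgA.
  apply: (le_trans (chi_le2 x (z * y)%g)); rewrite -!mulrA ler_wpM2l// ler_wpM2l//.
  by rewrite [leRHS]mulrC weight_submul.
by move=> _ /le_trans; apply; lra.
Qed.

Section Kernel.
Context {H : set G} (HH : open_sigma_subgroup H).
Context {f g : borel G -> R[i]} {K : borel G -> R[i]} {C : R}.
Hypothesis wf : wsum f.
Hypothesis wg : wsum g.
Hypothesis fH : @carried R G mu H f.
Hypothesis gH : @carried R G mu H g.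
Hypothesis mK : cmeasurable K.
Hypothesis KC : forall x, normc (K x) <= C * w x.
Hypothesis K0 : forall x, ~ H x -> K x = 0.

Lemma conv_integral (h : borel G -> R[i]) : cmeasurable h -> is_convolution mu f g h ->
  cintegral mu (fun x => h x * K x) =
  cintegral mu (fun y : borel G =>
    f y * cintegral mu (fun x : borel G => g x * K ((y : G) * (x : G))%g)).
Proof.
move=> mh fgh; have [mf _] := wf; have [mg _] := wg.
have [lam lamE] := haar_restriction hG Hmu HH.
have [al [mal al0 fal wal]] := wsum_version hG lcG Hmu _ _ HH wf fH.
have [be [mbe be0 gbe wbe]] := wsum_version hG lcG Hmu _ _ HH wg gH.
exact: (cintegral_conv hG lcG Hmu cU U1 UC HH lamE mal mbe al0 be0 wal wbe mK KC K0 mf mg fal gbe).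
Qed.

(* The factor [p] is [1] or [Phi]. *)
Lemma cmeasurable_shift (p : G -> R[i]) : cmeasurable (p : baire R G -> R[i]) ->
  cmeasurable (fun y : borel G =>
    cintegral mu (fun x : borel G => (g x * p x) * K ((y : G) * (x : G))%g)).
Proof.
move=> mp; have [mg _] := wg.
have [lam lamE] := haar_restriction hG Hmu HH.
have [be [mbe be0 gbe wbe]] := wsum_version hG lcG Hmu _ _ HH wg gH.
pose bp (x : G) := be x * p x.
have mbp : cmeasurable (bp : baire R G -> R[i]) by exact: cmeasurableM.
have bp0 x : ~ H x -> bp x = 0 by move=> nHx; rewrite /bp be0// mul0r.
have mgp : cmeasurable (fun x : borel G => g x * p x).
  by apply: cmeasurableM => //; exact: cmeasurable_borel.
have gp : {ae mu, forall x, g x * p x = bp x} by apply: filterS gbe => x ->.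
rewrite (_ : (fun _ => _) = pairing (mu := mu) (be := bp) (K := K)).
  exact: (cmeasurable_pairing hG lcG Hmu HH lamE mbp bp0 mK K0).
apply/funext => y; symmetry; exact: (pairingE mbp mK mgp gp).
Qed.

End Kernel.

Lemma cmeasurable_shift1 {H : set G} {g K : borel G -> R[i]} : open_sigma_subgroup H ->
  wsum g -> @carried R G mu H g -> cmeasurable K -> (forall x, ~ H x -> K x = 0) ->
  cmeasurable (fun y : borel G => cintegral mu (fun x : borel G => g x * K ((y : G) * (x : G))%g)).
Proof.
move=> HH wg gH mK K0; have := cmeasurable_shift HH wg gH mK K0 (fun=> 1) (cmeasurable_cst 1).
congr (cmeasurable _); apply/funext => y; apply: eq_cintegral => x; by rewrite mulr1.
Qed.

(** * The derivation identity *)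

Section DerivationIdentity.
Context {H : set G} (HH : open_sigma_subgroup H) (WH : W `<=` H).
Context {a b c ab bc ca : borel G -> R[i]}.
Hypothesis wa : wsum a.
Hypothesis wb : wsum b.
Hypothesis wc : wsum c.
Hypothesis wab : wsum ab.
Hypothesis wbc : wsum bc.
Hypothesis wca : wsum ca.
Hypothesis aH : @carried R G mu H a.
Hypothesis bH : @carried R G mu H b.
Hypothesis cH : @carried R G mu H c.
Hypothesis abE : is_convolution mu a b ab.
Hypothesis bcE : is_convolution mu b c bc.
Hypothesis caE : is_convolution mu c a ca.

Let I := chint c.
Let mI : cmeasurable (I : borel G -> R[i]). Proof. exact: cmeasurable_chint. Qed.
Let I0 x : ~ H x -> I x = 0. Proof. exact: (chint0 HH WH wc cH). Qed.
Let IC x : normc (I x) <= (2 * M1 * fnorm c) * w x.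
Proof. by case: (chint_bound1 c x wc). Qed.

Let chix (x : G) (y : borel G) : R[i] := chi (x * (y : G))%g.
Let mchix x : cmeasurable (chix x).
Proof. exact: cmeasurable_comp (lmul_borel x) cmeasurable_chi. Qed.
Let chixC x y : normc (chix x y) <= (M1 * w x) * w y.
Proof. by rewrite -mulrA; exact: chi_le1. Qed.
Let chix0 x y : H x -> ~ H y -> chix x y = 0.
Proof.
move=> Hx nHy; rewrite /chix chiC; exact: (chi0 HH WH _ _ nHy Hx).
Qed.

(** The two halves of [D(ab)(c)] after [Phi (y x) = Phi y + Phi x]: the integral of [a Phi T] will
    be [D(a)(bc)], that of [a S] will be [D(b)(ca)]. *)
Let T (y : borel G) := cintegral mu (fun x : borel G => b x * I ((y : G) * (x : G))%g).
Let S (y : borel G) := cintegral mu (fun x : borel G => (b x * Phi x) * I ((y : G) * (x : G))%g).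

Let mT : cmeasurable T. Proof. exact: (cmeasurable_shift1 HH wb bH mI I0). Qed.
Let mS : cmeasurable S. Proof. exact: (cmeasurable_shift HH wb bH mI I0 Phi mPhi). Qed.

Let mIy (y : G) : cmeasurable (fun x : borel G => I (y * (x : G))%g).
Proof. exact: cmeasurable_comp (lmul_borel y) mI. Qed.

Let fnc0 : 0 <= 2 * M1 * fnorm c.
Proof. by rewrite !mulr_ge0// fnorm_ge0. Qed.
Let fnc20 : 0 <= 2 * M2 * fnorm c.
Proof. by rewrite !mulr_ge0// fnorm_ge0. Qed.

Let iT y : cintegrable mu (fun x : borel G => b x * I (y * (x : G))%g).
Proof.
have [mb _] := wb.
have [] // := wsum_bound (fun x : borel G => b x * I (y * (x : G))%g) b (2 * M1 * fnorm c * w y) wb.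
- exact: cmeasurableM.
- by rewrite mulr_ge0.
- move=> x; rewrite normcM mulrCA ler_wpM2l ?normc_ge0//.
  apply: (le_trans (IC _)); rewrite -[leRHS]mulrA ler_wpM2l//; exact: weight_submul.
Qed.

Let iS y : cintegrable mu (fun x : borel G => (b x * Phi x) * I (y * (x : G))%g).
Proof.
have [mb _] := wb.
have [] // := wsum_bound (fun x : borel G => (b x * Phi x) * I (y * (x : G))%g) b
  (2 * M2 * fnorm c * w y) wb.
- by apply: cmeasurableM => //; apply: cmeasurableM => //; exact: cmeasurable_borel.
- by rewrite mulr_ge0.
- move=> x; rewrite -mulrA normcM mulrCA ler_wpM2l ?normc_ge0//.
  exact: chint_bound3.
Qed.

Lemma dform_ab : dform ab c =
  cintegral mu (fun y => a y * (Phi y * T y + S y)).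
Proof.
have mPI : cmeasurable (fun x : borel G => Phi x * I x) by exact: cmeasurable_Phi_chint.
have [mab _] := wab.
have PI0 x : ~ H x -> Phi x * I x = 0 by move=> /I0 ->; rewrite mulr0.
rewrite /dform (conv_integral HH wa wb aH bH mPI (fun x => chint_bound2 c x wc) PI0 ab mab abE).
apply: eq_cintegral => y; congr (_ * _).
rewrite -cintegral_Z// -cintegral_D//; last exact: cintegrableZ.
apply: eq_cintegral => x; rewrite PhiM; ring.
Qed.

(** For [y] in [H], expanding [b c] against the kernel [chi (y .)] gives [chint bc y = T y], by
    associativity alone. For other [y] that kernel need not vanish off [H], but [a] vanishes almost
    everywhere there. *)
Lemma dform_bc : dform a bc = cintegral mu (fun y => a y * (Phi y * T y)) /\
  cintegrable mu (fun y => a y * (Phi y * T y)).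
Proof.
have [ma _] := wa; have [mbc _] := wbc.
have ia := (dform_bound a bc wa wbc).1.
have maT : cmeasurable (fun y => a y * (Phi y * T y)).
  by apply: cmeasurableM => //; apply: cmeasurableM => //; exact: cmeasurable_borel.
have maI := cmeasurable_dform_in a bc wa wbc.
have eqT : {ae mu, forall y, a y * (Phi y * chint bc y) = a y * (Phi y * T y)}.
  apply: (ae_imp aH) => y ay.
  have [Hy|nHy] := pselect (H y); last by rewrite ay// !mul0r.
  congr (_ * (_ * _)); rewrite /chint.
  rewrite (conv_integral HH wb wc bH cH (mchix y) (chixC y) (chix0 y ^~ Hy) bc mbc bcE).
  by apply: eq_cintegral => x; congr (_ * _); apply: eq_cintegral => z; rewrite /chix mulgA.
split; first exact: ae_eq_cintegral.
exact: (ae_eq_cintegrable mu maI maT eqT ia).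
Qed.

Let rmul_borel (x : G) : measurable_fun setT (fun y : borel G => ((y : G) * x)%g : borel G).
Proof. by apply: continuous_borel; exact: continuous_rmulg. Qed.

Let wv (f : borel G -> R[i]) : wsum f -> measurable_fun setT (fun x : borel G => normc (f x) * w x).
Proof. by move=> [mf _]; apply/measurable_EFinP; exact: measurable_wnorm. Qed.

Let wv0 (f : borel G -> R[i]) x : 0 <= normc (f x) * w x.
Proof. by rewrite mulr_ge0// normc_ge0. Qed.

Let wkfin (f : borel G -> R[i]) (k : R) : wsum f -> 0 <= k ->
  (\int[mu]_x (k * (normc (f x) * w x))%:E < +oo)%E.
Proof.
move=> [mf foo] k0; under eq_integral do rewrite EFinM.
rewrite ge0_integralZl_EFin//.
- exact: lte_mul_pinfty.
- by move=> x _; exact: wnorm_integrand_ge0.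
- exact: measurable_wnorm.
Qed.

Let iIa (x : G) : cintegrable mu (fun y : borel G => a y * I ((y : G) * x)%g).
Proof.
have [ma _] := wa.
have [] // := wsum_bound (fun y : borel G => a y * I ((y : G) * x)%g) a (2 * M1 * fnorm c * w x) wa.
- by apply: cmeasurableM => //; exact: cmeasurable_comp (rmul_borel x) mI.
- by rewrite mulr_ge0.
- move=> y; rewrite normcM mulrCA ler_wpM2l ?normc_ge0//.
  apply: (le_trans (IC _)); rewrite -[leRHS]mulrA ler_wpM2l// mulrC; exact: weight_submul.
Qed.

(** The cyclic step: [chi (x z y) = chi (y x z)], after which the integral over [z] is [I (y x)].
    The interchange uses a Baire set [Z] almost equal to [W]; comparing them in the variable [z],
    with [y] on its right, is where invariance of null sets under right translations enters. *)
Lemma chint_ca (x : G) : H x ->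
  chint ca x = cintegral mu (fun y : borel G => a y * I ((y : G) * x)%g).
Proof.
move=> Hx; have [ma _] := wa; have [mc _] := wc; have [mca _] := wca.
have [Z mZ WZ] := borel_ae_baire hG lcG Hmu _ bW (haar_compact Hmu _ cW).
rewrite /chint (conv_integral HH wc wa cH aH (mchix x) (chixC x) (chix0 x ^~ Hx) ca mca caE).
have chiE (z y : G) : chi (x * (z * y))%g = chi (y * x * z)%g.
  by rewrite mulgA (chiC (x * z)%g) mulgA.
have mQ' : cmeasurable (fun p : borel G * borel G =>
    (\1_Z (x * (retr H p.1 * retr H p.2))%g : R)%:C%C).
  apply: (cmeasurable_baire_prod hG lcG HH (fun p => x * (p.1 * p.2))%g
    (fun z => (\1_Z z : R)%:C%C)); last exact: cmeasurable_indic.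
  by apply: continuous_mulg => [p|]; [exact: cvg_cst|exact: mulg_continuous].
have QZ z y : H z -> H y -> (W (x * (z * y))%g <-> Z (x * (z * y))%g) ->
    chi (x * (z * y))%g = (\1_Z (x * (retr H z * retr H y))%g : R)%:C%C.
  move=> Hz Hy WZzy; rewrite !retr_id// /chi !indicE; congr (_%:R%:C)%C; congr nat_of_bool.
  by apply/idP/idP => /set_mem/WZzy/mem_set.
have [] := @cintegral_swap R G mu hG Hmu H HH c a
  (fun z => (M1 * w x) * (normc (c z) * w z)) (fun y => normc (a y) * w y)
  (fun z y => chi (x * (z * y))%g)
  (fun p => (\1_Z (x * (retr H p.1 * retr H p.2))%g : R)%:C%C) mc ma cH aH mQ'.
- move=> z Hz; have WZz := ae_lmul Hmu _ (x * z)%g WZ.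
  by apply: (ae_imp WZz) => y; rewrite -mulgA => WZy Hy; exact: QZ.
- move=> y Hy; have WZy := ae_rmul_sigma hG lcG Hmu cU U1 UC H _ y (oss_sigma _ HH)
    (ae_lmul Hmu _ x WZ).
  apply: (ae_imp WZy) => z WZz Hz.
  by apply: QZ => //; exact: WZz.
- move=> z; case: (chint_bound1 a (x * z)%g wa) => + _; congr cintegrable.
  by apply/funext => y; rewrite mulgA.
- move=> y; case: (chint_bound1 c (y * x)%g wc) => + _; congr cintegrable.
  by apply/funext => z; rewrite chiE.
- move=> z y; rewrite !normcM.
  have := chi_le1 x (z * y)%g => le1.
  apply: (@le_trans _ _ (normc (c z) * (normc (a y) * (M1 * (w x * (w z * w y)))))).
    rewrite ler_wpM2l ?normc_ge0// ler_wpM2l ?normc_ge0//; apply: (le_trans le1).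
    by rewrite ler_wpM2l// ler_wpM2l// weight_submul.
  by lra.
- by apply: measurable_funM => //; exact: wv.
- exact: wv.
- by move=> z; rewrite mulr_ge0// mulr_ge0.
- by move=> y.
- by apply: wkfin => //; rewrite mulr_ge0.
- by case: wa.
- exact: (cmeasurable_shift1 HH wa aH (mchix x) (chix0 x ^~ Hx)).
- rewrite (_ : (fun _ => _) = fun y : borel G => I ((y : G) * x)%g).
    exact: cmeasurable_comp (rmul_borel x) mI.
  by apply/funext => y; apply: eq_cintegral => z; rewrite chiE.
move=> E _; rewrite /chix; rewrite E; apply: eq_cintegral => y; congr (_ * _).
by apply: eq_cintegral => z; rewrite chiE.
Qed.

(** A second interchange, between [x] and [y]. The kernel [I (y x)] is built from a Baire function,
    so its product-measurable form agrees with it on all of [H * H]. *)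
Lemma dform_ca : dform b ca = cintegral mu (fun y => a y * S y) /\
  cintegrable mu (fun y => a y * S y).
Proof.
have [ma _] := wa; have [mb _] := wb; have [mc _] := wc.
have mbP : cmeasurable (fun x : borel G => b x * Phi x).
  by apply: cmeasurableM => //; exact: cmeasurable_borel.
have bPH : @carried R G mu H (fun x => b x * Phi x).
  apply: (ae_imp bH) => x bx nHx.
  by rewrite bx// mul0r.
have V0 (x : G) : ~ H x -> cintegral mu (fun y : borel G => a y * I ((y : G) * x)%g) = 0.
  move=> nHx; rewrite (ae_eq_cintegral mu (cintegrable_cmeasurable mu (iIa x)) (cmeasurable_cst 0)).
    by rewrite /cintegral /Rintegral /= integral0.
  apply: (ae_imp aH) => y ay.
  have [Hy|nHy] := pselect (H y); last by rewrite ay// mul0r.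
  by rewrite I0 ?mulr0// => /(ossMr HH _ _ Hy).
have mV : cmeasurable (fun x : borel G =>
    cintegral mu (fun y : borel G => a y * I ((y : G) * (x : G))%g)).
  rewrite (_ : (fun _ => _) = fun x : borel G => (\1_H x : R)%:C%C * chint ca x).
    apply: cmeasurableM; last exact: cmeasurable_chint.
    by apply: cmeasurable_indic; exact: oss_borel.
  apply/funext => x; have [Hx|nHx] := pselect (H x).
    by rewrite indicE mem_set// mul1r chint_ca.
  by rewrite indicE memNset// mul0r V0.
have mQ' : cmeasurable (fun p : borel G * borel G => I (retr H p.2 * retr H p.1)%g).
  apply: (cmeasurable_baire_prod hG lcG HH (fun p => p.2 * p.1)%g I).
    by apply: continuous_mulg => p; [exact: cvg_snd|exact: cvg_fst].
  exact: (chint_baire HH WH wc cH).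
have [] := @cintegral_swap R G mu hG Hmu H HH (fun x => b x * Phi x) a
  (fun x => (2 * M2 * fnorm c) * (normc (b x) * w x)) (fun y => normc (a y) * w y)
  (fun x y => I (y * x)%g) (fun p => I (retr H p.2 * retr H p.1)%g) mbP ma bPH aH mQ'.
- by move=> x Hx; apply: aeW => y Hy; rewrite !retr_id.
- by move=> y Hy; apply: aeW => x Hx; rewrite !retr_id.
- by move=> x; exact: iIa.
- by move=> y; exact: iS.
- move=> x y; rewrite -[b x * Phi x * _]mulrA normcM.
  apply: (@le_trans _ _ (normc (b x) * (normc (a y) * (2 * M2 * fnorm c * w y * w x)))).
    rewrite ler_wpM2l ?normc_ge0// mulrCA normcM ler_wpM2l ?normc_ge0//.
    exact: chint_bound3.
  by lra.
- by apply: measurable_funM => //; exact: wv.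
- exact: wv.
- by move=> x; rewrite mulr_ge0.
- by move=> y.
- exact: wkfin.
- by case: wa.
- exact: mV.
- exact: mS.
move=> E iE; split; last exact: iE.
rewrite -[RHS]E.
apply: ae_eq_cintegral; first exact: cmeasurable_dform_in.
  exact: cmeasurableM.
apply: (ae_imp bH) => x bx.
have [Hx|nHx] := pselect (H x).
  by rewrite (chint_ca x Hx) mulrA.
have mul00 (r s t : R[i]) : 0 * r = 0 * s * t by rewrite !mul0r.
by rewrite (bx nHx); exact: mul00.
Qed.

Lemma dform_derivation_carried : dform ab c = dform b ca + dform a bc.
Proof.
have [E1 i1] := dform_bc; have [E2 i2] := dform_ca.
rewrite dform_ab E1 E2 addrC -cintegral_D//.
by apply: eq_cintegral => y; rewrite mulrDr.
Qed.

End DerivationIdentity.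

Lemma dform_derivation (a b c ab bc ca : borel G -> R[i]) :
  wsum a -> wsum b -> wsum c -> wsum ab -> wsum bc -> wsum ca ->
  is_convolution mu a b ab -> is_convolution mu b c bc -> is_convolution mu c a ca ->
  dform ab c = dform b ca + dform a bc.
Proof.
move=> wa wb wc wab wbc wca abE bcE caE.
have [H [HH UH WH [aH bH cH]]] := exists_carrier hG lcG Hmu cU _ _ _ _
  (compact_sigma_compact _ cW) wa wb wc.
exact: (dform_derivation_carried HH WH wa wb wc wab wbc wca aH bH cH abE bcE caE).
Qed.

End Derivation.

(** * Commuting translates *)

Lemma normcE {R : realType} (z : R[i]) : `|z| = (normc z)%:C%C.
Proof. by case: z. Qed.

Lemma bounded_additive_continuous {K : numFieldType} {A B : normedModType K}
    (f : A -> B) (C : K) : 0 <= C ->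
  (forall x y, `|f x - f y| <= C * `|x - y|) -> continuous f.
Proof.
move=> C0 fC x; apply/cvgrPdist_lt => e e0.
(* [C + 1] in place of [C], which may be zero, permits the division. *)
have C1 : 0 < C + 1 by rewrite ltr_wpDl.
have d0 : 0 < e / (C + 1) by rewrite divr_gt0.
have : \forall y \near x, `|x - y| < e / (C + 1).
  by apply: (@cvgr_dist_lt _ _ _ (nbhs x) _ idfun x) => //; exact: cvg_id.
apply: filterS => y xy; apply: (le_lt_trans (fC x y)).
apply: (@le_lt_trans _ _ ((C + 1) * `|x - y|)); first by rewrite ler_wpM2r// lerDl.
by rewrite mulrC -ltr_pdivlMr.
Qed.

(** * Representatives of classes in the weighted [L^1] space *)

Section L1Facts.
Local Open Scope quotient_scope.
Context {R : realType} {G : topologicalGroupType}.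
Context {mu : {measure set (borel G) -> \bar R}} {w : weight G R}.

Let wsum := @wsum R G mu w.

Lemma wsum_repr (a : L1 mu w) : wsum (repr a).
Proof.
split; first exact: wfun_cmeasurable.
by have := wfun_wnorm_fin (repr a); rewrite ge0_fin_numE// wnorm_ge0.
Qed.

Definition wfun_of (f : borel G -> R[i]) (wf : wsum f) : wfun mu w :=
  WFun ((wsummableP mu w f).2 wf).

Lemma repr_ae (f : wfun mu w) (a : L1 mu w) : a = \pi_(L1 mu w) f ->
  {ae mu, forall x, repr a x = f x}.
Proof.
move=> af; have /L1_eqP/wnullP : \pi_(L1 mu w) (repr a) = \pi_(L1 mu w) f by rewrite reprK.
apply: filterS => x fx; apply/eqP; rewrite -subr_eq0; apply/eqP; exact: fx.
Qed.

Lemma L1_ext (a b : L1 mu w) : {ae mu, forall x, repr a x = repr b x} -> a = b.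
Proof.
move=> ab; rewrite -[a]reprK -[b]reprK; apply/L1_eqP/wnullP.
by apply: filterS ab => x abx; rewrite -[LHS]/(repr a x - repr b x) abx subrr.
Qed.

Lemma repr_linear (k : R[i]) (a b : L1 mu w) :
  {ae mu, forall x, repr (k *: a + b) x = k * repr a x + repr b x}.
Proof.
apply: (@repr_ae (k *: repr a + repr b)).
rewrite pi_L1D -L1_scale_pi -[k *: a]/(L1_scale k a) -[in LHS](reprK a) -[in LHS](reprK b).
by rewrite !reprK.
Qed.

Lemma L1_normE (a : L1 mu w) : `|a| = (fine (wnorm mu w (repr a)))%:C%C.
Proof. by []. Qed.

End L1Facts.

(** * The derivation on classes and the obstruction to being inner *)

Section NotWeaklyAmenable.
Local Open Scope quotient_scope.
Context {R : realType} {G : topologicalGroupType}.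
Context {mu : {measure set (borel G) -> \bar R}} {w : weight G R}.
Hypothesis hG : hausdorff_space G.
Hypothesis lcG : locally_compact [set: G].
Hypothesis Hmu : left_Haar_measure mu.
Context {U : set G}.
Hypothesis cU : compact U.
Hypothesis U1 : nbhs 1%g U.
Hypothesis UC : forall x y, U (x * y)%g -> U (y * x)%g.

Let wsum := @wsum R G mu w.
Let L := L1 mu w.

(** Existence of the convolution excludes the default value of [xget]. *)
Lemma L1_convP (a b : L) : is_convolution mu (repr a) (repr b) (repr (L1_conv a b)).
Proof.
have [h wh abh] := conv_exists hG lcG Hmu cU U1 UC _ _ (wsum_repr a) (wsum_repr b).
have hc := repr_ae (wfun_of h wh) (\pi_L (wfun_of h wh)) erefl.
apply: (@xgetPex _ 0 [set c : L | is_convolution mu (repr a) (repr b) (repr c)]).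
exists (\pi_L (wfun_of h wh)) => /=.
by apply: (ae_imp2 abh hc) => x [iF hx] ->.
Qed.

(** Any representatives compute the convolution, as soon as the first vanishes off a sigma-compact
    set: there, null sets of the second are controlled through [y -> y^-1 x]. *)
Lemma conv_version (a b : L) (f g : borel G -> R[i]) (A : set G) :
  cmeasurable f -> cmeasurable g -> {ae mu, forall x, repr a x = f x} ->
  {ae mu, forall x, repr b x = g x} -> sigma_compact A -> (forall x, ~ A x -> f x = 0) ->
  {ae mu, forall x : G, repr (L1_conv a b) x =
     cintegral mu (fun y : borel G => f y * g ((y : G)^-1 * x)%g)}.
Proof.
move=> mf mg af bg sA f0; have [ma _] := wsum_repr a; have [mb _] := wsum_repr b.
apply: (ae_imp (L1_convP a b)) => x [_ ->].
have mp (p q : borel G -> R[i]) : cmeasurable p -> cmeasurable q ->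
    cmeasurable (fun y : borel G => p y * q ((y : G)^-1 * x)%g).
  by move=> mp mq; apply: cmeasurableM => //; exact: cmeasurable_comp (invl_borel x) mq.
apply: ae_eq_cintegral; [exact: mp|exact: mp|].
have bgx := ae_invl_sigma hG lcG Hmu cU U1 UC A (fun z => repr b z = g z) x sA bg.
apply: filterS2 af bgx => y -> bgy.
by have [Ay|nAy] := pselect (A y); [rewrite bgy|rewrite f0// !mul0r].
Qed.

Context {W : set G}.
Hypothesis cW : compact W.
Hypothesis WC : forall x y, W (x * y)%g -> W (y * x)%g.
Hypothesis UW : forall u v, U u -> U v -> W (u * v)%g.
Context {Phi : G -> R[i]} {M1 M2 : R}.
Hypothesis mPhi : cmeasurable (Phi : baire R G -> R[i]).
Hypothesis PhiM : forall x y, Phi (x * y)%g = Phi x + Phi y.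
Hypothesis WM1 : forall x y, W (x * y)%g -> 1 <= M1 * (w x * w y).
Hypothesis WM2 : forall x y, W (x * y)%g -> normc (Phi x) <= M2 * (w x * w y).
Hypothesis M10 : 0 <= M1.
Hypothesis M20 : 0 <= M2.

Let df (f g : borel G -> R[i]) : R[i] := @dform R G mu W Phi f g.

Definition deriv (a c : L) : R[i]^o := df (repr a) (repr c).

Lemma deriv_bound (a c : L) : `|deriv a c| <= (4 * M2)%:C%C * `|a| * `|c|.
Proof.
have [_ le] := dform_bound hG lcG Hmu cU cW mPhi WM1 WM2 M10 M20 _ _ (wsum_repr a) (wsum_repr c).
by rewrite !L1_normE normcE -!rmorphM /= lecR.
Qed.

Lemma derivDl (k : R[i]) (a b c : L) : deriv (k *: a + b) c = k * deriv a c + deriv b c.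
Proof.
rewrite /deriv /df -(dformDl hG lcG Hmu cU cW mPhi WM1 WM2 M10 M20); [|exact: wsum_repr..].
apply: (dform_ae hG lcG Hmu cU cW mPhi).
- exact: wsum_repr.
- by apply: wsumD; exact: wsum_repr.
- exact: wsum_repr.
- exact: wsum_repr.
- exact: repr_linear.
- exact: aeW.
Qed.

Lemma derivDr (k : R[i]) (a b c : L) : deriv a (k *: b + c) = k * deriv a b + deriv a c.
Proof.
rewrite /deriv /df -(dformDr hG lcG Hmu cU cW mPhi WM1 WM2 M10 M20); [|exact: wsum_repr..].
apply: (dform_ae hG lcG Hmu cU cW mPhi).
- exact: wsum_repr.
- exact: wsum_repr.
- exact: wsum_repr.
- by apply: wsumD; exact: wsum_repr.
- exact: aeW.
- exact: repr_linear.
Qed.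

Lemma derivBl (a b c : L) : deriv a c - deriv b c = deriv (a - b) c.
Proof.
have -> : a - b = (-1) *: b + a by rewrite scaleN1r addrC.
by rewrite derivDl mulN1r addrC.
Qed.

Lemma derivBr (a b c : L) : deriv a b - deriv a c = deriv a (b - c).
Proof.
have -> : b - c = (-1) *: c + b by rewrite scaleN1r addrC.
by rewrite derivDr mulN1r addrC.
Qed.

Lemma deriv_continuous_derivation : continuous_derivation (@L1_conv R G mu w) deriv.
Proof.
have M40 : 0 <= (4 * M2)%:C%C :> R[i] by rewrite lecR mulr_ge0.
split.
- move=> a; split; first by move=> k b c; exact: derivDr.
  apply: (@bounded_additive_continuous _ _ _ _ ((4 * M2)%:C%C * `|a|)).
    by rewrite mulr_ge0.
  by move=> b c; rewrite derivBr; exact: deriv_bound.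
- by move=> k a b; apply/funext => c; exact: derivDl.
- move=> a e e0.
  have C1 : 0 < (4 * M2)%:C%C + 1 :> R[i] by rewrite ltr_wpDl.
  have d0 : 0 < e / ((4 * M2)%:C%C + 1) by rewrite divr_gt0.
  have : \forall b \near a, `|a - b| < e / ((4 * M2)%:C%C + 1).
    by apply: (@cvgr_dist_lt _ _ _ (nbhs a) _ idfun a) => //; exact: cvg_id.
  apply: filterS => b ab x; rewrite derivBl; apply: (le_trans (deriv_bound _ _)).
  rewrite ler_wpM2r// distrC.
  apply: (@le_trans _ _ (((4 * M2)%:C%C + 1) * `|a - b|)); first by rewrite ler_wpM2r// lerDl.
  by rewrite mulrC -ler_pdivlMr// ltW.
- move=> a b; apply/funext => c.
  apply: (dform_derivation hG lcG Hmu cU U1 UC cW WC mPhi PhiM WM1 WM2 M10 M20);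
    by [exact: wsum_repr|exact: L1_convP].
Qed.

Let bU : measurable (U : set (borel G)). Proof. exact: compact_borel. Qed.

(** This is [t^-1 U], so [ind t] belongs to [t^-1 U] and [ind t^-1] to [t U]. *)
Let shiftU (t : G) : set G := [set x | U (t * x)%g].

Let cshiftU t : compact (shiftU t).
Proof.
rewrite (_ : shiftU t = [set (t^-1 * x)%g | x in U]).
  by apply: (compact_image (fun x => t^-1 * x)%g) => //; exact: continuous_lmulg.
apply/seteqP; split => [x Ux|_ [x Ux <-]]; first by exists (t * x)%g; rewrite ?mulKg.
by rewrite /shiftU /= mulVKg.
Qed.

Let ind (t : G) (x : borel G) : R[i] := (\1_(shiftU t) x : R)%:C%C.

Let mind t : cmeasurable (ind t).
Proof. by apply: cmeasurable_indic; exact: compact_borel. Qed.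

Let fin_compact (K : set G) : compact K -> mu K \is a fin_num.
Proof. by move=> cK; rewrite ge0_fin_numE// (haar_compact Hmu _ cK). Qed.

Let wind t : wsum (ind t).
Proof.
split; first exact: mind.
have [M M0 wM] := continuous_compact_le _ _ (cshiftU t) (@weight_continuous _ _ w).
have bUt : measurable (shiftU t : set (borel G)) by exact: compact_borel.
apply: (@le_lt_trans _ _ (\int[mu]_x (M%:E * (\1_(shiftU t) x)%:E))%E).
  apply: ge0_le_integral => //.
  - by move=> x _; exact: wnorm_integrand_ge0.
  - exact: measurable_wnorm.
  - by apply/measurable_EFinP; apply: measurable_funM => //; exact: measurable_indic.
  move=> x _; rewrite -EFinM lee_fin normc_real ger0_norm// indicE.
  case: (boolP (_ \in _)) => [/set_mem/wM|_]; last by rewrite mul0r mulr0.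
  by rewrite mul1r mulr1.
rewrite ge0_integralZl//; last by apply/measurable_EFinP; exact: measurable_indic.
rewrite integral_indic// setIT; apply: lte_mul_pinfty => //.
exact: haar_compact.
Qed.

Let lind t : L := \pi_L (wfun_of (ind t) (wind t)).

Let ind_ae t : {ae mu, forall x, repr (lind t) x = ind t x}.
Proof. exact: (repr_ae (wfun_of (ind t) (wind t))). Qed.

Let cintegral_indic (A : set G) : compact A ->
  cintegral mu (fun x : borel G => (\1_A x : R)%:C%C) = (fine (mu A))%:C%C.
Proof.
move=> cA; rewrite /cintegral /Rintegral /= integral0 /=.
by rewrite integral_indic ?setIT//; exact: compact_borel.
Qed.

Let clU : closed U. Proof. exact: compact_closed. Qed.

Let convU (s t : G) : {ae mu, forall x : G, repr (L1_conv (lind s) (lind t)) x =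
  (fine (mu [set y | U (s * y)%g /\ U (t * (y^-1 * x))%g]))%:C%C}.
Proof.
have ind0 x : ~ shiftU s x -> ind s x = 0 by move=> nUx; rewrite /ind indicE memNset.
apply: (ae_imp (conv_version (lind s) (lind t) (ind s) (ind t) (shiftU s) (mind s) (mind t)
  (ind_ae s) (ind_ae t) (compact_sigma_compact _ (cshiftU s)) ind0)) => x ->.
rewrite -cintegral_indic; last first.
  rewrite (_ : [set y | _] = shiftU s `&` ((fun y => t * (y^-1 * x))%g @^-1` U)).
    apply: compact_closedI => //; apply: closed_comp => // y _.
    apply: continuous_mulg; first by move=> ?; exact: cvg_cst.
    apply: continuous_mulg; last by move=> ?; exact: cvg_cst.
    by apply: continuous_invg => ?; exact: cvg_id.
  by [].
apply: eq_cintegral => y; rewrite /ind !indicE -rmorphM /=; congr _%:C%C.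
rewrite -natrM mulnb; congr (nat_of_bool _)%:R; apply/idP/idP.
  by move=> /andP[/set_mem ? /set_mem ?]; apply: mem_set.
by move=> /set_mem[? ?]; apply/andP; split; apply: mem_set.
Qed.

Let measurable_pre (A : set G) (s : G -> G) : continuous s ->
  measurable (A : set (borel G)) -> measurable (s @^-1` A : set (borel G)).
Proof. by move=> cs mA; have := continuous_borel _ cs measurableT _ mA; rewrite setTI. Qed.

(** At each [x] both sides are measures of sets of [y]. The substitution [y -> t y] carries one of
    them to [B], and [y -> t y t^-2], a left translation combined with the conjugation by [t^2],
    carries the other to the same [B], thanks to the conjugation invariance of [U]. *)
Lemma conv_commute t : L1_conv (lind t^-1%g) (lind t) = L1_conv (lind t) (lind t^-1%g).
Proof.
apply: L1_ext.
apply: (ae_imp2 (convU t^-1%g t) (convU t t^-1%g)) => x -> ->.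
congr (fine _)%:C%C.
have cx : continuous (fun y : G => t^-1 * (y^-1 * (t * x)))%g.
  apply: continuous_mulg; first by move=> ?; exact: cvg_cst.
  apply: continuous_mulg; last by move=> ?; exact: cvg_cst.
  by apply: continuous_invg => ?; exact: cvg_id.
pose B : set G := U `&` (fun y => t^-1 * (y^-1 * (t * x)))%g @^-1` U.
have cB : compact B by apply: compact_closedI => //; apply: closed_comp => // y _; exact: cx.
have mB : measurable (B : set (borel G)) by exact: compact_borel.
have UJ s y : U (s * y * s^-1)%g <-> U y.
  by split=> [/UC|Uy]; [rewrite mulKg|apply: UC; rewrite mulKg].
have cconj s : continuous (fun y : G => s * y * s^-1)%g.
  apply: continuous_mulg; last by move=> ?; exact: cvg_cst.
  exact: continuous_lmulg.
transitivity (mu B); last first.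
  rewrite -[LHS](haar_left Hmu t B mB); congr (mu _).
  have E y : (t^-1 * ((t * y)^-1 * (t * x)) = t^-1 * (y^-1 * x))%g.
    by rewrite invgM -!mulgA mulKg.
  by apply/seteqP; split => y; rewrite /B /= E.
rewrite -(haar_conj hG lcG Hmu cU U1 UC B (t * t)%g cB).
rewrite -[RHS](haar_left Hmu t^-1%g); last exact: (measurable_pre _ _ (cconj (t * t)%g) mB).
congr (mu _).
have E1 y : (t * t * (t^-1 * y) * (t * t)^-1 = t * (y * t^-1) * t^-1)%g.
  by rewrite invgM -!mulgA mulVKg.
have E2 y : (t^-1 * ((t * t * (t^-1 * y) * (t * t)^-1)^-1 * (t * x)) = t * (y^-1 * x))%g.
  by rewrite E1 !invgM !invgK -!mulgA !mulKg.
apply/seteqP; split => y; rewrite /B /= E2 E1 => -[Uy Uyx]; split => //.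
  by apply/UJ; exact: UC.
by apply: UC; exact/(UJ t).
Qed.

Let m : R[i] := (fine (mu U))%:C%C.

Let haar_shiftU t : mu (shiftU t) = mu U.
Proof. exact: haar_left. Qed.

Let lmulE t x : ind t^-1%g (t * x)%g = ind 1%g x.
Proof.
rewrite /ind !indicE; congr (nat_of_bool _)%:R%:C%C.
by apply/idP/idP => /set_mem h; apply: mem_set; move: h; rewrite /shiftU /= mulKg mul1g.
Qed.

(** For [x] in [tU] and [y] in [t^-1 U], the product [x y = (x t^-1)(t y)] lies in [U U], so the
    indicator function of [W] is [1] on the whole range of integration. *)
Let chint_ind t (x : G) : U (t^-1 * x)%g -> @chint R G mu W (ind t) x = m.
Proof.
move=> Utx; rewrite /m -(haar_shiftU t) -cintegral_indic//.
apply: eq_cintegral => y; rewrite /ind !indicE; have [Uy|nUy] := pselect (shiftU t y); last first.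
  by rewrite (memNset nUy) mul0r.
rewrite (mem_set Uy) mem_set ?mulr1//=.
have UJ : U (x * t^-1)%g by exact: UC.
by have := UW _ _ UJ Uy; rewrite -mulgA mulKg.
Qed.

Let dform_ind t : df (ind t^-1%g) (ind t) =
  cintegral mu (fun x : borel G => ind t^-1%g x * (Phi x * m)).
Proof.
apply: eq_cintegral => x; rewrite {1 3}/ind !indicE.
case: (boolP (_ \in _)) => [/set_mem Ux|_]; last by rewrite !mul0r.
by rewrite chint_ind.
Qed.

(** The substitution [x -> t x] brings [tU] back to [U] and turns [Phi x] into [Phi t + Phi x]. *)
Let dform_ind1 t : df (ind t^-1%g) (ind t) = Phi t * (m * m) + df (ind 1%g) (ind 1%g).
Proof.
have mPhib := cmeasurable_borel _ mPhi.
have mF (s : G) : cmeasurable (fun x : borel G => ind s x * (Phi x * m)).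
  by apply: cmeasurableM => //; apply: cmeasurableM => //; exact: cmeasurable_cst.
have D1 := dform_ind 1%g; rewrite invg1 in D1; rewrite D1 dform_ind {D1}.
have mE : m = cintegral mu (ind 1%g) by rewrite /m -(haar_shiftU 1%g) -cintegral_indic.
have iind : cintegrable mu (ind 1%g).
  apply/cintegrableP; split; first exact: mind.
  under eq_integral do rewrite normc_real ger0_norm//.
  rewrite integral_indic ?setIT//; last exact: compact_borel.
  exact: haar_compact.
have i1 : cintegrable mu (fun x : borel G => ind 1%g x * (Phi x * m)).
  have [i _] := dform_bound hG lcG Hmu cU cW mPhi WM1 WM2 M10 M20 _ _ (wind 1%g) (wind 1%g).
  move: i; congr cintegrable; apply/funext => x; rewrite {1 3}/ind !indicE.
  case: (boolP (_ \in _)) => [/set_mem Ux|_]; last by rewrite !mul0r.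
  by rewrite chint_ind// invg1.
transitivity (cintegral mu (fun x : borel G => ind t^-1%g (t * (x : G))%g * (Phi (t * x)%g * m))).
  symmetry; apply: (cintegral_preserving mu (fun x : borel G => (t * (x : G))%g : borel G)
    (fun x => ind t^-1%g x * (Phi x * m))) => //.
    exact: lmul_borel.
  by move=> A mA; exact: haar_left.
(* One of the two factors [m] is written as the integral of the indicator function of [U], so that
   both terms merge into one integral. *)
rewrite {3}mE mulrA -cintegral_Z// -cintegral_D//; last exact: cintegrableZ.
by apply: eq_cintegral => x; rewrite lmulE PhiM; ring.
Qed.

Lemma not_weakly_amenable (t : G) : Phi t <> 0 -> ~ weakly_amenable (@L1_conv R G mu w).
Proof.
move=> Phit /(_ deriv deriv_continuous_derivation)[phi _ dphi].
have df0 s : df (ind s^-1%g) (ind s) = 0.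
  transitivity (deriv (lind s^-1%g) (lind s)).
    apply: (dform_ae hG lcG Hmu cU cW mPhi).
    - exact: wind.
    - exact: wsum_repr.
    - exact: wind.
    - exact: wsum_repr.
    - by apply: filterS (ind_ae s^-1%g) => x ->.
    - by apply: filterS (ind_ae s) => x ->.
  rewrite dphi /= -[LHS]/(lact (@L1_conv R G mu w) (lind s^-1%g) phi (lind s) -
    ract (@L1_conv R G mu w) phi (lind s^-1%g) (lind s)).
  by rewrite /lact /ract conv_commute subrr.
(* At [1] the common term vanishes, which leaves [Phi t * (m * m) = 0]. *)
have D1 := df0 1%g; rewrite invg1 in D1.
have := dform_ind1 t; rewrite df0 D1 addr0 => /esym/eqP.
rewrite !mulf_eq0 orbb => /orP[/eqP//|]; rewrite /m eq_complex /= eqxx andbT.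
rewrite fine_eq0 ?fin_compact// => /eqP.
exact: haar_nbhs_neq0 cU U1.
Qed.

End NotWeaklyAmenable.

(** * The data of the construction obtained from the IN group *)

Lemma continuous_complex_baire {R : realType} {G : topologicalGroupType}
    (Phi : G -> R[i]^o) : continuous Phi -> cmeasurable (Phi : baire R G -> R[i]).
Proof.
move=> cPhi.
have part (r : R[i] -> R) : (forall z t, `|r z - r t| <= normc (z - t)) ->
    measurable_fun setT (fun x : baire R G => r (Phi x)).
  move=> rn; apply: continuous_measurable_baire => x; apply/cvgrPdist_lt => e e0.
  have e0' : 0 < e%:C%C :> R[i] by rewrite ltcR.
  have near := @cvgr_dist_lt _ _ _ (nbhs x) _ Phi (Phi x) (cPhi x) _ e0'.
  apply: (@filterS _ _ (nbhs_filter x) _ _ _ (near _)) => y; rewrite normcE ltcR.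
  exact: le_lt_trans.
split; apply: part => z t.
  by rewrite (_ : _ - _ = complex.Re (z - t)) ?Re_normc//; case: z t => ? ? [].
by rewrite (_ : _ - _ = complex.Im (z - t)) ?Im_normc//; case: z t => ? ? [].
Qed.

Theorem theorem2p2 (R : realType) (G : topologicalGroupType)
    (mu : {measure set (borel G) -> \bar R}) (w : weight G R)
    (Phi : G -> R[i]^o)
    (G_hausdorff : hausdorff_space G)
    (G_locally_compact : locally_compact [set: G])
    (G_IN : IN_group G)
    (mu_Haar : left_Haar_measure mu)
    (Phi_continuous : continuous Phi)
    (Phi_morphism : forall x y : G, Phi (x * y)%g = Phi x + Phi y)
    (Phi_nontrivial : exists t : G, Phi t <> 0)
    (Phi_bounded :
      (ereal_sup [set (normc (Phi t) / (w t * w t^-1%g))%:E | t in [set: G]]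
         < +oo)%E) :
  ~ weakly_amenable (@L1_conv R G mu w).
Proof.
have [U [cU U1 UJ]] := G_IN.
have UJ' g u : U u -> U (g * u * g^-1)%g by move=> Uu; rewrite -(UJ g); exists u.
have UC x y : U (x * y)%g -> U (y * x)%g by move=> /(UJ' y); rewrite !mulgA mulgK.
pose W : set G := [set (p.1 * p.2)%g | p in U `*` U].
have cW : compact W by exact: compact_mulg.
have UW u v : U u -> U v -> W (u * v)%g by move=> Uu Uv; exists (u, v).
have WC x y : W (x * y)%g -> W (y * x)%g.
  (* If [x y = u v], then [y x = y (x y) y^-1] is the product of the conjugates of [u] and [v] by
     [y]. *)
  move=> [[u v] /= [Uu Uv] uvE].
  rewrite (_ : (y * x)%g = ((y * u * y^-1) * (y * v * y^-1))%g); first by apply: UW; exact: UJ'.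
  by rewrite !mulgA mulgVK -(mulgA y u) uvE !mulgA mulgK.
have w0 x := weight_gt0 w x.
(* A bound for the weight on the compact set [W^-1]. *)
have [M M0 WM] : exists2 M, 0 <= M & forall u, W u -> w u^-1%g <= M.
  apply: continuous_compact_le => // u; apply: continuous_comp.
    exact: invg_continuous.
  exact: weight_continuous.
have [C C0 PhiC] : exists2 C, 0 <= C & forall t, normc (Phi t) <= C * (w t * w t^-1%g).
  move: Phi_bounded; set s := ereal_sup _ => soo.
  have sub t : ((normc (Phi t) / (w t * w t^-1%g))%:E <= s)%E.
    by apply: ereal_sup_ubound; exists t.
  have q0 t : 0 <= normc (Phi t) / (w t * w t^-1%g).
    by rewrite divr_ge0 ?normc_ge0// mulr_ge0// ltW.
  have s0 : (0 <= s)%E by apply: le_trans (sub 1%g); rewrite lee_fin.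
  have sfin : s \is a fin_num by rewrite ge0_fin_numE.
  exists (fine s) => [|t]; first exact: fine_ge0.
  by rewrite -ler_pdivrMr ?mulr_gt0// -lee_fin fineK.
have wV x y : W (x * y)%g -> w x^-1%g <= w y * M.
  move=> Wxy.
  rewrite (_ : x^-1%g = (y * (x * y)^-1)%g); last by rewrite invgM mulVKg.
  by apply: (le_trans (weight_submul w _ _)); rewrite (ler_pM2l (w0 y)) WM.
have [t Phit] := Phi_nontrivial.
(* [M / w 1] comes from [w 1 <= w ((x y)^-1) w (x y) <= M w x w y], and [C * M] from
   [C w x w (x^-1)] with [w (x^-1) <= w y M]. *)
apply: (@not_weakly_amenable R G mu w G_hausdorff G_locally_compact mu_Haar U cU U1 UC
  W cW WC UW Phi (M / w 1%g) (C * M) _ Phi_morphism _ _ _ _ t Phit).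
- exact: continuous_complex_baire.
- move=> x y Wxy; rewrite mulrAC ler_pdivlMr// mul1r.
  rewrite -[X in w X <= _](mulVg (x * y)%g).
  apply: (le_trans (weight_submul w _ _)); apply: ler_pM; rewrite ?(ltW (w0 _))//.
    exact: WM.
  exact: weight_submul.
- move=> x y Wxy; apply: (le_trans (PhiC x)).
  by rewrite -mulrA ler_wpM2l// mulrCA ler_wpM2l ?(ltW (w0 _))// mulrC wV.
- by rewrite divr_ge0// ltW.
- by rewrite mulr_ge0.
Qed.
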